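(* Let $(\mathcal A,\varphi)$ be a probability space equipped with a representation $\rho:\mathbb B_\infty\to\mathrm{Aut}(\mathcal A,\varphi)$ having the generating property, let $\mathcal A_{n-1}^\rho:=\mathcal A^{\rho(\mathbb B_{n+1,\infty})}$ for $n\in\mathbb N_0$, and let $\alpha$ be the endomorphism of $\mathcal A$ given by $\alpha(x)=\lim_{n\to\infty}\rho(\sigma_1\sigma_2\cdots\sigma_n)(x)$ (limit in the strong operator topology). Then one obtains a triangular tower of inclusions such that each cell forms a commuting square: $$\begin{matrix} \mathcal A_{-1}^\rho&\subset&\mathcal A_0^\rho&\subset&\mathcal A_1^\rho&\subset&\mathcal A_2^\rho&\subset&\cdots&\subset&\mathcal A\\ &&\cup&&\cup&&\cup&&&&\cup\\ &&\mathcal A_{-1}^\rho&\subset&\alpha(\mathcal A_0^\rho)&\subset&\alpha(\mathcal A_1^\rho)&\subset&\cdots&\subset&\alpha(\mathcal A)\\ &&&&\cup&&\cup&&&&\cup\\ &&&&\mathcal A_{-1}^\rho&\subset&\alpha^2(\mathcal A_0^\rho)&\subset&\cdots&\subset&\alpha^2(\mathcal A)\\ &&&&&&\cup&&&&\cup\\ &&&&&&\vdots&&&&\vdots \end{matrix}$$ That is, $\alpha(\mathcal A_{-1}^\rho)=\mathcal A_{-1}^\rho$, all displayed inclusions hold, and for all $k,n\in\mathbb N_0$ the squares $$\begin{matrix}\alpha^{k}(\mathcal A_{n}^\rho)&\subset&\alpha^{k}(\mathcal A_{n+1}^\rho)\\ \cup&&\cup\\ \alpha^{k+1}(\mathcal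 A_{n-1}^\rho)&\subset&\alpha^{k+1}(\mathcal A_{n}^\rho)\end{matrix}\qquad\text{and}\qquad\begin{matrix}\alpha^{k}(\mathcal A_{n}^\rho)&\subset&\alpha^{k}(\mathcal A)\\ \cup&&\cup\\ \alpha^{k+1}(\mathcal A_{n-1}^\rho)&\subset&\alpha^{k+1}(\mathcal A)\end{matrix}$$ are commuting squares.
   Context: A probability space $(\mathcal A,\varphi)$ is a von Neumann algebra $\mathcal A$ with separable predual together with a faithful normal state $\varphi$. $\mathrm{Aut}(\mathcal A,\varphi)$ is the group of $\varphi$-preserving automorphisms of $\mathcal A$; $\mathbb N_0=\{0,1,2,\dots\}$. $\mathbb B_\infty$ is generated by $\sigma_1,\sigma_2,\dots$ subject to $\sigma_i\sigma_j\sigma_i=\sigma_j\sigma_i\sigma_j$ if $|i-j|=1$ and $\sigma_i\sigma_j=\sigma_j\sigma_i$ if $|i-j|>1$; $\mathbb B_{n,\infty}:=\langle\sigma_k\mid n\le k<\infty\rangle$, and $\mathcal A^{\rho(\mathbb B_{n,\infty})}$ is the fixed point algebra of $\rho(\mathbb B_{n,\infty})$. The representation $\rho$ has the generating property if $\mathcal A$ is the von Neumann algebra generated by $\bigcup_{n}\mathcal A_n^\rho$. Under the generating property the limit defining $\alpha$ exists pointwise in $\mathcal A$ and $\alpha$ is a $\varphi$-preserving endomorphism of $\mathcal A$. For a von Neumann subalgebra $\mathcal B$ for which it exists, $E_{\mathcal B}$ denotes the $\varphi$-preserving conditional expectation of $\mathcal A$ onto $\mathcal B$; $\mathcal B$ is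 then called $\varphi$-conditioned (all algebras in the tower are $\varphi$-conditioned). A square of inclusions of $\varphi$-conditioned subalgebras $$\begin{matrix}\mathcal N_2&\subset&\mathcal P\\ \cup&&\cup\\ \mathcal N&\subset&\mathcal N_1\end{matrix}$$ is a commuting square if $E_{\mathcal N_1}E_{\mathcal N_2}=E_{\mathcal N}$. *)

(* Defs.v *)
From HB Require Import structures.
From mathcomp Require Import all_boot all_order all_algebra.
From mathcomp Require Import all_classical all_reals all_analysis.
From mathcomp Require Import generic_quotient complex.
Set Implicit Arguments.
Unset Strict Implicit.
Unset Printing Implicit Defensive.
Import Order.TTheory GRing.Theory Num.Theory.
Import numFieldNormedType.Exports.
Local Open Scope classical_set_scope.
Local Open Scope ring_scope.
Local Open Scope complex_scope.

(* The braid group on infinitely many strands, as a quotient of the monoid of *)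
(* words in letters (i, false), standing for the generator sigma i, and       *)
(* (i, true), standing for its inverse. Generators are indexed from 0, so     *)
(* that sigma i is the usual sigma_(i+1).                                     *)
Section BraidGroup.
Local Open Scope seq_scope.

Definition braid_word := seq (nat * bool).

Inductive braid_rel : braid_word -> braid_word -> Prop :=
| braid_rel_refl u : braid_rel u u
| braid_rel_sym u v : braid_rel u v -> braid_rel v u
| braid_rel_trans u v w : braid_rel u v -> braid_rel v w -> braid_rel u w
| braid_rel_cat u u' v v' :
    braid_rel u u' -> braid_rel v v' -> braid_rel (u ++ v) (u' ++ v')
| braid_rel_cancel i b : braid_rel [:: (i, b); (i, ~~ b)] [::]
| braid_rel_braid i j : (i.+1 == j) || (j.+1 == i) ->
    braid_rel [:: (i, false); (j, false); (i, false)]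
              [:: (j, false); (i, false); (j, false)]
| braid_rel_comm i j : (i.+1 < j)%N || (j.+1 < i)%N ->
    braid_rel [:: (i, false); (j, false)] [:: (j, false); (i, false)].

Definition braid_relb : rel braid_word := fun u v => `[< braid_rel u v >].

Lemma braid_relb_refl : reflexive braid_relb.
Proof. by move=> u; apply/asboolP; exact: braid_rel_refl. Qed.

Lemma braid_relb_sym : symmetric braid_relb.
Proof. by move=> u v; apply/asboolP/asboolP; exact: braid_rel_sym. Qed.

Lemma braid_relb_trans : transitive braid_relb.
Proof.
move=> v u w /asboolP uv /asboolP vw; apply/asboolP.
exact: braid_rel_trans uv vw.
Qed.

Canonical braid_equiv :=
  EquivRel braid_relb braid_relb_refl braid_relb_sym braid_relb_trans.

Definition braid_group := {eq_quot braid_equiv}%qT.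
HB.instance Definition _ := Choice.on braid_group.

Definition braid_class (u : braid_word) : braid_group := (\pi u)%qT.

Definition word_inv (u : braid_word) : braid_word :=
  rev [seq (l.1, ~~ l.2) | l <- u].

Definition braid_one : braid_group := braid_class [::].
Definition braid_mul (g h : braid_group) : braid_group :=
  braid_class (repr g ++ repr h).
Definition braid_inv (g : braid_group) : braid_group :=
  braid_class (word_inv (repr g)).

Lemma braid_classP u v : braid_class u = braid_class v <-> braid_rel u v.
Proof.
by split=> [/eqmodP/asboolP //|uv]; apply/eqmodP; exact/asboolP.
Qed.

Lemma braid_class_repr g : braid_class (repr g) = g.
Proof. exact: reprK. Qed.

Lemma braid_repr_class u : braid_rel (repr (braid_class u)) u.
Proof. by apply/braid_classP; exact: braid_class_repr. Qed.

Lemma braid_class_cat u v :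
  braid_class (u ++ v) = braid_mul (braid_class u) (braid_class v).
Proof.
by apply/braid_classP/braid_rel_cat; apply/braid_rel_sym/braid_repr_class.
Qed.

Lemma word_mulVg u : braid_rel (word_inv u ++ u) [::].
Proof.
elim: u => [|[i b] u IH]; first exact: braid_rel_refl.
rewrite /word_inv /= rev_cons cat_rcons.
apply: braid_rel_trans IH.
apply: braid_rel_cat; first exact: braid_rel_refl.
rewrite -[X in braid_rel _ X]cat0s -[_ :: _ :: u]/([:: _; _] ++ u).
apply: braid_rel_cat; last exact: braid_rel_refl.
by have := braid_rel_cancel i (~~ b); rewrite negbK.
Qed.

Lemma word_invK u : word_inv (word_inv u) = u.
Proof.
rewrite /word_inv map_rev revK -map_comp -[RHS]map_id.
by apply: eq_map => -[i b] /=; rewrite negbK.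
Qed.

Lemma word_mulgV u : braid_rel (u ++ word_inv u) [::].
Proof. by rewrite -{1}[u]word_invK; exact: word_mulVg. Qed.

Lemma braid_mulA : associative braid_mul.
Proof.
move=> g h k; rewrite -[g]braid_class_repr -[h]braid_class_repr.
by rewrite -[k]braid_class_repr -!braid_class_cat catA.
Qed.

Lemma braid_mul1g : left_id braid_one braid_mul.
Proof. by move=> g; rewrite -[g]braid_class_repr -braid_class_cat. Qed.

Lemma braid_mulg1 : right_id braid_one braid_mul.
Proof. by move=> g; rewrite -[g]braid_class_repr -braid_class_cat cats0. Qed.

Lemma braid_mulVg : left_inverse braid_one braid_inv braid_mul.
Proof.
move=> g; rewrite -{2}[g]braid_class_repr -braid_class_cat.
exact/braid_classP/word_mulVg.
Qed.

Lemma braid_mulgV : right_inverse braid_one braid_inv braid_mul.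
Proof.
move=> g; rewrite -{1}[g]braid_class_repr -braid_class_cat.
exact/braid_classP/word_mulgV.
Qed.

HB.instance Definition _ := isGroup.Build braid_group
  braid_mulA braid_mul1g braid_mulg1 braid_mulVg braid_mulgV.

Definition sigma (i : nat) : braid_group := braid_class [:: (i, false)].

Definition subgroup (S : set braid_group) : Prop :=
  [/\ S 1%g, (forall g h, S g -> S h -> S (g * h)%g) &
      (forall g, S g -> S (g^-1)%g)].

(* As sigma is indexed from 0, this is the group usually written B_(n+1,oo). *)
Definition braid_tail (n : nat) : set braid_group :=
  smallest subgroup [set sigma k | k in [set k | (n <= k)%N]].

End BraidGroup.

(* Operators on a complex Hilbert space H are functions H -> H, and operator  *)
(* algebras are sets of such functions. The inner product dot is linear in    *)
(* its first argument, as in sesquilinear.v. Maps between operator algebras   *)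
(* and functionals on them are total functions whose values outside the       *)
(* algebra are irrelevant.                                                    *)
Section VonNeumann.
Context {R : realType} {H : completeNormedModType R[i]}.
Variable dot : {dot H for Num.conj}.

Local Notation op := (H -> H).

Definition hilbert_norm : Prop := forall v : H, `|v| ^+ 2 = dot v v.

Definition bounded_op (x : op) : Prop := linear x /\ continuous x.

Definition adjoint (x y : op) : Prop :=
  forall v w, dot (x v) w = dot v (y w).

Definition positive_op (x : op) : Prop := forall v, 0 <= dot (x v) v.

Definition commutant (S : set op) : set op :=
  [set x | bounded_op x /\ forall y, S y -> x \o y = y \o x].

Definition star_closed (S : set op) : Prop :=
  forall x, S x -> exists2 y, S y & adjoint x y.

Definition von_neumann (M : set op) : Prop :=
  [/\ M `<=` bounded_op, star_closed M & commutant (commutant M) = M].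

Definition linear_on (M : set op) (V : lmodType R[i]) (f : op -> V) : Prop :=
  forall (a : R[i]) x y, M x -> M y -> f (a *: x + y) = a *: f x + f y.

Definition square_summable (xi : nat -> H) : Prop :=
  cvgn (series (fun i => `|xi i| ^+ 2)).

(* The predual of M: functionals sum_i <x xi_i, eta_i> with xi, eta in l2(H), *)
(* that is, the ultraweakly continuous ones.                                  *)
Definition normal_functional (M : set op) (psi : op -> R[i]) : Prop :=
  exists xi eta : nat -> H,
    [/\ square_summable xi, square_summable eta &
        forall x, M x ->
          series (fun i => dot (x (xi i)) (eta i)) @ \oo -->
            (psi x : (R[i] : numFieldType))].

(* There is a sequence dense in the predual for the norm                      *)
(* sup {|psi x| : x in M, ||x|| <= 1}.                                        *)
Definition separable_predual (M : set op) : Prop :=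
  exists2 psi : nat -> op -> R[i],
    (forall k, normal_functional M (psi k)) &
    forall theta, normal_functional M theta ->
      forall e : R, 0 < e -> exists k, forall x, M x ->
        (forall v, `|x v| <= `|v|) -> `|theta x - psi k x| <= e%:C.

Definition faithful_normal_state (M : set op) (phi : op -> R[i]) : Prop :=
  [/\ linear_on M (phi : op -> R[i]^o),
      (forall x y, M x -> M y -> adjoint x y -> 0 <= phi (y \o x)),
      phi idfun = 1,
      (forall x y, M x -> M y -> adjoint x y -> phi (y \o x) = 0 -> x = 0) &
      normal_functional M phi].

Definition probability_space (A : set op) (phi : op -> R[i]) : Prop :=
  [/\ von_neumann A, separable_predual A & faithful_normal_state A phi].

Definition automorphism (A : set op) (phi : op -> R[i]) (f : op -> op) : Prop :=
  [/\ set_bij A A f,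
      linear_on A f,
      (forall x y, A x -> A y -> f (x \o y) = f x \o f y),
      (forall x y, A x -> A y -> adjoint x y -> adjoint (f x) (f y)) &
      (forall x, A x -> phi (f x) = phi x)].

Definition representation (A : set op) (phi : op -> R[i])
    (rho : braid_group -> op -> op) : Prop :=
  (forall g, automorphism A phi (rho g)) /\
  (forall g h x, A x -> rho (g * h)%g x = rho g (rho h x)).

Definition fixed_points (A : set op) (rho : braid_group -> op -> op)
    (S : set braid_group) : set op :=
  [set x | A x /\ forall g, S g -> rho g x = x].

(* The tower starts at index -1 in the literature: this is A_(n-1)^rho. *)
Definition tower (A : set op) (rho : braid_group -> op -> op) (n : nat) :
    set op :=
  fixed_points A rho (braid_tail n).

Definition generating (A : set op) (rho : braid_group -> op -> op) : Prop :=
  smallest von_neumann (\bigcup_n tower A rho n) = A.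

(* The limit is in the strong operator topology, i.e. pointwise on H.         *)
Definition limit_endo (rho : braid_group -> op -> op) (x : op) : op :=
  get (fun y : op =>
    {ptws, (fun n => rho (\prod_(i < n) sigma i)%g x) @ \oo --> y}).

Definition conditional_expectation (A : set op) (phi : op -> R[i])
    (B : set op) (E : op -> op) : Prop :=
  [/\ (forall x, A x -> B (E x)) /\ (forall b, B b -> E b = b),
      linear_on A E,
      (forall x, A x -> positive_op x -> positive_op (E x)),
      (forall b x c, B b -> A x -> B c -> E (b \o x \o c) = b \o E x \o c) &
      (forall x, A x -> phi (E x) = phi x)].

Definition conditioned (A : set op) (phi : op -> R[i]) (B : set op) : Prop :=
  [/\ von_neumann B, B `<=` A &
      exists E, conditional_expectation A phi B E].

(* The square of inclusions   N2 <= P        *)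
(*                            N  <= N1 .     *)
Definition commuting_square (A : set op) (phi : op -> R[i])
    (N2 P N N1 : set op) : Prop :=
  [/\ [/\ conditioned A phi N2, conditioned A phi P, conditioned A phi N
        & conditioned A phi N1],
      [/\ N2 `<=` P, N `<=` N1, N `<=` N2 & N1 `<=` P] &
      forall E1 E2 E,
        conditional_expectation A phi N1 E1 ->
        conditional_expectation A phi N2 E2 ->
        conditional_expectation A phi N E ->
        forall x, A x -> E1 (E2 x) = E x].

End VonNeumann.

(* Main.v *)
Require Import Defs.
From mathcomp Require Import all_boot all_order all_algebra.
From mathcomp Require Import all_classical all_reals all_analysis.
From mathcomp Require Import complex ring lra.

(** Write T_n for the n-th fixed algebra (A_(n-1) in the usual numbering), beta_n
    for the automorphism rho(sigma_0 ... sigma_(n-1)), and <x, z> = phi(z^* x) for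
    the GNS form on A.

    A square commutes as soon as the expectation onto the lower right corner
    carries the upper left corner into the lower left one
    ([commuting_square_of_proj]). All squares are images under alpha^k of squares
    whose lower right corner is alpha(A) or contained in it, and the expectation
    onto alpha(A) is alpha o alpha', where alpha' is the adjoint of alpha for the
    GNS form. The braid relations give
      sigma_(k+1) (sigma_0 ... sigma_m) = (sigma_0 ... sigma_m) sigma_k  for k < m,
    so alpha intertwines rho(sigma_k) with rho(sigma_(k+1)). Hence alpha maps T_n
    into T_(n+1), its adjoint maps T_(n+1) into T_n ([dagger_tower]), and the
    expectation alpha o alpha' maps T_(n+1) into alpha(T_n), which is the claim
    ([tower_is_proj]).

    It remains to construct alpha, its adjoint and the expectations inside A.
    The tool is completeness: a norm bounded GNS-Cauchy sequence in A converges
    strongly in A ([gns_cauchy_sot]). Normality bounds the GNS norm by the l2(H)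
    norm of x |-> x u for one square-summable sequence u ([normal_dominated]); by
    faithfulness u is cyclic for the commutant of A ([cyclic_span_dense]), so
    convergence on u implies strong convergence, and a convexity argument turns
    this into a converse bound ([gns_small_strong]).

    Convexity then produces limits. Near-minimal points for the GNS norm in a
    decreasing sequence of convex sets form a Cauchy sequence ([extraction]). For
    the hull of an orbit the limit is the expectation onto the fixed points
    ([fixed_projectable]); for the hulls of the tails of beta_n^-1(x) it is
    alpha'(x) ([limit_dagger]). The bicommutant theorem in l2(H)
    ([bicommutant_gns]) shows that the range of such an expectation is a von
    Neumann algebra, and that the union of the T_n is GNS-dense; as beta_m is
    eventually constant on each T_n, the limit alpha exists on all of A
    ([endo_limit_ex]). Operator norms and positivity pass through
    *-endomorphisms because positive elements have square roots in A
    ([positive_sqrt], [endo_nbound]). *)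

Set Implicit Arguments.
Unset Strict Implicit.
Unset Printing Implicit Defensive.
Import Order.TTheory GRing.Theory Num.Theory.
Import numFieldNormedType.Exports.
Local Open Scope classical_set_scope.
Local Open Scope ring_scope.
Local Open Scope complex_scope.

Local Notation Re := complex.Re.
Local Notation Im := complex.Im.

(** * Null sequences *)

Section Null.
Context {R : realType}.
Implicit Types a b c : nat -> R.

(** The upper limit of a is at most 0; for nonnegative sequences, a tends to 0. *)
Definition null a := forall e : R, 0 < e -> \forall n \near \oo, a n < e.

Lemma null_le b a : (forall n, a n <= b n) -> null b -> null a.
Proof.
move=> ab nb e e0; near=> n; apply: le_lt_trans (ab n) _.
by near: n; exact: nb.
Unshelve. all: by end_near. Qed.

Lemma nullD a b : null a -> null b -> null (fun n => a n + b n).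
Proof.
move=> na nb e e0; near=> n; rewrite [e]splitr; apply: ltrD; near: n.
  by apply: na; rewrite divr_gt0.
by apply: nb; rewrite divr_gt0.
Unshelve. all: by end_near. Qed.

Lemma nullZ k a : 0 <= k -> null a -> null (fun n => k * a n).
Proof.
move=> k0 na e e0; have k1 : 0 < k + 1 by rewrite ltr_wpDl.
have := na (e / (k + 1)); rewrite divr_gt0 // => /(_ isT).
apply: filterS => n; rewrite ltr_pdivlMr // => h.
case: (ltP 0 (a n)) => an; first by nra.
by apply: le_lt_trans e0; rewrite mulr_ge0_le0.
Qed.

Lemma null_harmonic : null (fun n => n.+1%:R^-1).
Proof.
move=> e e0; have /cvgrPdist_lt/(_ e e0) := @cvg_harmonic R.
apply: filterS => n /=; rewrite sub0r normrN; apply: le_lt_trans.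
exact: ler_norm.
Qed.

Lemma null_cst0 x : null (fun=> x) -> x <= 0.
Proof.
move=> nx; rewrite leNgt; apply/negP => x0.
by have [N _ /(_ N (leqnn _))] := nx x x0; rewrite /= ltxx.
Qed.

Lemma null_cst_eq0 x : 0 <= x -> null (fun=> x) -> x = 0.
Proof. by move=> x0 /null_cst0 h; apply/eqP; rewrite eq_le h. Qed.

End Null.

(** * Positive semidefinite forms and minimisation over convex sets *)

Section PsdForm.
Context {R : realType} {V : lmodType R[i]}.
Implicit Types (D W : set V) (q : V -> V -> R) (y : nat -> V).

(** A real-valued semi-inner product on a complex subspace D: for the forms used
    here, the real part of a sesquilinear one. The values of q outside D are
    junk, so that q may be a limit that exists on D only. *)
Record psd_form D q : Prop := PsdForm {
  psd_closed : forall (a : R[i]) u v, D u -> D v -> D (a *: u + v);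
  psd_mem0 : D 0;
  psd_linear : forall (a : R) u v w, D u -> D v -> D w ->
    q (a%:C *: u + v) w = a * q u w + q v w;
  psd_sym : forall u v, D u -> D v -> q u v = q v u;
  psd_ge0 : forall u, D u -> 0 <= q u u }.

Definition form_cauchy q y := forall e : R, 0 < e -> exists M, forall n m,
  (M <= n)%N -> (M <= m)%N -> q (y n - y m) (y n - y m) < e.

Definition form_complete D q := forall y, (forall n, D (y n)) ->
  form_cauchy q y ->
  exists2 l, D l & null (fun n => q (y n - l) (y n - l)).

Context {D : set V} {q : V -> V -> R}.
Hypothesis pq : psd_form D q.
Implicit Types (a : R) (u v w : V).

Lemma psd_memD u v : D u -> D v -> D (u + v).
Proof. by move=> Du Dv; rewrite -[u]scale1r; exact: (psd_closed pq). Qed.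

Lemma psd_memZ (a : R[i]) u : D u -> D (a *: u).
Proof.
by move=> Du; rewrite -[_ *: _]addr0; apply: (psd_closed pq) => //; exact: psd_mem0 pq.
Qed.

Lemma psd_memN u : D u -> D (- u).
Proof. by move=> Du; rewrite -scaleN1r; exact: psd_memZ. Qed.

Lemma psd_memB u v : D u -> D v -> D (u - v).
Proof. by move=> Du Dv; apply: psd_memD => //; exact: psd_memN. Qed.

Lemma psdDl u v w : D u -> D v -> D w -> q (u + v) w = q u w + q v w.
Proof.
move=> Du Dv Dw; rewrite -[X in q (X + _) _]scale1r -[1]/(1%:C).
by rewrite (psd_linear pq) // mul1r.
Qed.

Lemma psd0l w : D w -> q 0 w = 0.
Proof.
move=> Dw; have D0 := psd_mem0 pq.
by have /eqP := psdDl D0 D0 Dw; rewrite addr0 -subr_eq0 opprD addrA subrr sub0r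
  oppr_eq0 => /eqP.
Qed.

Lemma psdZl a u w : D u -> D w -> q (a%:C *: u) w = a * q u w.
Proof.
move=> Du Dw; rewrite -[X in q X _]addr0 (psd_linear pq) ?psd0l ?addr0 //.
exact: psd_mem0 pq.
Qed.

Lemma psdNl u w : D u -> D w -> q (- u) w = - q u w.
Proof.
move=> Du Dw; have -> : - u = (-1)%:C *: u by rewrite rmorphN1 scaleN1r.
by rewrite psdZl // mulN1r.
Qed.

Lemma psdBl u v w : D u -> D v -> D w -> q (u - v) w = q u w - q v w.
Proof. by move=> Du Dv Dw; rewrite psdDl ?psdNl //; exact: psd_memN. Qed.

Lemma psdDr u v w : D u -> D v -> D w -> q w (u + v) = q w u + q w v.
Proof.
move=> Du Dv Dw; rewrite (psd_sym pq) ?psdDl //; last exact: psd_memD.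
by congr (_ + _); exact: (psd_sym pq).
Qed.

Lemma psdZr a u w : D u -> D w -> q w (a%:C *: u) = a * q w u.
Proof.
move=> Du Dw; rewrite (psd_sym pq) ?psdZl //; last exact: psd_memZ.
by congr (_ * _); exact: (psd_sym pq).
Qed.

Lemma psdBr u v w : D u -> D v -> D w -> q w (u - v) = q w u - q w v.
Proof.
move=> Du Dv Dw; rewrite (psd_sym pq) ?psdBl //; last exact: psd_memB.
by congr (_ - _); exact: (psd_sym pq).
Qed.

Lemma psdNr u w : D u -> D w -> q w (- u) = - q w u.
Proof.
move=> Du Dw; rewrite (psd_sym pq) ?psdNl //; last exact: psd_memN.
by congr (- _); exact: (psd_sym pq).
Qed.

Lemma psd_sqrD u v : D u -> D v ->
  q (u + v) (u + v) = q u u + q u v *+ 2 + q v v.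
Proof.
move=> Du Dv; rewrite psdDl ?psdDr ?(psd_sym pq Dv Du) //.
  by rewrite mulr2n !addrA.
exact: psd_memD.
Qed.

Lemma psd_sqrB u v : D u -> D v ->
  q (u - v) (u - v) = q u u - q u v *+ 2 + q v v.
Proof.
move=> Du Dv; rewrite psdBl ?psdBr ?(psd_sym pq Dv Du) //; first by ring.
exact: psd_memB.
Qed.

Lemma psd_sqrZ a u : D u -> q (a%:C *: u) (a%:C *: u) = a ^+ 2 * q u u.
Proof.
by move=> Du; rewrite psdZl ?psdZr ?mulrA ?expr2 //; exact: psd_memZ.
Qed.

Lemma psd_sqrBC u v : D u -> D v -> q (u - v) (u - v) = q (v - u) (v - u).
Proof.
move=> Du Dv; rewrite !psd_sqrB // (psd_sym pq Du Dv); ring.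
Qed.

Lemma psd_sqrD_le u v : D u -> D v ->
  q (u + v) (u + v) <= q u u *+ 2 + q v v *+ 2.
Proof.
move=> Du Dv; have := psd_ge0 pq (psd_memB Du Dv).
rewrite psd_sqrB // psd_sqrD //; lra.
Qed.

Lemma psd_cross_le u v : D u -> D v -> q u v *+ 2 <= q u u + q v v.
Proof.
by move=> Du Dv; have := psd_ge0 pq (psd_memB Du Dv); rewrite psd_sqrB //; lra.
Qed.

(** First-order condition at a minimum: a quadratic s^2 c - s b that stays
    nonnegative has no linear part. *)
Lemma quadratic_cross0 (b c : R) :
  (forall s : R, s * b <= s ^+ 2 * c) -> b = 0.
Proof.
move=> h; have c0 : 0 <= c by have := h 1; have := h (-1); lra.
have k0 : 0 < c + 1 by lra.
have k1 : c + 1 != 0 by rewrite gt_eqF.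
have h2 := ler_wpM2l (sqr_ge0 (c + 1)) (h (b / (c + 1))).
have e1 : (c + 1) ^+ 2 * (b / (c + 1) * b) = b ^+ 2 * (c + 1) by field.
have e2 : (c + 1) ^+ 2 * ((b / (c + 1)) ^+ 2 * c) = b ^+ 2 * c by field.
rewrite {}e1 {}e2 in h2.
have b2 := sqr_ge0 b; apply/eqP; rewrite -sqrf_eq0; apply/eqP; lra.
Qed.

Lemma psd_cauchy_schwarz u v : D u -> D v ->
  q u v ^+ 2 <= q u u * q v v.
Proof.
move=> Du Dv; have [qv0|qv0] := eqVneq (q v v) 0.
  suff -> : q u v = 0 by rewrite expr0n /= qv0 mulr0.
  apply: (@quadratic_cross0 _ 0) => s; rewrite mulr0.
  rewrite leNgt; apply/negP => sq0.
  pose t := (q u u + 1) / (2 * (s * q u v)).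
  have := psd_ge0 pq (psd_memB Du (psd_memZ (t * s)%:C Dv)).
  rewrite psd_sqrB ?psd_sqrZ ?psdZr ?qv0 //; last exact: psd_memZ.
  rewrite mulr0 addr0 -mulrA /t => h.
  have : (q u u + 1) / (2 * (s * q u v)) * (s * q u v) *+ 2 = q u u + 1.
    by field; apply/andP; split; apply: contraTneq sq0 => ->; rewrite ?mulr0 ?mul0r ltxx.
  by lra.
have qv : 0 < q v v by rewrite lt_neqAle eq_sym qv0 (psd_ge0 pq).
have := psd_ge0 pq (psd_memB Du (psd_memZ (q u v / q v v)%:C Dv)).
rewrite psd_sqrB ?psd_sqrZ ?psdZr //; last exact: psd_memZ.
move=> h; rewrite -subr_ge0.
have -> : q u u * q v v - q u v ^+ 2 =
  q v v * (q u u - q u v / q v v * q u v *+ 2 + (q u v / q v v) ^+ 2 * q v v).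
  by field.
by rewrite mulr_ge0 // ltW.
Qed.

(** The minimal values of q on the decreasing sets C n increase to a limit. By the
    parallelogram identity, points that nearly realise them are close to each
    other, since their midpoint cannot do much better. *)
Lemma extraction (C : nat -> set V) (B : R) :
  (forall n, C n `<=` D) ->
  (forall n, exists2 u, C n u & q u u <= B) ->
  (forall n, C n.+1 `<=` C n) ->
  (forall n u v, C n u -> C n v -> C n (2^-1%:C *: (u + v))) ->
  exists y, [/\ forall n, C n (y n), form_cauchy q y &
    forall n u, C n u -> q (y n) (y n) <= q u u + n.+1%:R^-1].
Proof.
move=> CD Cne Cdec Cmid.
pose S n := [set q u u | u in C n]; pose d n := inf (S n).
have S0 n : lbound (S n) 0 by move=> _ [u Cu <-]; exact: (psd_ge0 pq (CD _ _ Cu)).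
have Si n : has_inf (S n).
  split; last by exists 0; exact: S0.
  by have [u Cu _] := Cne n; exists (q u u); exists u.
have dle n u : C n u -> d n <= q u u.
  by move=> Cu; apply: ge_inf; [exact: (Si n).2 | exists u].
have dB n : d n <= B by have [u Cu uB] := Cne n; exact: le_trans (dle _ _ Cu) uB.
have dS n : d n <= d n.+1.
  apply: lb_le_inf; first exact: (Si n.+1).1.
  by move=> _ [u Cu <-]; apply: dle; exact: Cdec.
have dmono n m : (n <= m)%N -> d n <= d m.
  by move=> /(homo_leq (@lexx _ R) (@le_trans _ R)); apply.
have Cmono n m : (n <= m)%N -> C m `<=` C n.
  by elim: m => [|m IH]; [rewrite leqn0 => /eqP ->|
    rewrite leq_eqVlt => /orP[/eqP ->//|/IH h] u /Cdec /h].
have ex n : exists u, C n u /\ q u u < d n + n.+1%:R^-1.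
  have [|_ [u Cu <-] h] := @inf_adherent _ (S n) n.+1%:R^-1 _ (Si n).
    by rewrite invr_gt0.
  by exists u.
have [y yP] := choice ex.
have Cy n := (yP n).1; have yd n := (yP n).2.
exists y; split => //; last first.
  move=> n u Cu; apply/ltW/(lt_le_trans (yd n)); rewrite lerD2r; exact: dle.
pose s := sup (range d).
have hs : has_sup (range d).
  by split; [exists (d 0), 0%N | exists B => _ [n _ <-]].
have ds n : d n <= s by apply: ub_le_sup; [exact: hs.2 | exists n].
have key n m : (n <= m)%N ->
    q (y n - y m) (y n - y m) <= 2 * (s - d n) + 4 * n.+1%:R^-1.
  move=> nm; have Dn := CD _ _ (Cy n); have Dm := CD _ _ (Cy m).
  have := dle n _ (Cmid _ _ _ (Cy n) (Cmono _ _ nm _ (Cy m))).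
  rewrite psd_sqrZ; last exact: psd_memD.
  rewrite psd_sqrD // psd_sqrB //.
  have := yd n; have := yd m; have := ds m; have := dmono _ _ nm.
  have : m.+1%:R^-1 <= n.+1%:R^-1 :> R by rewrite lef_pV2 ?posrE ?ler_nat.
  have -> : 2^-1 ^+ 2 = 4^-1 :> R by field.
  by move: (n.+1%:R^-1) (m.+1%:R^-1) => a b; lra.
move=> e e0.
have [_ [N0 _ <-] hN0] := @sup_adherent _ (range d) (e / 4) ltac:(lra) hs.
have [N1 _ hN1] := @null_harmonic R (e / 8) ltac:(lra).
exists (maxn N0 N1) => n m; rewrite !geq_max => /andP[n0 n1] /andP[m0 m1].
wlog nm : n m n0 n1 m0 m1 / (n <= m)%N.
  move=> h; case: (leqP n m) => [|/ltnW] ?; first exact: h.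
  by rewrite psd_sqrBC; [exact: h | exact: CD (Cy _) ..].
apply: le_lt_trans (key _ _ nm) _.
have := hN1 n n1; have := dmono _ _ n0; rewrite /= -/s in hN0 *.
by move: (n.+1%:R^-1) => a; lra.
Qed.

Lemma psd_null_sqr_cross y w : (forall n, D (y n)) -> D w ->
  null (fun n => q (y n) (y n)) -> null (fun n => `|q (y n) w|).
Proof.
move=> Dy Dw ny e e0.
have k0 : 0 < q w w + 1 by rewrite ltr_wpDl // (psd_ge0 pq).
have := ny (e ^+ 2 / (q w w + 1)).
rewrite divr_gt0 ?exprn_gt0 // => /(_ isT); apply: filterS => n /=.
rewrite ltr_pdivlMr // => h; rewrite -(@ltr_pXn2r _ 2) ?nnegrE ?(ltW e0) //.
rewrite real_normK ?num_real //; apply: le_lt_trans (psd_cauchy_schwarz _ _) _ => //.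
by have := psd_ge0 pq (Dy n); nra.
Qed.

Lemma scale_half_double u : 2^-1%:C *: (u + u) = u.
Proof.
rewrite -[u + u]mulr2n -[u *+ 2]scaler_nat scalerA -(rmorph_nat (real_complex R)) -rmorphM /=.
by rewrite mulVf ?pnatr_eq0 // scale1r.
Qed.

(** The projection is a limit of near-minimal points of the affine subspace t - W;
    minimality makes the residue orthogonal to W. *)
Lemma projection (W : set V) (t : V) :
  form_complete D q -> W `<=` D -> W 0 ->
  (forall (a : R[i]) u v, W u -> W v -> W (a *: u + v)) -> D t ->
  exists2 p, D p &
    (exists2 y, forall n, W (y n) & null (fun n => q (y n - p) (y n - p))) /\
    (forall w, W w -> q (t - p) w = 0).
Proof.
move=> comp WD W0 Wlin Dt.
have Wadd u v : W u -> W v -> W (u + v) by move=> Wu Wv; rewrite -[u]scale1r; exact: Wlin.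
have WZ (a : R[i]) u : W u -> W (a *: u) by move=> Wu; rewrite -[_ *: _]addr0; exact: Wlin.
pose C (n : nat) := [set t - w | w in W].
have [|||| y [Cy cy ymin]] := @extraction C (q t t).
- by move=> n _ [w Ww <-]; apply: psd_memB => //; exact: WD.
- by move=> n; exists t => //; exists 0 => //; rewrite subr0.
- by move=> n.
- move=> n _ _ [u Wu <-] [v Wv <-]; exists (2^-1%:C *: (u + v)); first exact/WZ/Wadd.
  by rewrite [t - u + _]addrACA -opprD scalerBr scale_half_double.
have {}Cy n : {w | W w & t - w = y n} by apply: cid2; exact: Cy.
pose w n := s2val (Cy n).
have Ww n : W (w n) by rewrite /w; case: (Cy n).
have yw n : y n = t - w n by rewrite /w; case: (Cy n).
have Dw n := WD _ (Ww n).
have Dy n : D (y n) by rewrite yw; exact: psd_memB.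
have [|p Dp wp] := comp w Dw.
  move=> e e0; have [M hM] := cy e e0; exists M => n m Mn Mm.
  have := hM m n Mm Mn.
  by rewrite !yw opprB [_ + (w n - t)]addrC addrA subrK.
have Dtp : D (t - p) by exact: psd_memB.
exists p => //; split; first by exists w.
move=> v Wv; have Dv := WD _ Wv.
suff : q (t - p) v *+ 2 = 0 by move=> /eqP; rewrite mulrn_eq0 => /eqP.
(* y n is near-minimal, so it is compared with the competitor t - (w n + s v). *)
apply: (@quadratic_cross0 _ (q v v)) => s.
suff : null (fun=> s * (q (t - p) v *+ 2) - s ^+ 2 * q v v) by
  move/null_cst0; rewrite subr_le0.
have hc := psd_null_sqr_cross (fun n => psd_memB (Dw n) Dp) (psd_memZ s%:C Dv) wp.
apply: null_le (nullD (nullZ (ler0n _ 2) hc) null_harmonic) => n /=.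
have Csv : C n (t - (w n + s%:C *: v)) by exists (w n + s%:C *: v) => //; exact/Wadd/WZ.
have := ymin n _ Csv; rewrite opprD addrA -yw.
rewrite psd_sqrB ?psd_sqrZ //; last exact: psd_memZ.
have : q (y n) (s%:C *: v) = s * q (t - p) v - q (w n - p) (s%:C *: v).
  rewrite -psdZr // -psdBl //; last exact: psd_memZ.
    by rewrite yw opprB addrA subrK.
  exact: psd_memB.
move=> ->; have := lerNnormlW (lexx `|q (w n - p) (s%:C *: v)|).
have := ler_norm (q (w n - p) (s%:C *: v)).
rewrite mulrnAr; move: (n.+1%:R^-1) (s * q (t - p) v) (s ^+ 2 * q v v) => a b c; lra.
Qed.

End PsdForm.

(** * Orthogonal projections *)

Section OrthogonalProjection.
Context {R : realType} {V : lmodType R[i]} {D : set V} {q : V -> V -> R}.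
Hypotheses (pq : psd_form D q) (comp : form_complete D q).
Hypothesis qZ : forall (a : R[i]) u v, D u -> D v -> q (a *: u) v = q u (a^* *: v).
Context {W : set V}.
Hypotheses (WD : W `<=` D) (W0 : W 0).
Hypothesis Wlin : forall (a : R[i]) u v, W u -> W v -> W (a *: u + v).
Implicit Types (t p u v w : V).

(** p is the projection of t onto the closure of W. It is a relation because q may
    be degenerate, in which case p is determined only up to null vectors. *)
Definition orth_proj t p : Prop :=
  [/\ D p, exists2 y, forall n, W (y n) & null (fun n => q (y n - p) (y n - p)) &
      forall w, W w -> q (t - p) w = 0].

Lemma orth_proj_ex t : D t -> exists p, orth_proj t p.
Proof. by move=> Dt; have [p Dp [h1 h2]] := projection pq comp WD W0 Wlin Dt; exists p. Qed.

Lemma orth_limit u p : D u -> D p -> (forall w, W w -> q u w = 0) ->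
  (exists2 y, forall n, W (y n) & null (fun n => q (y n - p) (y n - p))) ->
  q u p = 0.
Proof.
move=> Du Dp uW [y Wy yp]; have Dy n := WD (Wy n).
apply/normr0_eq0/(null_cst_eq0 (normr_ge0 _)).
apply: null_le (psd_null_sqr_cross pq (fun n => psd_memB pq (Dy n) Dp) Du yp) => n.
rewrite (psdBl pq) // [q (y n) u](psd_sym pq) // (uW (y n)) // sub0r normrN.
by rewrite (psd_sym pq).
Qed.

Lemma qZ_sqr (a : R[i]) u : D u -> q (a *: u) (a *: u) = (Re a ^+ 2 + Im a ^+ 2) * q u u.
Proof.
move=> Du; rewrite qZ //; last exact: (psd_memZ pq).
rewrite scalerA -(psdZr pq) //; congr (q _ (_ *: _)).
by case: a => x y; apply/eqP; rewrite eq_complex /=; apply/andP; split; apply/eqP; ring.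
Qed.

Lemma orth_proj_lin (a : R[i]) t p t' p' : D t -> D t' ->
  orth_proj t p -> orth_proj t' p' -> orth_proj (a *: t + t') (a *: p + p').
Proof.
move=> Dt Dt' [Dp [y Wy yp] tp] [Dp' [y' Wy' yp'] tp'].
have c0 : 0 <= Re a ^+ 2 + Im a ^+ 2 by rewrite addr_ge0 ?sqr_ge0.
split; first exact: (psd_closed pq).
  exists (fun n => a *: y n + y' n); first by move=> n; exact: Wlin.
  apply: null_le (nullD (nullZ (ler0n _ 2) (nullZ c0 yp)) (nullZ (ler0n _ 2) yp')) => n.
  have D1 := psd_memB pq (WD (Wy n)) Dp; have D2 := psd_memB pq (WD (Wy' n)) Dp'.
  have -> : a *: y n + y' n - (a *: p + p') = a *: (y n - p) + (y' n - p').
    by rewrite scalerBr opprD addrACA.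
  have := psd_sqrD_le pq (psd_memZ pq a D1) D2; rewrite qZ_sqr //; lra.
move=> w Ww.
have -> : a *: t + t' - (a *: p + p') = a *: (t - p) + (t' - p').
  by rewrite scalerBr opprD addrACA.
have D1 := psd_memB pq Dt Dp; have D2 := psd_memB pq Dt' Dp'.
have Dw := WD Ww.
rewrite (psdDl pq (psd_memZ pq a D1) D2 Dw) (qZ _ D1 Dw) tp' // addr0 tp //.
by rewrite -[_ *: _]addr0; exact: Wlin.
Qed.

Lemma orth_proj_uniq t p p' : (forall u, D u -> q u u = 0 -> u = 0) -> D t ->
  orth_proj t p -> orth_proj t p' -> p = p'.
Proof.
move=> q0 Dt h h'; apply/eqP; rewrite -subr_eq0; apply/eqP.
have [Dd cd od] := orth_proj_lin (-1) Dt Dt h' h.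
rewrite addrC -scaleN1r; apply: q0 => //.
have := orth_limit Dd Dd _ cd; apply => w Ww.
have := od w Ww; rewrite scaleN1r addNr sub0r (psdNl pq Dd (WD Ww)).
by move=> /eqP; rewrite oppr_eq0 => /eqP.
Qed.

Lemma orth_proj_self w : W w -> orth_proj w w.
Proof.
move=> Ww; split; first exact: WD.
  exists (fun=> w) => // e e0; near=> n.
  by rewrite subrr (psd0l pq) //; exact: (psd_mem0 pq).
by move=> v Wv; rewrite subrr (psd0l pq) //; exact: WD.
Unshelve. all: by end_near. Qed.

Lemma orth_proj_le t p : D t -> orth_proj t p -> q p p <= q t t.
Proof.
move=> Dt [Dp cp op]; have Dtp := psd_memB pq Dt Dp.
have := psd_sqrD pq Dtp Dp; rewrite subrK => ->.
rewrite (orth_limit Dtp Dp op cp) mul0rn addr0 ler_wpDl //; exact: (psd_ge0 pq).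
Qed.

(** If S preserves W and its adjoint S' preserves W, then S commutes with the
    projection: this is how projections onto invariant subspaces are seen to lie
    in a commutant. *)
Lemma orth_proj_map (C : R) (S S' : V -> V) t p : 0 <= C ->
  (forall u, D u -> D (S u)) -> (forall u, W u -> W (S u)) ->
  (forall u, W u -> W (S' u)) -> (forall u v, S (u - v) = S u - S v) ->
  (forall u, D u -> q (S u) (S u) <= C * q u u) ->
  (forall u w, D u -> W w -> q (S u) w = q u (S' w)) -> D t ->
  orth_proj t p -> orth_proj (S t) (S p).
Proof.
move=> C0 SD SW S'W SB SC SS Dt [Dp [y Wy yp] tp].
split; first exact: SD.
  exists (fun n => S (y n)); first by move=> n; exact: SW.
  apply: null_le (nullZ C0 yp) => n; rewrite -SB; apply: SC.
  by apply: (psd_memB pq) => //; exact: WD.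
move=> w Ww; rewrite -SB SS //; first by rewrite tp //; exact: S'W.
exact: (psd_memB pq).
Qed.

End OrthogonalProjection.

(** * Real and imaginary parts *)

Section ComplexReal.
Context {R : realType}.
Implicit Types z w : R[i].

Lemma ReD z w : Re (z + w) = Re z + Re w. Proof. by move: z w => [a b] [c d]. Qed.
Lemma ReN z : Re (- z) = - Re z. Proof. by case: z. Qed.
Lemma ReZ (a : R) z : Re (a%:C * z) = a * Re z.
Proof. by case: z => x y /=; rewrite mul0r subr0. Qed.
Lemma ReNi z : Re (- 'i%C * z) = Im z.
Proof. by case: z => x y /=; ring. Qed.
Lemma complexReJ z : Re z^* = Re z.
Proof. by case: z. Qed.
Lemma Re_ge0 z : 0 <= z -> 0 <= Re z.
Proof. by rewrite lecE => /andP[]. Qed.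
Lemma ge0_RRe z : 0 <= z -> z = (Re z)%:C.
Proof. by rewrite lecE => /andP[/eqP]; case: z => x y /= ->. Qed.
Lemma eq_ReIm z w : Re z = Re w -> Im z = Im w -> z = w.
Proof. by case: z w => x y [x' y'] /= -> ->. Qed.

End ComplexReal.

(** * Bounded operators on a Hilbert space *)

Section Hilbert.
Context {R : realType} {H : completeNormedModType R[i]}.
Variable dot : {dot H for Num.conj}.
Hypothesis hN : hilbert_norm dot.
Implicit Types (u v w : H) (x y z : H -> H).

Definition re_dot v w : R := Re (dot v w).
Definition sqnorm v : R := re_dot v v.
Local Notation ip := re_dot.
Local Notation nsq := sqnorm.

Lemma dotC v w : dot v w = (dot w v)^*.
Proof. by rewrite hermC expr0 mul1r. Qed.

Lemma dotDl u v w : dot (u + v) w = dot u w + dot v w.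
Proof. exact: linearDl. Qed.

Lemma dotZl (a : R[i]) v w : dot (a *: v) w = a * dot v w.
Proof. exact: linearZl_LR. Qed.

Lemma dotZr (a : R[i]) v w : dot v (a *: w) = a^* * dot v w.
Proof. by rewrite dotC dotZl rmorphM /= -dotC. Qed.

Lemma ip_form : psd_form setT ip.
Proof.
split=> // [a u v w _ _ _|u v _ _|u _]; rewrite /re_dot.
- by rewrite dotDl dotZl ReD ReZ.
- by rewrite dotC complexReJ.
- exact/Re_ge0/dnorm_ge0.
Qed.

Let T v : [set: H] v := I.
Local Notation F := ip_form.

Lemma ipDl u v w : ip (u + v) w = ip u w + ip v w. Proof. exact: (psdDl F). Qed.
Lemma ipBl u v w : ip (u - v) w = ip u w - ip v w. Proof. exact: (psdBl F). Qed.
Lemma ipZl (a : R) u w : ip (a%:C *: u) w = a * ip u w. Proof. exact: (psdZl F). Qed.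
Lemma ipZr (a : R) u w : ip u (a%:C *: w) = a * ip u w. Proof. exact: (psdZr F). Qed.
Lemma ipDr u v w : ip w (u + v) = ip w u + ip w v. Proof. exact: (psdDr F). Qed.
Lemma ipBr u v w : ip w (u - v) = ip w u - ip w v. Proof. exact: (psdBr F). Qed.
Lemma ipC u v : ip u v = ip v u. Proof. exact: (psd_sym F). Qed.
Lemma nsq_ge0 v : 0 <= nsq v. Proof. exact: (psd_ge0 F). Qed.
Lemma nsqD_le u v : nsq (u + v) <= nsq u *+ 2 + nsq v *+ 2.
Proof. exact: (psd_sqrD_le F). Qed.
Lemma nsqBC u v : nsq (u - v) = nsq (v - u). Proof. exact: (psd_sqrBC F). Qed.
Lemma nsqZr (a : R) v : nsq (a%:C *: v) = a ^+ 2 * nsq v.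
Proof. exact: (psd_sqrZ F). Qed.
Lemma ip_ii v w : ip ('i *: v) ('i *: w) = ip v w.
Proof.
rewrite /re_dot dotZl dotZr mulrA; congr Re; rewrite -[RHS]mul1r; congr (_ * _).
by apply: eq_ReIm => /=; ring.
Qed.

Lemma nsqB_tri u v w : nsq (u - w) <= nsq (u - v) *+ 2 + nsq (v - w) *+ 2.
Proof. by rewrite -(subrKA v) nsqD_le. Qed.

Lemma dot_sqrE v : dot v v = (nsq v)%:C.
Proof. by apply: ge0_RRe; exact: dnorm_ge0. Qed.

Lemma nsq_eq0 v : nsq v = 0 -> v = 0.
Proof. by move=> v0; apply/eqP; rewrite -(dnorm_eq0 dot) dot_sqrE v0. Qed.

Lemma nsq0 : nsq 0 = 0. Proof. exact: (psd0l F). Qed.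

Lemma Im_dot v w : Im (dot v w) = ip v ('i *: w).
Proof.
rewrite /re_dot dotZr -ReNi; congr (Re (_ * _)).
by apply: eq_ReIm => //=; rewrite oppr0.
Qed.

Lemma norm_nsq v : `|v| ^+ 2 = (nsq v)%:C.
Proof. by rewrite hN dot_sqrE. Qed.

Lemma norm_lt (e : R) v : 0 < e -> (`|v| < e%:C) = (nsq v < e ^+ 2).
Proof.
move=> e0; rewrite -(@ltr_pXn2r _ 2) ?nnegrE ?ler0c ?(ltW e0) //.
by rewrite norm_nsq -rmorphXn ltcR.
Qed.

Lemma cvg_nsq (v : nat -> H) l : (v @ \oo --> l) <-> null (fun n => nsq (v n - l)).
Proof.
split=> [/cvgrPdist_lt vl e e0|nv].
  have s0 : 0 < Num.sqrt e by rewrite sqrtr_gt0.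
  have := vl (Num.sqrt e)%:C; rewrite ltcR => /(_ s0); apply: filterS => n.
  by rewrite norm_lt // sqr_sqrtr ?(ltW e0) // nsqBC.
apply/cvgrPdist_lt => e e0; have eE := ge0_RRe (ltW e0).
move: e0; rewrite eE ltcR => e0.
have := nv (Re e ^+ 2); rewrite exprn_gt0 // => /(_ isT).
by apply: filterS => n h; rewrite norm_lt // nsqBC.
Qed.

Lemma nsq_complete : form_complete setT ip.
Proof.
move=> v _ cv.
suff /cvg_ex[l /cvg_nsq vl] : cvgn v by exists l.
apply/cauchy_cvgP/cauchy_ballP => e e0; have eE := ge0_RRe (ltW e0).
move: e0; rewrite eE ltcR => e0.
have [|M hM] := cv (Re e ^+ 2); first by rewrite exprn_gt0.
pose S := [set v n | n in [set n | (M <= n)%N]].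
exists (S, S); first by split; exists M => // n Mn; exists n.
move=> [_ _] /= [[n Mn <-] [m Mm <-]].
by rewrite -ball_normE /= norm_lt //; exact: hM.
Qed.

Section LinearOp.
Context {x : H -> H}.
Hypothesis lx : linear x.

Lemma linopD v w : x (v + w) = x v + x w.
Proof. by have := lx 1 v w; rewrite !scale1r. Qed.

Lemma linop0 : x 0 = 0.
Proof.
by have /eqP := linopD 0 0; rewrite addr0 -subr_eq0 opprD addrA subrr sub0r
  oppr_eq0 => /eqP.
Qed.

Lemma linopZ (a : R[i]) v : x (a *: v) = a *: x v.
Proof. by rewrite -[a *: v]addr0 (lx a) linop0 addr0. Qed.

Lemma linopB v w : x (v - w) = x v - x w.
Proof. by rewrite -scaleN1r linopD linopZ scaleN1r. Qed.

End LinearOp.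

Lemma bopD x (bx : bounded_op x) v w : x (v + w) = x v + x w.
Proof. exact: (linopD bx.1). Qed.

Lemma bop0 x (bx : bounded_op x) : x 0 = 0.
Proof. exact: (linop0 bx.1). Qed.

Lemma bopZ x (bx : bounded_op x) (a : R[i]) v : x (a *: v) = a *: x v.
Proof. exact: (linopZ bx.1). Qed.

Lemma bopB x (bx : bounded_op x) v w : x (v - w) = x v - x w.
Proof. exact: (linopB bx.1). Qed.

(** Real parts suffice: the imaginary part is recovered by multiplying a vector
    by i. *)
Lemma adjointP x y : linear x -> (adjoint dot x y <-> forall v w, ip (x v) w = ip v (y w)).
Proof.
move=> lx; split=> [xy v w|xy v w]; first by rewrite /re_dot xy.
apply: eq_ReIm; first exact: xy.
rewrite -!ReNi -!dotZl -[LHS]/(ip _ _) -(linopZ lx); exact: xy.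
Qed.

(** C bounds the square of the operator norm; all estimates are kept quadratic. *)
Definition nbound (C : R) x := forall v, nsq (x v) <= C * nsq v.

(** Continuity at 0 gives a ball of radius r mapped into the unit ball; every
    vector is rescaled into it. *)
Lemma bounded_op_nbound x : bounded_op x -> exists2 C : R, 0 <= C & nbound C x.
Proof.
move=> [lx cx].
have x0 := linop0 lx; have /cvgrPdist_lt/(_ 1 ltr01) := cx 0.
move=> /nbhs_ballP[d /= d0 hd]; have dE := ge0_RRe (ltW d0).
move: d0; rewrite dE ltcR => d0; set r := Re d in d0 dE.
have hr v : nsq v < r ^+ 2 -> nsq (x v) < 1.
  move=> vr; have := hd v; rewrite -ball_normE /= sub0r normrN dE norm_lt // => /(_ vr).
  by rewrite x0 sub0r normrN -[1 : R[i]]/(1%:C) norm_lt // expr1n.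
exists (2 / r ^+ 2); first by rewrite divr_ge0 // sqr_ge0.
move=> v; have [/nsq_eq0 ->|v0] := eqVneq (nsq v) 0.
  by rewrite x0 nsq0 mulr0.
have vp : 0 < nsq v by rewrite lt_neqAle eq_sym v0 nsq_ge0.
pose s := Num.sqrt (r ^+ 2 / 2 / nsq v).
have s2 : s ^+ 2 = r ^+ 2 / 2 / nsq v.
  by rewrite sqr_sqrtr // !divr_ge0 ?sqr_ge0 ?ltW.
have r2 : 0 < r ^+ 2 by rewrite exprn_gt0.
have := hr (s%:C *: v); rewrite (linopZ lx) !nsqZr s2.
have -> : r ^+ 2 / 2 / nsq v * nsq v = r ^+ 2 / 2 by field.
have -> : r ^+ 2 / 2 / nsq v * nsq (x v) = (r ^+ 2 / 2 * nsq (x v)) / nsq v by ring.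
rewrite [_ / nsq v < 1]ltr_pdivrMr // mul1r => h.
rewrite mulrAC ler_pdivlMr //; have := h ltac:(lra); lra.
Qed.

Lemma nbound_bounded_op C x : linear x -> nbound C x -> bounded_op x.
Proof.
move=> lx xC; split=> // v; apply/cvgrPdist_lt => e e0; have eE := ge0_RRe (ltW e0).
move: e0; rewrite eE ltcR => e0; set r := Re e in e0 eE.
pose k := `|C| + 1; have k0 : 0 < k by rewrite ltr_wpDl.
apply/nbhs_ballP; exists (r / k)%:C => /=; first by rewrite ltcR divr_gt0.
move=> w; rewrite -ball_normE /= norm_lt ?divr_gt0 // => h.
rewrite norm_lt // -(linopB lx); apply: le_lt_trans (xC _) _.
have n0 := nsq_ge0 (v - w).
apply: (@le_lt_trans _ _ (k ^+ 2 * nsq (v - w))).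
  rewrite ler_wpM2r // (le_trans (ler_norm C)) // /k.
  have := normr_ge0 C; nra.
by rewrite mulrC -ltr_pdivlMr ?exprn_gt0 // -expr_div_n.
Qed.


Lemma adjoint_sym x y : adjoint dot x y -> adjoint dot y x.
Proof. by move=> xy v w; rewrite dotC -xy -dotC. Qed.

Lemma adjoint_uniq x y y' : adjoint dot x y -> adjoint dot x y' -> y = y'.
Proof.
move=> xy xy'; apply/funext => w; apply/eqP; rewrite -subr_eq0; apply/eqP.
by apply: nsq_eq0; rewrite /sqnorm ipBr /re_dot -xy -xy' subrr.
Qed.

Lemma adjoint_ip x y v w : adjoint dot x y -> ip (x v) w = ip v (y w).
Proof. by move=> xy; rewrite /re_dot xy. Qed.

Lemma nbound_adjoint (C : R) x y : 0 <= C -> nbound C x -> adjoint dot x y ->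
  nbound C y.
Proof.
move=> C0 xC xy v.
have := psd_cauchy_schwarz F (T (x (y v))) (T v).
rewrite (adjoint_ip _ _ xy) -!/(nsq _) => h.
have n3 := nsq_ge0 (y v); have n4 := nsq_ge0 v.
have {}h : nsq (y v) ^+ 2 <= nsq (y v) * (C * nsq v).
  apply: le_trans h _; rewrite mulrA; apply: ler_wpM2r => //.
  by rewrite [_ * C]mulrC; exact: xC.
have [->|y0] := eqVneq (nsq (y v)) 0; first exact: mulr_ge0.
by move: h; rewrite expr2 ler_pM2l // lt_neqAle eq_sym y0.
Qed.

Lemma adjoint_bounded x y : bounded_op x -> adjoint dot x y -> bounded_op y.
Proof.
move=> bx xy; have [C C0 xC] := bounded_op_nbound bx.
have ly : linear y.
  move=> a v w; apply/eqP; rewrite -subr_eq0; apply/eqP/nsq_eq0.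
  suff ipy u : ip u (y (a *: v + w) - (a *: y v + y w)) = 0 by exact: ipy.
  rewrite ipBr ipDr -!(adjoint_ip _ _ xy) ipDr.
  suff -> : ip u (a *: y v) = ip (x u) (a *: v) by rewrite subrr.
  by rewrite /re_dot !dotZr xy.
exact: nbound_bounded_op ly (nbound_adjoint C0 xC xy).
Qed.

Lemma nsq_limit_le (a : nat -> H) l (B : R) :
  null (fun n => nsq (a n - l)) -> (forall n, nsq (a n) <= B) -> nsq l <= B.
Proof.
move=> al aB.
suff h : null (fun=> nsq l - B) by have := null_cst0 h; lra.
have nc := psd_null_sqr_cross F (fun n => T (a n - l)) (T l) al.
apply: null_le (nullZ (ler0n _ 2) nc) => n.
have := aB n; have := psd_sqrD F (T (a n - l)) (T l); rewrite subrK -!/(nsq _).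
have := lerNnormlW (lexx `|ip (a n - l) l|); have := nsq_ge0 (a n - l); lra.
Qed.

Definition sot_cvg (x : nat -> H -> H) (l : H -> H) :=
  forall v, null (fun n => nsq (x n v - l v)).

Lemma sot_cvg_uniq (x_ : nat -> H -> H) l l' :
  sot_cvg x_ l -> sot_cvg x_ l' -> l = l'.
Proof.
move=> xl xl'; apply/funext => v; apply/eqP; rewrite -subr_eq0; apply/eqP/nsq_eq0.
apply: (null_cst_eq0 (nsq_ge0 _)).
apply: null_le (nullD (nullZ (ler0n _ 2) (xl v)) (nullZ (ler0n _ 2) (xl' v))) => n.
have := nsqB_tri (l v) (x_ n v) (l' v); rewrite [nsq (l v - x_ n v)]nsqBC; lra.
Qed.

End Hilbert.

(** * Existence of adjoints *)

Section Riesz.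
Context {R : realType} {H : completeNormedModType R[i]}.
Variable dot : {dot H for Num.conj}.
Hypothesis hN : hilbert_norm dot.
Local Notation op := (H -> H).
Local Notation ip := (re_dot dot).
Local Notation nsq := (sqnorm dot).
Implicit Types (x y : op).

(** Unless it is zero, the functional L v = <x v, w> has a closed hyperplane as
    kernel, and a vector e orthogonal to it represents L up to a scalar. *)
Lemma riesz x (w : H) : bounded_op x -> exists h, forall v, dot (x v) w = dot v h.
Proof.
move=> bx; have [C C0 xC] := bounded_op_nbound hN bx.
pose L v := dot (x v) w.
have Llin (a : R[i]) v v' : L (a *: v + v') = a * L v + L v'.
  by rewrite /L (bopD bx) (bopZ bx) dotDl dotZl.
have LZ (a : R[i]) v : L (a *: v) = a * L v.
  by rewrite /L (bopZ bx) dotZl.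
have LB v v' : L (v - v') = L v - L v'.
  by rewrite addrC -scaleN1r Llin mulN1r addrC.
have [L0|/existsNP[t /eqP Lt]] := pselect (forall v, L v = 0).
  by exists 0 => v; rewrite linear0r; exact: L0.
pose W : set H := [set v | L v = 0].
have W0 : W 0 by rewrite /W /= /L (bop0 bx) linear0l.
have Wlin (a : R[i]) v v' : W v -> W v' -> W (a *: v + v').
  by rewrite /W /= Llin => -> ->; rewrite mulr0 addr0.
have [p _ [[y Wy yp] pW]] :=
  projection (ip_form dot) (nsq_complete hN) (fun _ _ => I) W0 Wlin (I : setT t).
have Lp : L p = 0.
  have key w' : (forall n, ip (x (y n)) w' = 0) -> ip (x p) w' = 0.
    move=> h; apply/normr0_eq0/(null_cst_eq0 (normr_ge0 _)).
    have n0 : null (fun n => nsq (x (y n - p))).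
      by apply: null_le (nullZ C0 yp) => n; exact: xC.
    apply: null_le (psd_null_sqr_cross (ip_form dot) (fun n => I : setT (x (y n - p)))
      (I : setT w') n0) => n.
    by rewrite (bopB bx) ipBl h sub0r normrN.
  apply: eq_ReIm; first by apply: (key w) => n; rewrite /re_dot [dot _ _]Wy.
  by rewrite Im_dot; apply: key => n; rewrite -Im_dot [dot _ _]Wy.
pose e := t - p.
have Le : L e != 0 by rewrite LB Lp subr0.
have eW v : W v -> dot e v = 0.
  move=> Wv; apply: eq_ReIm; first exact: pW.
  by rewrite Im_dot; apply: pW; rewrite /W /= LZ Wv mulr0.
have e0 : (nsq e)%:C != 0 :> R[i].
  apply: contra_neq Le => /eqP; rewrite eq_complex /= eqxx andbT => /eqP/nsq_eq0 ->.
  by rewrite /L (bop0 bx) linear0l.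
exists ((L e / (nsq e)%:C)^* *: e) => v.
have /eW : W (v - (L v / L e) *: e) by rewrite /W /= LB LZ divfK // subrr.
rewrite dotC => h.
have {h} : dot (v - (L v / L e) *: e) e = 0.
  by rewrite -[LHS]conjcK [X in X^*]h conjc0.
rewrite -scaleNr addrC dotDl dotZl dot_sqrE => /eqP.
rewrite mulNr addrC subr_eq0 => /eqP h.
rewrite dotZr h -[dot (x v) w]/(L v) [X in _ = X * _]conjcK.
by field; rewrite Le e0.
Qed.

Lemma adjoint_ex x : bounded_op x -> exists y, adjoint dot x y.
Proof.
move=> bx; have [y hy] := choice (fun w => riesz w bx).
by exists y => v w; exact: hy.
Qed.

End Riesz.

(** * Square-summable sequences of vectors *)

Section SquareSummable.
Context {R : realType} {H : completeNormedModType R[i]}.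
Variable dot : {dot H for Num.conj}.
Hypothesis hN : hilbert_norm dot.
Local Notation ip := (re_dot dot).
Local Notation nsq := (sqnorm dot).
Implicit Types (u v w : nat -> H) (x y : H -> H).

Lemma nsqZ (a : R[i]) (v : H) : nsq (a *: v) = (Re a ^+ 2 + Im a ^+ 2) * nsq v.
Proof.
rewrite /sqnorm /re_dot dotZl dotZr mulrA -ReZ; congr (Re (_ * _)).
by apply: eq_ReIm; case: a => a b /=; ring.
Qed.

(** The Hilbert space l2(H), as a set of sequences carrying a form. *)
Definition l2 : set (nat -> H) :=
  [set u | exists B : R, forall n, \sum_(0 <= k < n) nsq (u k) <= B].

Definition l2ip u v : R := limn (series (fun k => ip (u k) (v k))).
Definition l2sq u : R := l2ip u u.

Lemma l2_lin (a : R[i]) u v : l2 u -> l2 v -> l2 (a *: u + v).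
Proof.
move=> [B uB] [B' vB]; set c := Re a ^+ 2 + Im a ^+ 2.
have c0 : 0 <= c by rewrite addr_ge0 ?sqr_ge0.
exists (c * B *+ 2 + B' *+ 2) => n.
apply: (@le_trans _ _ (\sum_(0 <= k < n) (c * nsq (u k) *+ 2 + nsq (v k) *+ 2))).
  apply: ler_sum => k _; rewrite -nsqZ; exact: nsqD_le.
rewrite big_split /= !sumrMnl -mulr_sumr.
have := ler_wpM2l c0 (uB n); have := vB n; lra.
Qed.

Lemma l2_mem0 : l2 0.
Proof. by exists 0 => n; rewrite big1 // => k _; rewrite nsq0. Qed.

Lemma l2_cvg u v : l2 u -> l2 v -> cvgn (series (fun k => ip (u k) (v k))).
Proof.
move=> [B uB] [B' vB]; apply: normed_cvg; apply: nondecreasing_is_cvgn.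
  by apply: nondecreasing_series => n _ _; exact: normr_ge0.
exists (B + B') => _ [n _ <-].
apply: le_trans (lerD (uB n) (vB n)); rewrite -big_split /=.
apply: ler_sum => k _; rewrite ler_norml; apply/andP.
have := psd_sqrD_le (ip_form dot) (I : setT (u k)) (I : setT (v k)).
have := psd_cross_le (ip_form dot) (I : setT (u k)) (I : setT (v k)).
have := psd_sqrD (ip_form dot) (I : setT (u k)) (I : setT (v k)).
have := nsq_ge0 dot (u k + v k); rewrite -!/(nsq _).
have := nsq_ge0 dot (u k); have := nsq_ge0 dot (v k).
by move=> h1 h2 h3 h4 h5 h6; split; lra.
Qed.

Lemma l2sq_ub u n : l2 u -> \sum_(0 <= k < n) nsq (u k) <= l2sq u.
Proof.
move=> lu; apply: (@nondecreasing_cvgn_le _ (series (fun k => ip (u k) (u k)))).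
  by apply: nondecreasing_series => k _ _; exact: nsq_ge0.
exact: l2_cvg.
Qed.

Lemma l2sq_le u (B : R) : (forall n, \sum_(0 <= k < n) nsq (u k) <= B) -> l2sq u <= B.
Proof.
move=> uB; have lu : l2 u by exists B.
by apply: limr_le; [exact: l2_cvg | apply: nearW].
Qed.

Lemma l2_form : psd_form l2 l2ip.
Proof.
split=> [||a u v w lu lv lw|u v lu lv|u lu].
- exact: l2_lin.
- exact: l2_mem0.
- have cu := l2_cvg lu lw; have cv := l2_cvg lv lw.
  transitivity (limn (series
    (a *: (fun k => ip (u k) (w k)) + (fun k => ip (v k) (w k))))).
    by congr (limn (series _)); apply/funext => k; rewrite !fctE ipDl ipZl.
  by rewrite (lim_seriesD (is_cvg_seriesZ (k := a) cu) cv) (lim_seriesZ a cu).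
- by congr (limn (series _)); apply/funext => k; rewrite ipC.
- by have := l2sq_ub 0 lu; rewrite big_geq.
Qed.

Lemma nsq_le_l2sq u k : l2 u -> nsq (u k) <= l2sq u.
Proof.
move=> lu; apply: le_trans (l2sq_ub k.+1 lu); rewrite big_nat_recr //= ler_wpDl //.
by apply: sumr_ge0 => i _; exact: nsq_ge0.
Qed.

Lemma l2sq_eq0 u : l2 u -> l2sq u = 0 -> u = 0.
Proof.
move=> lu u0; apply/funext => k; apply: (@nsq_eq0 _ _ dot); apply/eqP.
by rewrite eq_le nsq_ge0 andbT -u0 nsq_le_l2sq.
Qed.

Lemma null_sum (a : nat -> nat -> R) K : (forall k, null (a k)) ->
  null (fun n => \sum_(0 <= k < K) a k n).
Proof.
move=> na; elim: K => [|K IH].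
  by move=> e e0; near=> n; rewrite big_geq.
by apply: null_le (nullD IH (na K)) => n; rewrite big_nat_recr.
Unshelve. all: by end_near. Qed.

(** The Cauchy bound passes to the coordinatewise limit on each finite block of
    coordinates, uniformly in the block. *)
Lemma l2_complete : form_complete l2 l2ip.
Proof.
move=> y ly cy; have F := l2_form.
have cauchyk k : form_cauchy ip (fun n => y n k).
  move=> e e0; have [M hM] := cy e e0; exists M => n m Mn Mm.
  apply: le_lt_trans (hM n m Mn Mm).
  exact: (@nsq_le_l2sq (y n - y m) k (psd_memB F (ly n) (ly m))).
have exl k : exists l, null (fun n => nsq (y n k - l)).
  by have [l _ hl] := nsq_complete hN (fun=> I) (cauchyk k); exists l.
have [l lP] := choice exl.
have key e : 0 < e -> exists M, forall n, (M <= n)%N -> forall K,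
    \sum_(0 <= k < K) nsq (y n k - l k) <= e.
  move=> e0; have [M hM] := cy (e / 2) (divr_gt0 e0 (ltr0n _ 2)).
  exists M => n Mn K.
  suff h : null (fun=> \sum_(0 <= k < K) nsq (y n k - l k) - e).
    by have := null_cst0 h; rewrite subr_le0.
  have hs := null_sum K lP.
  move=> d d0; have [N _ hN'] := hs (d / 2) (divr_gt0 d0 (ltr0n _ 2)).
  near=> m0; pose m := maxn M N.
  have mM : (M <= m)%N by rewrite leq_maxl.
  have hm : \sum_(0 <= k < K) nsq (y m k - l k) < d / 2.
    by apply: hN'; rewrite /= leq_maxr.
  have hnm : \sum_(0 <= k < K) nsq (y n k - y m k) < e / 2.
    apply: le_lt_trans (hM n m Mn mM).
    exact: (@l2sq_ub (y n - y m) K (psd_memB F (ly n) (ly m))).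
  have : \sum_(0 <= k < K) nsq (y n k - l k) <=
      \sum_(0 <= k < K) (nsq (y n k - y m k) *+ 2 + nsq (y m k - l k) *+ 2).
    by apply: ler_sum => k _; exact: nsqB_tri.
  rewrite big_split /= !sumrMnl; lra.
have lyl e : 0 < e -> exists M, forall n, (M <= n)%N ->
    l2 (y n - l) /\ l2sq (y n - l) <= e.
  move=> /key[M hM]; exists M => n Mn; split; last exact/l2sq_le/hM.
  by exists e; exact: hM.
exists l.
  have [M /(_ M (leqnn _))[h _]] := lyl 1 ltr01.
  by rewrite -[l](subKr (y M)); exact: (psd_memB F (ly M) h).
move=> e e0; have [M hM] := lyl (e / 2) (divr_gt0 e0 (ltr0n _ 2)).
exists M => // n /= Mn; have [_ h] := hM n Mn; apply: le_lt_trans h _; lra.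
Unshelve. all: by end_near. Qed.

Lemma l2_comp (C : R) x u : nbound dot C x -> l2 u -> l2 (x \o u).
Proof.
move=> xC [B uB]; exists (`|C| * B) => n.
apply: (@le_trans _ _ (\sum_(0 <= k < n) `|C| * nsq (u k))).
  apply: ler_sum => k _; apply: le_trans (xC _) _; rewrite ler_wpM2r ?nsq_ge0 //.
  exact: ler_norm.
by rewrite -mulr_sumr ler_wpM2l.
Qed.

Lemma l2sq_comp_le (C : R) x u : 0 <= C -> nbound dot C x -> l2 u ->
  l2sq (x \o u) <= C * l2sq u.
Proof.
move=> C0 xC lu; apply: l2sq_le => n.
apply: le_trans (ler_wpM2l C0 (l2sq_ub n lu)).
by rewrite mulr_sumr; apply: ler_sum => k _; exact: xC.
Qed.

Lemma l2ip_adjoint x y u v : adjoint dot x y -> l2ip (x \o u) v = l2ip u (y \o v).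
Proof.
move=> xy; congr (limn (series _)); apply/funext => k /=; exact: adjoint_ip.
Qed.

Definition single (j : nat) (h : H) : nat -> H := fun k => if k == j then h else 0.
Definition initseg (n : nat) u : nat -> H := fun k => if (k < n)%N then u k else 0.

Lemma sum_single j h n : \sum_(0 <= k < n) nsq (single j h k) <= nsq h.
Proof.
have -> : \sum_(0 <= k < n) nsq (single j h k) = if (j < n)%N then nsq h else 0.
  elim: n => [|n IH]; first by rewrite big_geq.
  rewrite big_nat_recr //= IH /single ltnS; case: ltngtP => jn; rewrite ?nsq0 ?addr0 ?add0r //.
by case: ifP => _ //; exact: nsq_ge0.
Qed.

Lemma l2_single j h : l2 (single j h).
Proof. by exists (nsq h) => n; exact: sum_single. Qed.

Lemma l2sq_single_le j h : l2sq (single j h) <= nsq h.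
Proof. by apply: l2sq_le => n; exact: sum_single. Qed.

Lemma single_lin j (a : R[i]) h h' :
  single j (a *: h + h') = a *: single j h + single j h'.
Proof.
by apply/funext => k; rewrite /single !fctE; case: ifP => // _; rewrite scaler0 addr0.
Qed.

Lemma initseg0 u : initseg 0 u = 0. Proof. by []. Qed.

Lemma initsegS n u : initseg n.+1 u = initseg n u + single n (u n).
Proof.
apply/funext => k; rewrite /initseg /single !fctE ltnS.
by case: ltngtP => [||->]; rewrite ?addr0 ?add0r.
Qed.

Lemma initseg_cvg u : l2 u -> null (fun n => l2sq (u - initseg n u)).
Proof.
move=> lu e e0; have cu := l2_cvg lu lu.
have /cvgrPdist_lt/(_ e e0) := cu; apply: filterS => n /= hn.
apply: le_lt_trans hn; rewrite -[limn _]/(l2sq u).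
apply: le_trans (ler_norm _); apply: l2sq_le => m; rewrite lerBrDr.
apply: le_trans (l2sq_ub (m + n) lu).
apply: (@le_trans _ _ (\sum_(0 <= k < m + n) nsq ((u - initseg n u) k) +
   \sum_(0 <= k < m + n) nsq (initseg n u k))).
  apply: lerD.
    rewrite (big_cat_nat (leq0n _) (leq_addr n m)) /= ler_wpDr // sumr_ge0 //.
    by move=> k _; exact: nsq_ge0.
  rewrite (big_cat_nat (leq0n _) (leq_addl m n)) /= ler_wpDr //.
    by rewrite sumr_ge0 // => k _; exact: nsq_ge0.
  by apply: ler_sum_nat => k /andP[_ kn]; rewrite /initseg kn.
rewrite -big_split /=; apply: ler_sum => k _; rewrite /initseg !fctE.
by case: ifP => _; rewrite ?subrr ?subr0 ?nsq0 ?addr0 ?add0r.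
Qed.

Lemma l2_initseg n u : l2 (initseg n u).
Proof.
elim: n => [|n IH]; first exact: l2_mem0.
by rewrite initsegS; apply: (psd_memD l2_form) => //; exact: l2_single.
Qed.

End SquareSummable.

(** * Operator *-algebras and the strong topology *)

Section StarAlgebra.
Context {R : realType} {H : completeNormedModType R[i]}.
Variable dot : {dot H for Num.conj}.
Hypothesis hN : hilbert_norm dot.
Local Notation op := (H -> H).
Local Notation ip := (re_dot dot).
Local Notation nsq := (sqnorm dot).
Implicit Types (x y z : op) (M N : set op).

(** Unital *-algebras of bounded operators, with no closure in any topology. *)
Record star_algebra N : Prop := StarAlgebra {
  star_bounded : N `<=` bounded_op;
  star_one : N idfun;
  star_lin : forall (a : R[i]) x y, N x -> N y -> N (a *: x + y);
  star_comp : forall x y, N x -> N y -> N (x \o y);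
  star_star : star_closed dot N }.

Definition adj x : op := get (fun y => adjoint dot x y).

Lemma adjE x y : adjoint dot x y -> adj x = y.
Proof.
move=> xy; apply: (@adjoint_uniq _ _ dot x) => //.
by rewrite /adj; case: xgetP => [z _ //|/(_ y)]; case.
Qed.

Lemma adjoint_id : adjoint dot idfun idfun. Proof. by []. Qed.

Lemma adjoint_comp x x' y y' : adjoint dot x x' -> adjoint dot y y' ->
  adjoint dot (x \o y) (y' \o x').
Proof. by move=> xx yy v w /=; rewrite xx yy. Qed.

Lemma adjoint_lin (a : R[i]) x x' y y' : adjoint dot x x' -> adjoint dot y y' ->
  adjoint dot (a *: x + y) (a^* *: x' + y').
Proof.
move=> xx yy v w; rewrite !fctE dotDl dotZl xx yy [RHS]dotC dotDl dotZl.
by rewrite rmorphD rmorphM /= -!dotC conjcK.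
Qed.

Section InStarAlgebra.
Context {N : set op}.
Hypothesis sN : star_algebra N.

Lemma star_adjP x : N x -> adjoint dot x (adj x).
Proof. by move=> /(star_star sN)[y _ xy]; rewrite (adjE xy). Qed.

Lemma star_adj x : N x -> N (adj x).
Proof. by move=> /(star_star sN)[y Ny xy]; rewrite (adjE xy). Qed.

Lemma star_adjK x : N x -> adj (adj x) = x.
Proof. by move=> Nx; apply/adjE/adjoint_sym/star_adjP. Qed.

Lemma star_adj_comp x y : N x -> N y -> adj (x \o y) = adj y \o adj x.
Proof. by move=> Nx Ny; apply/adjE/adjoint_comp; exact: star_adjP. Qed.

Lemma star_adj_lin (a : R[i]) x y : N x -> N y ->
  adj (a *: x + y) = a^* *: adj x + adj y.
Proof. by move=> Nx Ny; apply/adjE/adjoint_lin; exact: star_adjP. Qed.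

Lemma star_zero : N 0.
Proof.
have := star_lin sN (-1) (star_one sN) (star_one sN).
by rewrite scaleN1r addNr.
Qed.

Lemma star_add x y : N x -> N y -> N (x + y).
Proof. by move=> Nx Ny; rewrite -[x]scale1r; exact: (star_lin sN). Qed.

Lemma star_scale (a : R[i]) x : N x -> N (a *: x).
Proof. by move=> Nx; rewrite -[_ *: _]addr0; apply: (star_lin sN) => //; exact: star_zero. Qed.

Lemma star_opp x : N x -> N (- x).
Proof. by move=> Nx; rewrite -scaleN1r; exact: star_scale. Qed.

Lemma star_sub x y : N x -> N y -> N (x - y).
Proof. by move=> Nx Ny; apply: star_add => //; exact: star_opp. Qed.

End InStarAlgebra.

Lemma compDr x y z : bounded_op x -> x \o (y + z) = (x \o y) + (x \o z).
Proof. by move=> bx; apply/funext => v; rewrite /= !fctE (bopD bx). Qed.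

Lemma compZr (a : R[i]) x y : bounded_op x -> x \o (a *: y) = a *: (x \o y).
Proof. by move=> bx; apply/funext => v; rewrite /= !fctE (bopZ bx). Qed.

Lemma compBr x y z : bounded_op x -> x \o (y - z) = (x \o y) - (x \o z).
Proof. by move=> bx; apply/funext => v; rewrite /= !fctE (bopB bx). Qed.

Lemma compDl x y z : (y + z) \o x = (y \o x) + (z \o x). Proof. by []. Qed.
Lemma compBl x y z : (y - z) \o x = (y \o x) - (z \o x). Proof. by []. Qed.
Lemma compZl (a : R[i]) x y : (a *: y) \o x = a *: (y \o x). Proof. by []. Qed.

Lemma bounded_op_id : bounded_op (idfun : op).
Proof. by split=> // v; exact: cvg_id. Qed.

Lemma nbound_comp (C C' : R) x y : 0 <= C -> nbound dot C x -> nbound dot C' y ->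
  nbound dot (C * C') (x \o y).
Proof.
move=> C0 xC yC v; apply: le_trans (xC _) _.
by rewrite -mulrA ler_wpM2l.
Qed.

Lemma nbound_lin (C C' : R) (a : R[i]) x y : nbound dot C x -> nbound dot C' y ->
  nbound dot ((Re a ^+ 2 + Im a ^+ 2) * C *+ 2 + C' *+ 2) (a *: x + y).
Proof.
move=> xC yC v; apply: le_trans (nsqD_le _ _ _) _; rewrite nsqZ.
have c0 : 0 <= Re a ^+ 2 + Im a ^+ 2 by rewrite addr_ge0 ?sqr_ge0.
by have := ler_wpM2l c0 (xC v); have := yC v; lra.
Qed.

Lemma nbound_le (C C' : R) x : C <= C' -> nbound dot C x -> nbound dot C' x.
Proof. by move=> CC xC v; apply: le_trans (xC v) _; rewrite ler_wpM2r // nsq_ge0. Qed.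

Lemma bounded_op_comp x y : bounded_op x -> bounded_op y -> bounded_op (x \o y).
Proof.
move=> bx by_; have [C C0 xC] := bounded_op_nbound hN bx.
have [C' C'0 yC] := bounded_op_nbound hN by_.
apply: (nbound_bounded_op hN _ (nbound_comp C0 xC yC)) => a v w /=.
by rewrite by_.1 bx.1.
Qed.

Lemma bounded_op_lin (a : R[i]) x y : bounded_op x -> bounded_op y ->
  bounded_op (a *: x + y).
Proof.
move=> bx by_; have [C C0 xC] := bounded_op_nbound hN bx.
have [C' C'0 yC] := bounded_op_nbound hN by_.
apply: (nbound_bounded_op hN _ (@nbound_lin _ _ a _ _ xC yC)) => b v w.
rewrite !fctE by_.1 bx.1 !scalerDr !scalerA -!addrA [_ * b]mulrC; congr (_ + _).
by rewrite addrCA.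
Qed.

Lemma sot_cvg_linear (x : nat -> op) l : (forall n, linear (x n)) ->
  sot_cvg dot x l -> linear l.
Proof.
move=> lx xl a v w; apply/eqP; rewrite -subr_eq0; apply/eqP/(@nsq_eq0 _ _ dot).
apply: (null_cst_eq0 (nsq_ge0 _ _)).
set c := Re a ^+ 2 + Im a ^+ 2; have c0 : 0 <= c by rewrite addr_ge0 ?sqr_ge0.
apply: null_le (nullD (nullZ (ler0n _ 2) (xl (a *: v + w)))
  (nullZ (ler0n _ 4) (nullD (nullZ c0 (xl v)) (xl w)))) => n.
have := nsqB_tri dot (l (a *: v + w)) (x n (a *: v + w)) (a *: l v + l w).
rewrite [nsq (l _ - x n _)]nsqBC lx.
have -> : a *: x n v + x n w - (a *: l v + l w) = a *: (x n v - l v) + (x n w - l w).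
  by rewrite scalerBr opprD addrACA.
have := nsqD_le dot (a *: (x n v - l v)) (x n w - l w); rewrite nsqZ -/c.
move: (nsq _) (nsq _) (nsq _) (nsq _) (nsq _) => *; lra.
Qed.

Lemma sot_cvg_nbound (C : R) (x : nat -> op) l : (forall n, nbound dot C (x n)) ->
  sot_cvg dot x l -> nbound dot C l.
Proof. by move=> xC xl v; apply: nsq_limit_le (xl v) _ => n; exact: xC. Qed.

Lemma sot_cvg_comp (C : R) (x y : nat -> op) l k : 0 <= C ->
  (forall n, bounded_op (x n)) -> (forall n, nbound dot C (x n)) ->
  sot_cvg dot x l -> sot_cvg dot y k -> sot_cvg dot (fun n => x n \o y n) (l \o k).
Proof.
move=> C0 bx xC xl yk v.
apply: null_le (nullD (nullZ (ler0n _ 2) (nullZ C0 (yk v)))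
  (nullZ (ler0n _ 2) (xl (k v)))) => n /=.
have := nsqB_tri dot (x n (y n v)) (x n (k v)) (l (k v)).
by rewrite -(bopB (bx n)); have := xC n (y n v - k v); lra.
Qed.

Lemma sot_cvg_cst x : sot_cvg dot (fun=> x) x.
Proof. by move=> v e e0; near=> n; rewrite subrr nsq0. Unshelve. all: by end_near. Qed.

Lemma sot_cvg_ip (x : nat -> op) l v w : sot_cvg dot x l ->
  null (fun n => `|ip (x n v) w - ip (l v) w|).
Proof.
move=> xl; apply: null_le (psd_null_sqr_cross (ip_form dot)
  (fun n => (I : setT (x n v - l v))) (I : setT w) (xl v)) => n.
by rewrite ipBl.
Qed.

Lemma null_eq (a : nat -> R) b c : null (fun n => `|a n - b|) ->
  null (fun n => `|a n - c|) -> b = c.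
Proof.
move=> ab ac; apply/eqP; rewrite -subr_eq0; apply/eqP/normr0_eq0.
apply: (null_cst_eq0 (normr_ge0 _)); apply: null_le (nullD ab ac) => n.
by rewrite [`|a n - b|]distrC -[b - c](subrKA (a n)) ler_normD.
Qed.

Lemma sot_cvg_adjoint (x y : nat -> op) l k :
  linear l -> (forall n, adjoint dot (x n) (y n)) ->
  sot_cvg dot x l -> sot_cvg dot y k -> adjoint dot l k.
Proof.
move=> ll xy xl yk; apply/adjointP => // v w; rewrite [RHS]ipC.
apply: null_eq (sot_cvg_ip v w xl) _.
apply: null_le (sot_cvg_ip w v yk) => n.
by rewrite (adjoint_ip _ _ (xy n)) ipC.
Qed.

(** Positivity is a condition on matrix coefficients, which converge. *)
Lemma sot_cvg_positive (x : nat -> op) l : (forall n, positive_op dot (x n)) ->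
  sot_cvg dot x l -> positive_op dot l.
Proof.
move=> xp xl v; rewrite lecE; apply/andP; split; last first.
  rewrite /= -[Re _]/(ip (l v) v) -oppr_le0; apply: null_cst0.
  apply: null_le (sot_cvg_ip v v xl) => n.
  have := Re_ge0 (xp n v); rewrite -/(ip _ _) => h.
  have := ler_norm (ip (x n v) v - ip (l v) v); lra.
apply/eqP; rewrite Im_dot; apply: null_eq (sot_cvg_ip v ('i *: v) xl) _ => //=.
move=> e e0; near=> n; rewrite -Im_dot.
by rewrite (ger0_Im (xp n v)) subrr normr0.
Unshelve. all: by end_near. Qed.

(** The commutant of a self-adjoint set is self-adjoint: take adjoints in
    x z^* = z^* x. *)
Lemma commutant_star (S : set op) : S `<=` bounded_op -> star_closed dot S ->
  star_algebra (commutant S).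
Proof.
move=> Sb Ss; split.
- by move=> x [].
- by split; [exact: bounded_op_id | move=> y _; apply/funext].
- move=> a x y [bx cx] [by_ cy]; split; first exact: bounded_op_lin.
  move=> z Sz; have bz := Sb _ Sz.
  by rewrite compDl compZl compDr // compZr // cx // cy.
- move=> x y [bx cx] [by_ cy]; split; first exact: bounded_op_comp.
  by move=> z cz; rewrite -compA cy // compA cx.
- move=> x [bx cx]; have [y xy] := adjoint_ex hN bx; exists y => //.
  split; first exact: (adjoint_bounded hN bx xy).
  move=> z Sz; have [z' Sz' zz] := Ss _ Sz.
  have := cx _ Sz' => e.
  apply: (@adjoint_uniq _ _ dot (z' \o x)).
    exact: (adjoint_comp (adjoint_sym zz) xy).
  rewrite -e; exact: (adjoint_comp xy (adjoint_sym zz)).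
Qed.

Lemma commutant_anti (S S' : set op) : S `<=` S' -> commutant S' `<=` commutant S.
Proof. by move=> SS x [bx cx]; split=> // y /SS; exact: cx. Qed.

Lemma sub_bicommutant (S : set op) : S `<=` bounded_op -> S `<=` commutant (commutant S).
Proof. by move=> Sb x Sx; split; [exact: Sb|move=> y [_ cy]; rewrite cy]. Qed.

Lemma bicommutant_von_neumann (S : set op) : S `<=` bounded_op -> star_closed dot S ->
  von_neumann dot (commutant (commutant S)).
Proof.
move=> Sb Ss; have cS := commutant_star Sb Ss.
have ccS := commutant_star (star_bounded cS) (star_star cS).
split; [exact: (star_bounded ccS)|exact: (star_star ccS)|].
apply/seteqP; split; last exact/sub_bicommutant/(star_bounded ccS).
exact/commutant_anti/sub_bicommutant/(star_bounded cS).
Qed.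

Lemma von_neumann_star M : von_neumann dot M -> star_algebra M.
Proof.
move=> [Mb Ms <-]; have cM := commutant_star Mb Ms.
exact: commutant_star (star_bounded cM) (star_star cM).
Qed.

Lemma commutant_sot (S : set op) (C : R) (x : nat -> op) l :
  (forall n, commutant S (x n)) -> (S `<=` bounded_op) ->
  (forall n, nbound dot C (x n)) -> sot_cvg dot x l -> commutant S l.
Proof.
move=> cx bS xC xl; split.
  apply: (nbound_bounded_op hN _ (sot_cvg_nbound xC xl)).
  by apply: sot_cvg_linear xl => n; exact: (cx n).1.1.
move=> y Sy; have [C' C'0 yC] := bounded_op_nbound hN (bS _ Sy).
apply: (@sot_cvg_uniq _ _ dot (fun n => x n \o y)) => [v|]; first exact: xl.
have -> : (fun n => x n \o y) = (fun n => y \o x n).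
  by apply/funext => n; exact: (cx n).2.
by apply: (sot_cvg_comp C'0) => //; [move=> _; exact: bS|exact: sot_cvg_cst].
Qed.

Lemma von_neumann_sot M (C : R) (x : nat -> op) l : von_neumann dot M ->
  (forall n, M (x n)) -> (forall n, nbound dot C (x n)) -> sot_cvg dot x l -> M l.
Proof.
move=> [Mb Ms MM] Mx xC xl; rewrite -MM; apply: commutant_sot xl => //.
- by rewrite MM.
- by move=> y [].
Qed.

End StarAlgebra.

(** * Square roots and *-endomorphisms *)

Section SquareRoot.
Context {R : realType} {H : completeNormedModType R[i]}.
Variable dot : {dot H for Num.conj}.
Hypothesis hN : hilbert_norm dot.
Local Notation op := (H -> H).
Local Notation ip := (re_dot dot).
Local Notation nsq := (sqnorm dot).
Variable A : set op.
Hypothesis vA : von_neumann dot A.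
Implicit Types (x y z : op).

Let sA : star_algebra dot A := von_neumann_star hN vA.

(** The triangle inequality for operator norms s and t, in squared form. *)
Lemma nbound_add (s t : R) x y : 0 <= s -> 0 <= t ->
  nbound dot (s ^+ 2) x -> nbound dot (t ^+ 2) y ->
  nbound dot ((s + t) ^+ 2) (x + y).
Proof.
move=> s0 t0 xs yt v; rewrite fctE.
have := psd_sqrD (ip_form dot) (I : setT (x v)) (I : setT (y v)).
have := psd_cauchy_schwarz (ip_form dot) (I : setT (x v)) (I : setT (y v)).
rewrite -!/(nsq _) => h ->; have n0 := nsq_ge0 dot v.
have : ip (x v) (y v) <= s * t * nsq v.
  apply: le_trans (ler_norm _) _.
  rewrite -(@ler_pXn2r _ 2) ?nnegrE ?mulr_ge0 // real_normK ?num_real //.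
  apply: le_trans h _; rewrite !exprMn [nsq v ^+ 2]expr2 mulrACA.
  by apply: ler_pM; rewrite ?nsq_ge0 ?xs ?yt.
by have := xs v; have := yt v; rewrite sqrrD; lra.
Qed.

Lemma nbound_scale (s : R) (C : R) x : nbound dot C x ->
  nbound dot (s ^+ 2 * C) (s%:C *: x).
Proof.
by move=> xC v; rewrite fctE nsqZr -mulrA ler_wpM2l ?sqr_ge0.
Qed.

Lemma adjoint_zero : adjoint dot (0 : op) 0.
Proof.
move=> v w; rewrite -[(0 : op) v]/(0 : H) -[(0 : op) w]/(0 : H).
by rewrite linear0l linear0r.
Qed.

Lemma nbound_zero : nbound dot (0 ^+ 2) (0 : op).
Proof. by move=> v; rewrite -[(0 : op) v]/(0 : H) nsq0 expr0n mul0r. Qed.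

(** The increasing iteration t -> (1 + t^2) / 2 towards 1; it majorises the
    iteration y -> (b + y^2) / 2 below, whose limit y satisfies
    (1 - y)^2 = 1 - b. *)
Fixpoint root_scalar (n : nat) : R :=
  if n is m.+1 then (1 + root_scalar m ^+ 2) / 2 else 0.

Fixpoint root_iter (b : op) (n : nat) : op :=
  if n is m.+1 then 2^-1%:C *: (b + (root_iter b m \o root_iter b m)) else 0.

Local Notation t := root_scalar.

Lemma root_scalar01 n : 0 <= t n <= 1.
Proof. by elim: n => [|n /andP[h1 h2]] /=; [rewrite lexx ler01 | apply/andP; nra]. Qed.

Lemma root_scalar_step n : t n <= t n.+1.
Proof. by have := sqr_ge0 (t n - 1); rewrite sqrrB1 /=; lra. Qed.

Lemma root_scalar_mono n m : (n <= m)%N -> t n <= t m.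
Proof. by apply: (homo_leq (@lexx _ R) (@le_trans _ R)); exact: root_scalar_step. Qed.

Section Iterates.
Context {b : op}.
Hypotheses (Ab : A b) (bb : adjoint dot b b) (b1 : nbound dot 1 b).
Local Notation y := (root_iter b).

Lemma root_iter_mem n : A (y n).
Proof.
elim: n => [|n IH] /=; first exact: (star_zero sA).
by apply: (star_scale sA); apply: (star_add sA) => //; exact: (star_comp sA).
Qed.

Lemma root_iter_adjoint n : adjoint dot (y n) (y n).
Proof.
elim: n => [|n IH] /=; first exact: adjoint_zero.
apply/adjointP; first exact: (star_bounded sA (root_iter_mem n.+1)).1.
move=> v w; rewrite !fctE ipZl ipZr ipDl ipDr /= (adjoint_ip _ _ bb).
by rewrite !(adjoint_ip _ _ IH).
Qed.

Lemma root_iter_nbound n : nbound dot (t n ^+ 2) (y n).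
Proof.
elim: n => [|n IH]; first exact: nbound_zero.
have /andP[t0 _] := root_scalar01 n.
rewrite expr_div_n mulrC -exprVn; apply: nbound_scale.
apply: nbound_add => //; first exact: sqr_ge0; first by rewrite expr1n.
by have := nbound_comp (sqr_ge0 (t n)) IH IH; rewrite -expr2.
Qed.

(** The increments are majorised thanks to the factorisation
    y'^2 - y^2 = y' (y' - y) + (y' - y) y, valid without commutation. *)
Lemma root_iter_step n : nbound dot ((t n.+1 - t n) ^+ 2) (y n.+1 - y n).
Proof.
elim: n => [|n IH].
  rewrite !subr0 /= expr_div_n mulrC -exprVn; apply: nbound_scale.
  have -> : b + ((0 : op) \o (0 : op)) = b by apply/funext => v; rewrite !fctE addr0.
  by rewrite expr0n addr0 expr1n.
have by_ k := star_bounded sA (root_iter_mem k).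
have /andP[t0 _] := root_scalar01 n; have /andP[t1 _] := root_scalar01 n.+1.
have := root_scalar_step n; rewrite -subr_ge0 => d0.
have -> : t n.+2 - t n.+1 = 2^-1 * (t n.+1 * (t n.+1 - t n) + (t n.+1 - t n) * t n).
  by rewrite -[t n.+2]/((1 + t n.+1 ^+ 2) / 2) -[t n.+1]/((1 + t n ^+ 2) / 2); field.
have -> : y n.+2 - y n.+1 = 2^-1%:C *: ((y n.+1 \o (y n.+1 - y n)) + ((y n.+1 - y n) \o y n)).
  have eS k : y k.+1 = 2^-1%:C *: (b + (y k \o y k)) by [].
  rewrite (eS n.+1) [X in _ - X = _]eS -scalerBr; congr (_ *: _).
  by rewrite compBr // compBl subrKA opprD addrACA subrr add0r.
rewrite exprMn; apply: nbound_scale; apply: nbound_add.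
- exact: mulr_ge0.
- exact: mulr_ge0.
- by rewrite exprMn; apply: nbound_comp => //; [exact: sqr_ge0|exact: root_iter_nbound].
by rewrite exprMn; apply: nbound_comp => //; [exact: sqr_ge0|exact: root_iter_nbound].
Qed.

Lemma root_iter_dist n m : (n <= m)%N -> nbound dot ((t m - t n) ^+ 2) (y m - y n).
Proof.
elim: m => [|m IH]; first by rewrite leqn0 => /eqP ->; rewrite !subrr; exact: nbound_zero.
rewrite leq_eqVlt => /orP[/eqP ->|nm]; first by rewrite !subrr; exact: nbound_zero.
rewrite -[t m.+1 - _](subrKA (t m)) -[y m.+1 - _](subrKA (y m)).
apply: nbound_add; rewrite ?subr_ge0 ?root_scalar_step ?root_scalar_mono //.
  exact: root_iter_step.
exact: IH.
Qed.

Lemma root_iter_cvg : exists l, sot_cvg dot y l.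
Proof.
have tcv : cvgn t.
  apply: nondecreasing_is_cvgn; first exact: root_scalar_mono.
  by exists 1 => _ [n _ <-]; have /andP[] := root_scalar01 n.
have tle n : t n <= limn t.
  by apply: nondecreasing_cvgn_le => //; exact: root_scalar_mono.
have cy v : form_cauchy ip (fun n => y n v).
  move=> e e0; have k0 : 0 < nsq v + 1 by rewrite ltr_wpDl // nsq_ge0.
  have /cvgrPdist_lt/(_ _ (divr_gt0 e0 k0))[M _ hM] := tcv.
  exists M => n m; wlog nm : n m / (n <= m)%N.
    move=> h Mn Mm; case: (leqP n m) => [nm|/ltnW mn]; first exact: h.
    by rewrite -/(nsq _) nsqBC; exact: h.
  move=> Mn _; apply: (@le_lt_trans _ _ (nsq (y m v - y n v))).
    by rewrite -/(nsq _) nsqBC.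
  apply: le_lt_trans (root_iter_dist nm v) _.
  have := hM n Mn; rewrite /= ltr_pdivlMr // => h.
  apply: le_lt_trans h; rewrite ger0_norm ?subr_ge0 //.
  have := nsq_ge0 dot v; have := root_scalar_mono nm; have := tle m.
  have /andP[_] := root_scalar01 m; have /andP[+ _] := root_scalar01 n.
  move: (limn t) (t m) (t n) (nsq v) => L p q r q0 p1 pL qp r0.
  by apply: ler_pM; rewrite ?sqr_ge0 //; [nra | lra].
have ex v : exists l, null (fun n => nsq (y n v - l)).
  by have [l _ h] := nsq_complete hN (fun=> I) (cy v); exists l.
have [l lP] := choice ex.
by exists l.
Qed.

Lemma sqrt_of_contraction : exists w, [/\ A w, adjoint dot w w & w \o w = idfun - b].
Proof.
have [l yl] := root_iter_cvg.
have y1 n : nbound dot 1 (y n).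
  apply: nbound_le (root_iter_nbound n); have /andP[] := root_scalar01 n; nra.
have by_ k := star_bounded sA (root_iter_mem k).
have Al : A l by exact: (von_neumann_sot hN vA root_iter_mem y1 yl).
have bl := star_bounded sA Al.
have ll : adjoint dot l l.
  exact: (sot_cvg_adjoint bl.1 root_iter_adjoint yl yl).
have fixl : l = 2^-1%:C *: (b + (l \o l)).
  apply: (@sot_cvg_uniq _ _ dot (fun n => y n.+1)) => v.
    by move=> e /(yl v)[N _ hN']; exists N => // n Nn; exact: (hN' n.+1 (leqW Nn)).
  apply: null_le (sot_cvg_comp ler01 by_ y1 yl yl v) => n /=.
  rewrite !fctE -scalerBr nsqZr opprD addrACA subrr add0r.
  by have := nsq_ge0 dot (y n (y n v) - l (l v)); lra.
exists (idfun - l); split.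
- exact: (star_sub sA (star_one sA)).
- have : adjoint dot ((-1) *: l + idfun) ((-1)^* *: l + idfun).
    exact: adjoint_lin.
  by rewrite rmorphN1 scaleN1r [- l + _]addrC.
- have l2 : l + l = b + (l \o l).
    by rewrite {1 2}fixl -scalerDr scale_half_double.
  apply/funext => v; have := congr1 (fun h : op => h v) l2.
  rewrite /= !fctE /= (bopB bl) => l2v.
  have -> : l (l v) = l v + l v - b v by rewrite l2v [b v + _]addrC addrK.
  by rewrite opprB -!addrA addKr [l v + _]addrCA subrr addr0.
Qed.

End Iterates.

(** Polarisation: an operator with real diagonal coefficients is self-adjoint. *)
Lemma positive_adjoint x : bounded_op x -> positive_op dot x -> adjoint dot x x.
Proof.
move=> bx px; apply/adjointP; first exact: bx.1.
have im0 v : ip (x v) ('i *: v) = 0 by rewrite -Im_dot; exact: ger0_Im.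
move=> v w; rewrite [RHS]ipC.
have := im0 (v + 'i *: w); rewrite (bopD bx) (bopZ bx) scalerDr !ipDl !ipDr.
rewrite !ip_ii !im0.
rewrite scalerA; have -> : 'i * 'i = -1 :> R[i] by apply: eq_ReIm => /=; ring.
rewrite scaleN1r.
have -> : ip (x v) (- w) = - ip (x v) w by exact: (psdNr (ip_form dot)).
by move=> h; apply/eqP; rewrite -subr_eq0; apply/eqP; lra.
Qed.

(** For k at least the norm of x, the operator 1 - x / k is a contraction, to which
    [sqrt_of_contraction] applies. *)
Lemma positive_sqrt x : A x -> positive_op dot x ->
  exists w, [/\ A w, adjoint dot w w & w \o w = x].
Proof.
move=> Ax px; have bx := star_bounded sA Ax.
have xx := positive_adjoint bx px.
have [C C0 xC] := bounded_op_nbound hN bx.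
pose k := C + 1; have k0 : 0 < k by rewrite ltr_wpDl.
pose g v w := ip (x v) w.
have gF : psd_form setT g.
  split=> // [a u v w _ _ _|u v _ _|u _]; rewrite /g.
  - by rewrite (bopD bx) (bopZ bx) ipDl ipZl.
  - by rewrite (adjoint_ip _ _ xx) ipC.
  - exact/Re_ge0/px.
have gk v : g v v <= k * nsq v.
  have n0 := nsq_ge0 dot v.
  apply: le_trans (ler_norm _) _.
  rewrite -(@ler_pXn2r _ 2) ?nnegrE ?mulr_ge0 ?(ltW k0) // real_normK ?num_real //.
  apply: le_trans (psd_cauchy_schwarz (ip_form dot) I I) _.
  rewrite -!/(nsq _) exprMn [nsq v ^+ 2]expr2 mulrA ler_wpM2r //.
  by apply: le_trans (xC v) _; rewrite ler_wpM2r // /k; nra.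
have xg v : nsq (x v) <= k * g v v.
  have g0 := psd_ge0 gF (I : setT v).
  have := psd_cauchy_schwarz gF (I : setT v) (I : setT (x v)).
  rewrite -[g v (x v)]/(nsq (x v)) => h.
  have [->|n0] := eqVneq (nsq (x v)) 0; first by rewrite mulr_ge0 // ltW.
  have n1 : 0 < nsq (x v) by rewrite lt_neqAle eq_sym n0 nsq_ge0.
  rewrite -(ler_pM2r n1) -expr2; apply: le_trans h _.
  by rewrite mulrAC mulrC; apply: ler_wpM2r => //; rewrite ?gk //.
pose b := idfun - k^-1%:C *: x.
have Ab : A b by apply: (star_sub sA (star_one sA)); exact: (star_scale sA).
have bb : adjoint dot b b.
  apply/adjointP; first exact: (star_bounded sA Ab).1.
  by move=> v w; rewrite /b !fctE ipBl ipBr ipZl ipZr (adjoint_ip _ _ xx).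
have b1 : nbound dot 1 b.
  move=> v; rewrite /b !fctE mul1r.
  have := psd_sqrB (ip_form dot) (I : setT v) (I : setT (k^-1%:C *: x v)).
  rewrite -!/(nsq _) => ->; rewrite nsqZr ipZr ipC -[ip (x v) v]/(g v v).
  have := xg v; rewrite -ler_pdivrMl // => h.
  have h2 : k^-1 ^+ 2 * nsq (x v) <= k^-1 * g v v.
    by rewrite expr2 -mulrA ler_wpM2l // invr_ge0 ltW.
  have := psd_ge0 gF (I : setT v) => g0.
  have : 0 <= k^-1 * g v v by rewrite mulr_ge0 // invr_ge0 ltW.
  by move: h2; move: (k^-1 * g v v) (k^-1 ^+ 2 * _) (nsq v) => p q r; lra.
have [w [Aw ww wb]] := sqrt_of_contraction Ab bb b1.
exists ((Num.sqrt k)%:C *: w); split.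
- exact: (star_scale sA).
- apply/adjointP; first exact: (star_bounded sA (star_scale sA _ Aw)).1.
  by move=> v v'; rewrite !fctE ipZl ipZr (adjoint_ip _ _ ww).
- rewrite compZl compZr; last exact: (star_bounded sA).
  rewrite wb /b subKr !scalerA -!rmorphM /= -expr2 sqr_sqrtr ?ltW //.
  by rewrite mulfV ?gt_eqF // scale1r.
Qed.

Record star_endo (g : op -> op) : Prop := StarEndo {
  endo_mem : forall x, A x -> A (g x);
  endo_lin : linear_on A g;
  endo_comp : forall x y, A x -> A y -> g (x \o y) = g x \o g y;
  endo_adjoint : forall x y, A x -> A y -> adjoint dot x y -> adjoint dot (g x) (g y);
  endo_one : g idfun = idfun }.

Section Endo.
Context {g : op -> op}.
Hypothesis hg : star_endo g.

Lemma endo_add x y : A x -> A y -> g (x + y) = g x + g y.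
Proof. by move=> Ax Ay; have := endo_lin hg 1 Ax Ay; rewrite !scale1r. Qed.

Lemma endo_zero : g 0 = 0.
Proof.
have A0 := star_zero sA.
by have /eqP := endo_add A0 A0; rewrite addr0 -subr_eq0 opprD addrA subrr sub0r
  oppr_eq0 => /eqP.
Qed.

Lemma endo_scale (a : R[i]) x : A x -> g (a *: x) = a *: g x.
Proof.
move=> Ax; have := endo_lin hg a Ax (star_zero sA).
by rewrite endo_zero !addr0.
Qed.

Lemma endo_sub x y : A x -> A y -> g (x - y) = g x - g y.
Proof.
move=> Ax Ay; rewrite -scaleN1r endo_add ?endo_scale ?scaleN1r //.
exact: (star_opp sA).
Qed.

Lemma endo_adj x : A x -> adj dot (g x) = g (adj dot x).
Proof.
move=> Ax; apply: adjE; apply: (endo_adjoint hg) => //.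
  exact: (star_adj sA).
exact: (star_adjP sA).
Qed.

(** A positive x is w^2 with w self-adjoint, and g preserves this form. *)
Lemma endo_positive x : A x -> positive_op dot x -> positive_op dot (g x).
Proof.
move=> Ax px; have [w [Aw ww wx]] := positive_sqrt Ax px.
move=> v; rewrite -wx (endo_comp hg) //= (endo_adjoint hg Aw Aw ww).
exact: dnorm_ge0.
Qed.

(** C - x^* x is positive, hence so is its image C - g(x)^* g(x). *)
Lemma endo_nbound (C : R) x : A x -> nbound dot C x -> nbound dot C (g x).
Proof.
move=> Ax xC; have Ax' := star_adj sA Ax; have xx := star_adjP sA Ax.
pose z := C%:C *: idfun - (adj dot x \o x).
have Axx : A (adj dot x \o x) by exact: (star_comp sA).
have AC : A (C%:C *: idfun) by apply: (star_scale sA); exact: (star_one sA).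
have Az : A z by exact: (star_sub sA).
have dz v (y y' : op) : adjoint dot y y' -> dot ((C%:C *: idfun - (y' \o y)) v) v =
    (C * nsq v - nsq (y v))%:C.
  move=> yy; rewrite -[(_ - _) v]/(C%:C *: v - y' (y v)) linearBl /= dotZl.
  rewrite (adjoint_sym yy) !dot_sqrE.
  by move: (nsq v) (nsq (y v)) => p q; apply: eq_ReIm => /=; ring.
have pz : positive_op dot z.
  by move=> v; rewrite dz // ler0c subr_ge0.
have gz : g z = C%:C *: idfun - (g (adj dot x) \o g x).
  rewrite /z (endo_sub AC Axx) (endo_scale _ (star_one sA)) (endo_one hg).
  by rewrite (endo_comp hg Ax' Ax).
move=> v; have := endo_positive Az pz v.
rewrite gz dz; first by rewrite ler0c subr_ge0.
exact: (endo_adjoint hg).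
Qed.

End Endo.

End SquareRoot.

(** * Convex hulls of operators *)

Section MoreOperators.
Context {R : realType} {H : completeNormedModType R[i]}.
Variable dot : {dot H for Num.conj}.
Hypothesis hN : hilbert_norm dot.
Local Notation op := (H -> H).
Local Notation ip := (re_dot dot).
Local Notation nsq := (sqnorm dot).
Local Notation l2 := (l2 dot).
Local Notation l2ip := (l2ip dot).
Local Notation l2sq := (l2sq dot).
Implicit Types (x y z : op) (u : nat -> H).

Lemma ip_adjZ (a : R[i]) (v w : H) : ip (a *: v) w = ip v (a^* *: w).
Proof.
rewrite /re_dot dotZl dotZr; congr (Re (_ * _)); exact: (esym (conjcK a)).
Qed.

Lemma l2ip_adjZ (a : R[i]) (u v : nat -> H) : l2ip (a *: u) v = l2ip u (a^* *: v).
Proof.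
by congr (limn (series _)); apply/funext => k; rewrite !fctE ip_adjZ.
Qed.

(** Dominated convergence: a bounded strongly null sequence is small on the finite
    initial segment of u and controlled by its bound on the tail. *)
Lemma null_l2sq_comp (K : R) (x : nat -> op) u : 0 <= K ->
  (forall n, bounded_op (x n)) -> (forall n, nbound dot K (x n)) ->
  sot_cvg dot x 0 -> l2 u -> null (fun n => l2sq (x n \o u)).
Proof.
move=> K0 bx xK x0 lu e e0.
have k0 : 0 < 4 * K + 1 by lra.
have [M _ /(_ M (leqnn M)) /= hM] := initseg_cvg lu (divr_gt0 e0 k0).
have h0 : null (fun n => \sum_(0 <= k < M) nsq (x n (u k))).
  apply: (@null_sum _ (fun k n => nsq (x n (u k)))) => k.
  by apply: null_le (x0 (u k)) => n; rewrite subr0.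
apply: filterS (h0 _ (divr_gt0 e0 (ltr0n _ 4))) => n hn.
have lt := l2_initseg dot M u.
have ld : l2 (u - initseg M u) by exact: (psd_memB (l2_form dot)).
have -> : x n \o u = (x n \o (u - initseg M u)) + (x n \o initseg M u).
  by apply/funext => k; rewrite !fctE /= -(bopD (bx n)) subrK.
have lxt := l2_comp (xK n) lt; have lxd := l2_comp (xK n) ld.
apply: le_lt_trans (psd_sqrD_le (l2_form dot) lxd lxt) _.
have h1 : l2sq (x n \o initseg M u) <= \sum_(0 <= k < M) nsq (x n (u k)).
  apply: l2sq_le => m.
  have tr k : nsq ((x n \o initseg M u) k) = if (k < M)%N then nsq (x n (u k)) else 0.
    by rewrite /= /initseg; case: ifP => // _; rewrite (bop0 (bx n)) nsq0.
  rewrite (eq_bigr _ (fun k _ => tr k)).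
  apply: (@le_trans _ _ (\sum_(0 <= k < M + m) (if (k < M)%N then nsq (x n (u k)) else 0))).
    rewrite [X in _ <= X](big_cat_nat (leq0n _) (leq_addl M m)) /= ler_wpDr //.
    rewrite sumr_ge0 // => k _.
    by case: ifP => // _; exact: nsq_ge0.
  rewrite (big_cat_nat (leq0n _) (leq_addr m M)) /=.
  rewrite [X in _ + X]big_nat_cond [X in _ + X]big1 ?addr0; last first.
    by move=> k /andP[/andP[Mk _] _]; rewrite ltnNge Mk.
  by apply: ler_sum_nat => k /andP[_ ->].
have h2 := l2sq_comp_le K0 (xK n) ld.
move: hM; rewrite ltr_pdivlMr // -/(l2sq _) => hM.
have := psd_ge0 (l2_form dot) ld; rewrite -/(l2sq _) => h3.
have h4 : K * l2sq (u - initseg M u) <= e / 4.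
  have := mulr_ge0 K0 h3; nra.
rewrite -!/(l2sq _); lra.
Qed.

(** Midpoints suffice: minimising a quadratic form only uses the parallelogram
    identity. *)
Inductive hull (S : set op) : op -> Prop :=
| hull_base x : S x -> hull S x
| hull_mid x y : hull S x -> hull S y -> hull S (2^-1%:C *: (x + y)).

Lemma hull_sub (S S' : set op) : S `<=` S' -> hull S `<=` hull S'.
Proof.
move=> SS x; elim=> [y Sy|y z _ hy _ hz]; first exact/hull_base/SS.
exact: hull_mid.
Qed.

Lemma nbound_mid (C : R) x y : nbound dot C x -> nbound dot C y ->
  nbound dot C (2^-1%:C *: (x + y)).
Proof.
move=> xC yC v; rewrite !fctE nsqZr; have := nsqD_le dot (x v) (y v).
have := xC v; have := yC v.
by rewrite (_ : 2^-1 ^+ 2 = 4^-1 :> R); [lra | field].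
Qed.

Lemma positive_mid x y : positive_op dot x -> positive_op dot y ->
  positive_op dot (2^-1%:C *: (x + y)).
Proof.
move=> px py v; rewrite !fctE dotZl dotDl mulr_ge0 ?addr_ge0 ?px ?py //.
by rewrite ler0c invr_ge0 ler0n.
Qed.

End MoreOperators.

(** * The GNS form of a faithful normal state *)

Section State.
Context {R : realType} {H : completeNormedModType R[i]}.
Variable dot : {dot H for Num.conj}.
Hypothesis hN : hilbert_norm dot.
Local Notation op := (H -> H).
Local Notation ip := (re_dot dot).
Local Notation nsq := (sqnorm dot).
Local Notation l2 := (l2 dot).
Local Notation l2ip := (l2ip dot).
Local Notation l2sq := (l2sq dot).
Local Notation adj := (adj dot).
Context {A : set op} (phi : op -> R[i]).
Hypotheses (vA : von_neumann dot A) (hphi : faithful_normal_state dot A phi).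
Implicit Types (x y z : op).

Let sA : star_algebra dot A := von_neumann_star hN vA.

(** Only real parts are used: on a complex subspace they determine phi. *)
Definition re_state x : R := Re (phi x).
Definition gns_ip x z : R := re_state (adj z \o x).
Local Notation fre := re_state.
Local Notation gns := gns_ip.

Lemma phi_lin (a : R[i]) x y : A x -> A y -> phi (a *: x + y) = a * phi x + phi y.
Proof. by have [h _ _ _ _] := hphi => Ax Ay; exact: h. Qed.

Lemma phi0 : phi 0 = 0.
Proof.
have A0 := star_zero sA.
have := phi_lin 1 A0 A0; rewrite scale1r addr0 mul1r => /eqP.
by rewrite -subr_eq0 opprD addrA subrr sub0r oppr_eq0 => /eqP.
Qed.

Lemma phiD x y : A x -> A y -> phi (x + y) = phi x + phi y.
Proof. by move=> Ax Ay; have := phi_lin 1 Ax Ay; rewrite scale1r mul1r. Qed.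

Lemma phiZ (a : R[i]) x : A x -> phi (a *: x) = a * phi x.
Proof. by move=> Ax; have := phi_lin a Ax (star_zero sA); rewrite phi0 !addr0. Qed.

Lemma phi_sqr_ge0 x : A x -> 0 <= phi (adj x \o x).
Proof.
have [_ h _ _ _] := hphi => Ax.
by apply: h => //; [exact: (star_adj sA)|exact: (star_adjP sA)].
Qed.

(** phi is positive, so phi((a x + 1)^* (a x + 1)) is real; the values a = 1 and
    a = i give the two parts of the identity. *)
Lemma phi_adj x : A x -> phi (adj x) = (phi x)^*.
Proof.
move=> Ax; have Ax' := star_adj sA Ax; have A1 := star_one sA.
have Axx : A (adj x \o x) by exact: (star_comp sA).
have key (a : R[i]) : Im (a^* * phi (adj x) + a * phi x) = 0.
  have Az : A (a *: x + idfun) by exact: (star_lin sA).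
  have := phi_sqr_ge0 Az.
  have -> : adj (a *: x + idfun) \o (a *: x + idfun) =
      (a^* * a) *: (adj x \o x) + (a^* *: adj x + (a *: x + idfun)).
    rewrite (star_adj_lin sA) // (adjE (adjoint_id dot)).
    rewrite compDl compZl (compDr _ _ (star_bounded sA Ax')).
    rewrite (compZr _ _ (star_bounded sA Ax')).
    by rewrite scalerDr scalerA -addrA.
  rewrite phi_lin //; last by do 2?apply: (star_lin sA) => //.
  rewrite phi_lin // phi_lin //; have [_ _ -> _ _] := hphi.
  move=> {Az} /ger0_Im; have := ger0_Im (phi_sqr_ge0 Ax).
  case: (phi (adj x \o x)) (phi (adj x)) (phi x) a => p p' [r r'] [s s'] [a a'] /= ->.
  by move=> <-; ring.
have := key 'i%C; have := key 1.
case: (phi (adj x)) (phi x) => [p p'] [r r'] /= h1 h2.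
by congr (_ +i* _); lra.
Qed.

Lemma fre_adj x : A x -> fre (adj x) = fre x.
Proof. by move=> Ax; rewrite /re_state phi_adj // complexReJ. Qed.

Lemma freD x y : A x -> A y -> fre (x + y) = fre x + fre y.
Proof. by move=> Ax Ay; rewrite /re_state phiD // ReD. Qed.

Lemma freZ (a : R) x : A x -> fre (a%:C *: x) = a * fre x.
Proof. by move=> Ax; rewrite /re_state phiZ // ReZ. Qed.

Lemma freB x y : A x -> A y -> fre (x - y) = fre x - fre y.
Proof.
move=> Ax Ay; rewrite freD //; last exact: (star_opp sA).
have -> : - y = (-1)%:C *: y by rewrite rmorphN1 scaleN1r.
by rewrite freZ // mulN1r.
Qed.

Lemma gns_form : psd_form A gns.
Proof.
split=> [||a x y z Ax Ay Az|x y Ax Ay|x Ax]; rewrite /gns_ip.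
- exact: (star_lin sA).
- exact: (star_zero sA).
- have Az' := star_adj sA Az; have bz := star_bounded sA Az'.
  rewrite compDr // compZr // freD ?freZ //; last 3 first.
  + exact: (star_comp sA).
  + by apply: (star_scale sA); exact: (star_comp sA).
  + exact: (star_comp sA).
- rewrite -fre_adj; last by apply: (star_comp sA) => //; exact: (star_adj sA).
  by rewrite (star_adj_comp sA) ?(star_adjK sA) //; exact: (star_adj sA).
- exact/Re_ge0/phi_sqr_ge0.
Qed.

Lemma gns_faithful x : A x -> gns x x = 0 -> x = 0.
Proof.
have [_ _ _ h _] := hphi => Ax q0.
apply: (h x (adj x)) => //; [exact: (star_adj sA)|exact: (star_adjP sA)|].
by rewrite (ge0_RRe (phi_sqr_ge0 Ax)) -[Re _]/(gns x x) q0.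
Qed.

Lemma gns_one x : A x -> gns x idfun = fre x.
Proof. by move=> Ax; rewrite /gns_ip (adjE (adjoint_id dot)). Qed.

Lemma square_summable_l2 (xi : nat -> H) : square_summable xi -> l2 xi.
Proof.
move=> /cvg_ex[L /cvgrPdist_lt/(_ 1 ltr01)[N _ hN']].
exists (Re L + 1) => n.
apply: (@le_trans _ _ (\sum_(0 <= k < N + n) nsq (xi k))).
  rewrite [X in _ <= X](big_cat_nat (leq0n _) (leq_addl N n)) /= ler_wpDr //.
  rewrite sumr_ge0 // => k _.
  exact: nsq_ge0.
have := hN' (N + n)%N (leq_addr _ _); rewrite /= /series /=.
have -> : \sum_(0 <= k < N + n) `|xi k| ^+ 2 = (\sum_(0 <= k < N + n) nsq (xi k))%:C.
  by rewrite rmorph_sum; apply: eq_bigr => k _; exact: norm_nsq.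
move: (\sum_(_ <= _ < _) _) => s.
rewrite normc_def -[1 : R[i]]/(1%:C) ltcR -[X in _ < X]sqrtr1 ltr_sqrt //.
clear hN'; case: L => a b /=; rewrite oppr0 addr0 => h.
have : (a - s) ^+ 2 < 1 by have := sqr_ge0 b; lra.
nra.
Qed.

(** If phi(x) is the sum of the <x xi_k, eta_k>, polarisation of
    <y xi_k, y eta_k> bounds the GNS norm by the norms of y (xi_k + eta_k). *)
Lemma normal_dominated : exists2 u, l2 u &
  forall y, A y -> gns y y <= l2sq (y \o u).
Proof.
have [_ _ _ _ [xi [eta [/square_summable_l2 lxi /square_summable_l2 leta hcv]]]] := hphi.
have lu : l2 (xi + eta) by exact: (psd_memD (l2_form dot)).
exists (xi + eta) => // y Ay.
have Ay' := star_adj sA Ay; have by_ := star_bounded sA Ay.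
have [C C0 yC] := bounded_op_nbound hN by_.
have lyu := l2_comp yC lu.
rewrite leNgt; apply/negP => h.
have /cvgrPdist_lt/(_ (gns y y - l2sq (y \o (xi + eta)))%:C) := hcv _ (star_comp sA Ay' Ay).
rewrite ltcR subr_gt0 => /(_ h)[N _ /(_ N (leqnn N))] /=.
rewrite normc_def ltcR => hlt.
set z := phi _ - _ in hlt.
have : Re z <= Num.sqrt (Re z ^+ 2 + Im z ^+ 2).
  apply: le_trans (ler_norm _) _; rewrite -sqrtr_sqr ler_wsqrtr // lerDl; exact: sqr_ge0.
move=> /le_lt_trans/(_ hlt); rewrite /z ReD ReN -[Re (phi _)]/(gns y y).
suff : Re (series (fun k => dot ((adj y \o y) (xi k)) (eta k)) N) <= l2sq (y \o (xi + eta)) by lra.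
apply: le_trans (l2sq_ub N lyu).
rewrite /series /= (big_morph _ (@ReD R) (erefl : Re 0 = 0)); apply: ler_sum => k _.
have -> : Re (dot ((adj y \o y) (xi k)) (eta k)) = ip (y (xi k)) (y (eta k)).
  by rewrite -[LHS]/(ip _ _) (adjoint_ip _ _ (adjoint_sym (star_adjP sA Ay))).
rewrite /= !fctE (bopD by_).
have := psd_sqrD (ip_form dot) (I : setT (y (xi k))) (I : setT (y (eta k))).
have := psd_sqrB (ip_form dot) (I : setT (y (xi k))) (I : setT (y (eta k))).
have := nsq_ge0 dot (y (xi k) - y (eta k)); have := nsq_ge0 dot (y (xi k)).
have := nsq_ge0 dot (y (xi k) + y (eta k)); have := nsq_ge0 dot (y (eta k)).
rewrite -!/(nsq _); lra.
Qed.

End State.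

(** * Cyclicity for the commutant *)

Section Normality.
Context {R : realType} {H : completeNormedModType R[i]}.
Variable dot : {dot H for Num.conj}.
Hypothesis hN : hilbert_norm dot.
Local Notation op := (H -> H).
Local Notation ip := (re_dot dot).
Local Notation nsq := (sqnorm dot).
Local Notation l2 := (l2 dot).
Local Notation l2ip := (l2ip dot).
Local Notation l2sq := (l2sq dot).
Local Notation adj := (adj dot).
Context {A : set op} {phi : op -> R[i]}.
Hypotheses (vA : von_neumann dot A) (hphi : faithful_normal_state dot A phi).
Local Notation gns := (gns_ip dot phi).
Local Notation fre := (re_state phi).
Context {u : nat -> H}.
Hypotheses (lu : l2 u) (hu : forall y, A y -> gns y y <= l2sq (y \o u)).
Implicit Types (x y z : op).

Let sA : star_algebra dot A := von_neumann_star hN vA.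

Let sA' : star_algebra dot (commutant A).
Proof. by have [Ab As _] := vA; exact: (commutant_star hN). Qed.

(** The linear span of A' u, where A' is the commutant of A. *)
Definition cyclic_span : set H := [set w | forall S : set H, S 0 ->
  (forall (a : R[i]) v w, S v -> S w -> S (a *: v + w)) ->
  (forall a k, commutant A a -> S (a (u k))) -> S w].

Lemma cyclic_span_lin (a : R[i]) v w :
  cyclic_span v -> cyclic_span w -> cyclic_span (a *: v + w).
Proof. by move=> hv hw S S0 Sl Su; exact: (Sl a v w (hv S S0 Sl Su) (hw S S0 Sl Su)). Qed.

Lemma cyclic_span_stable a v : commutant A a -> cyclic_span v -> cyclic_span (a v).
Proof.
move=> ca hv S S0 Sl Su; have ba := star_bounded sA' ca.
apply: (hv [set w | S (a w)]) => /=; first by rewrite (bop0 ba).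
  by move=> b w w'; rewrite (bopD ba) (bopZ ba); exact: Sl.
by move=> b k cb; apply: (Su (a \o b)); exact: (star_comp sA').
Qed.

(** The projection P onto the closed span of A' u commutes with A', so lies in A,
    and (1 - P) u = 0. Since u dominates the GNS norm, faithfulness gives P = 1. *)
Lemma cyclic_span_dense v : exists2 y, forall n, cyclic_span (y n) &
  null (fun n => nsq (y n - v)).
Proof.
pose F := ip_form dot; pose cF := nsq_complete hN.
have W0 : cyclic_span 0 by move=> S.
have WT : cyclic_span `<=` setT by [].
have iZ (a : R[i]) (h h' : H) : setT h -> setT h' -> ip (a *: h) h' = ip h (a^* *: h').
  by move=> _ _; exact: ip_adjZ.
have nZ (h : H) : setT h -> ip h h = 0 -> h = 0 by move=> _; exact: nsq_eq0.
pose pr := @orth_proj R H setT ip cyclic_span.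
have [P hP] : {P : op & forall t, pr t (P t)}.
  by apply: choice => t; exact: (orth_proj_ex F cF WT W0 cyclic_span_lin I).
have uniq t p p' : pr t p -> pr t p' -> p = p'.
  exact: (orth_proj_uniq F iZ WT W0 cyclic_span_lin nZ I).
have lP : linear P.
  move=> a t t'; apply: uniq (hP _) _.
  exact: (orth_proj_lin F iZ WT W0 cyclic_span_lin a I I (hP t) (hP t')).
have bP : bounded_op P.
  apply: (@nbound_bounded_op _ _ dot hN 1) => // t; rewrite mul1r.
  exact: (orth_proj_le F WT I (hP t)).
have AP : A P.
  have [_ _ <-] := vA; split=> // a ca; have ba := star_bounded sA' ca.
  have [C C0 aC] := bounded_op_nbound hN ba.
  apply/funext => t /=; apply: uniq (hP _) _.
  apply: (orth_proj_map F WT (S' := adj a) C0 _ _ _ _ _ _ I (hP t)) => //.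
  - by move=> w; exact: cyclic_span_stable.
  - by move=> w; apply: cyclic_span_stable; exact: (star_adj sA').
  - exact: (bopB ba).
  - by move=> h _; exact: aC.
  - by move=> h w _ _; apply: adjoint_ip; exact: (star_adjP sA').
have A1P : A (idfun - P) by exact: (star_sub sA (star_one sA)).
have P1 : idfun - P = 0.
  apply: (gns_faithful hN vA hphi) => //; apply/eqP.
  rewrite eq_le (psd_ge0 (gns_form hN vA hphi)) // andbT.
  apply: le_trans (hu A1P) _; apply: l2sq_le => n; rewrite big1 // => k _.
  rewrite /= !fctE.
  have -> : P (u k) = u k.
    apply: uniq (hP _) _; apply: (orth_proj_self F WT) => S _ _ Su.
    by have := Su idfun k; apply; exact: (star_one sA').
  by rewrite subrr nsq0.
have [_ [y Wy yv] _] := hP v; exists y => //.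
have <- : P v = v; last by [].
by have := congr1 (fun h : op => h v) P1; rewrite !fctE => /eqP; rewrite subr_eq0 => /eqP.
Qed.

Definition vec_form x y : R := l2ip (x \o u) (y \o u).

Let l2A x : A x -> l2 (x \o u).
Proof.
move=> Ax; have [C C0 xC] := bounded_op_nbound hN (star_bounded sA Ax).
exact: l2_comp xC lu.
Qed.

Lemma vec_form_psd : psd_form A vec_form.
Proof.
split=> [||a x y z Ax Ay Az|x y Ax Ay|x Ax]; rewrite /vec_form.
- exact: (star_lin sA).
- exact: (star_zero sA).
- by apply: (psd_linear (l2_form dot)); exact: l2A.
- by apply: (psd_sym (l2_form dot)); exact: l2A.
- by apply: (psd_ge0 (l2_form dot)); exact: l2A.
Qed.

Lemma nbound_sub (K : R) x y : nbound dot K x -> nbound dot K y ->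
  nbound dot (4 * K) (x - y).
Proof.
move=> xK yK v; have := psd_sqrD_le (ip_form dot) (I : setT (x v)) (I : setT (- y v)).
have -> : ip (- y v) (- y v) = nsq (y v).
  by rewrite (psdNl (ip_form dot)) ?(psdNr (ip_form dot)) ?opprK.
by rewrite !fctE -!/(nsq _); have := xK v; have := yK v; lra.
Qed.

(** The vectors on which x converges form a closed subspace invariant under A'; if
    it contains u, it is everything. *)
Lemma vec_cauchy_sot (K : R) (x : nat -> op) : 0 <= K -> (forall n, A (x n)) ->
  (forall n, nbound dot K (x n)) -> form_cauchy vec_form x ->
  exists l, [/\ A l, nbound dot K l & sot_cvg dot x l].
Proof.
move=> K0 Ax xK cx; have bx n := star_bounded sA (Ax n).
pose good v := form_cauchy ip (fun n => x n v).
have good0 : good 0.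
  by move=> e e0; exists 0%N => n m _ _; rewrite !(bop0 (bx _)) subrr (psd0l (ip_form dot)).
have goodl (a : R[i]) v w : good v -> good w -> good (a *: v + w).
  move=> gv gw e e0; set c := Re a ^+ 2 + Im a ^+ 2.
  have c0 : 0 <= c by rewrite addr_ge0 ?sqr_ge0.
  have k0 : 0 < 4 * (c + 1) by lra.
  have [M hM] := gv _ (divr_gt0 e0 k0); have [M' hM'] := gw _ (divr_gt0 e0 (ltr0n _ 4)).
  exists (maxn M M') => n m; rewrite !geq_max => /andP[Mn M'n] /andP[Mm M'm].
  rewrite !(bopD (bx _)) !(bopZ (bx _)) opprD addrACA -scalerBr.
  apply: le_lt_trans (nsqD_le dot _ _) _; rewrite nsqZ -/c.
  have := hM n m Mn Mm; have := hM' n m M'n M'm; rewrite /= -!/(nsq _).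
  rewrite !ltr_pdivlMr // => h1 h2; have := nsq_ge0 dot (x n v - x m v) => h3; lra.
have goodu a k : commutant A a -> good (a (u k)).
  move=> ca e e0; have [C C0 aC] := bounded_op_nbound hN (star_bounded sA' ca).
  have k0 : 0 < C + 1 by lra.
  have [M hM] := cx _ (divr_gt0 e0 k0); exists M => n m Mn Mm.
  have comm j : x j (a (u k)) = a (x j (u k)).
    by have [_ /(_ _ (Ax j))] := ca; move=> /(congr1 (fun h : op => h (u k))).
  rewrite !comm -(bopB (star_bounded sA' ca)); apply: le_lt_trans (aC _) _.
  have := hM n m Mn Mm; rewrite ltr_pdivlMr // /vec_form -/(l2sq _) => h.
  have := nsq_le_l2sq k (l2A (star_sub sA (Ax n) (Ax m))); rewrite /= !fctE => h2.
  have := nsq_ge0 dot (x n (u k) - x m (u k)) => h3; nra.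
have goodT v : good v.
  have [y Wy yv] := cyclic_span_dense v => e e0.
  have k0 : 0 < 24 * (K + 1) by lra.
  have [N _ /(_ N (leqnn N)) /= hNv] := yv _ (divr_gt0 e0 k0).
  have [M hM] := Wy N good good0 goodl goodu _ (divr_gt0 e0 (ltr0n _ 8)).
  exists M => n m Mn Mm; have := hM n m Mn Mm; rewrite -!/(nsq _) => h.
  have := nbound_sub (xK n) (xK m) (y N - v); rewrite !fctE.
  rewrite !(bopB (bx _)) => h1.
  have -> : x n v - x m v = x n (y N) - x m (y N) -
      (x n (y N) - x n v - (x m (y N) - x m v)).
    by rewrite !opprB addrA subrKA [RHS]addrC subrKA.
  have := psd_sqrD_le (ip_form dot) (I : setT (x n (y N) - x m (y N)))
    (I : setT (- (x n (y N) - x n v - (x m (y N) - x m v)))).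
  rewrite [X in _ + X *+ 2](psdNl (ip_form dot)) // (psdNr (ip_form dot)) // opprK.
  rewrite -!/(nsq _) => h2.
  move: hNv; rewrite ltr_pdivlMr // => hNv.
  have h3 := nsq_ge0 dot (y N - v); nra.
have ex v : exists l, null (fun n => nsq (x n v - l)).
  by have [l _ hl] := nsq_complete hN (fun=> I) (goodT v); exists l.
have [l xl] := choice ex.
exists l; split=> //; last exact: (sot_cvg_nbound xK xl).
exact: (von_neumann_sot hN vA Ax xK xl).
Qed.

End Normality.

(** * GNS norm and strong topology *)

Section StateTopology.
Context {R : realType} {H : completeNormedModType R[i]}.
Variable dot : {dot H for Num.conj}.
Hypothesis hN : hilbert_norm dot.
Local Notation op := (H -> H).
Local Notation ip := (re_dot dot).
Local Notation nsq := (sqnorm dot).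
Local Notation l2 := (l2 dot).
Local Notation l2ip := (l2ip dot).
Local Notation l2sq := (l2sq dot).
Local Notation adj := (adj dot).
Context {A : set op} {phi : op -> R[i]}.
Hypotheses (vA : von_neumann dot A) (hphi : faithful_normal_state dot A phi).
Local Notation gns := (gns_ip dot phi).
Local Notation fre := (re_state phi).
Implicit Types (x y z : op).

Let sA : star_algebra dot A := von_neumann_star hN vA.
Let gF : psd_form A gns := gns_form hN vA hphi.

Lemma sot_cvg_gns (K : R) (x : nat -> op) l : 0 <= K -> (forall n, A (x n)) ->
  (forall n, nbound dot K (x n)) -> A l -> sot_cvg dot x l ->
  null (fun n => gns (x n - l) (x n - l)).
Proof.
move=> K0 Ax xK Al xl; have [u lu hu] := normal_dominated hN vA hphi.
have Ad n : A (x n - l) by exact: (star_sub sA).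
have h0 : null (fun n => l2sq ((x n - l) \o u)).
  apply: (@null_l2sq_comp _ _ _ (4 * K)) => //; first by rewrite mulr_ge0.
  - by move=> n; exact: (star_bounded sA).
  - by move=> n; apply: nbound_sub => //; exact: sot_cvg_nbound xl.
  - by move=> v; apply: null_le (xl v) => n; rewrite !fctE subr0.
by apply: null_le h0 => n; exact: hu.
Qed.

Lemma gns_cvg_fre (x : nat -> op) l : (forall n, A (x n)) -> A l ->
  null (fun n => gns (x n - l) (x n - l)) -> null (fun n => `|fre (x n) - fre l|).
Proof.
move=> Ax Al xl; have A1 := star_one sA; have Ad n : A (x n - l) by exact: (star_sub sA).
apply: null_le (psd_null_sqr_cross gF Ad A1 xl) => n.
by rewrite (gns_one dot phi (Ad n)) // (freB hN vA hphi).
Qed.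

(** On bounded parts of A the GNS norm controls the strong topology. Otherwise
    there are y_n of small GNS norm with |y_n v| bounded below; suitable convex
    combinations of the y_n^* y_n converge strongly to a positive element l, with
    <l v, v> bounded below, on which the faithful state phi vanishes. *)
Lemma gns_small_strong (C : R) (v : H) (e : R) : 0 <= C -> 0 < e ->
  exists2 d : R, 0 < d & forall y, A y -> nbound dot C y -> gns y y < d ->
    nsq (y v) < e.
Proof.
move=> C0 e0; apply: contrapT => hne.
have bad n : exists y, [/\ A y, nbound dot C y, gns y y < n.+1%:R^-1 & e <= nsq (y v)].
  apply: contrapT => hn; apply: hne; exists n.+1%:R^-1; first by rewrite invr_gt0.
  move=> y Ay yC yn; rewrite ltNge; apply/negP => ye; apply: hn; by exists y.
have [y hy] := choice bad; have {bad hne} hyA n : A (y n) by have [] := hy n.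
pose z n := adj (y n) \o y n.
have Ay' n : A (adj (y n)) by exact: (star_adj sA).
have yy n := star_adjP sA (hyA n).
have zv n w w' : dot (z n w) w' = dot (y n w) (y n w').
  by rewrite -[z n w]/(adj (y n) (y n w)) (adjoint_sym (yy n)).
pose S n := [set z k | k in [set k | (n <= k)%N]].
pose P n x := [/\ A x, positive_op dot x, nbound dot (C * C) x,
  fre x <= n.+1%:R^-1 & e <= ip (x v) v].
have SP n x : hull (S n) x -> P n x.
  elim=> [_ [k /= nk <-]|a b _ [Aa pa aC fa ea] _ [Ab pb bC fb eb]].
    have [_ yC yn ye] := hy k; split.
    - exact: (star_comp sA).
    - by move=> w; rewrite zv; exact: dnorm_ge0.
    - by apply: nbound_comp => //; exact: (nbound_adjoint C0 yC (yy k)).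
    - apply: ltW; apply: lt_le_trans yn _.
      by rewrite lef_pV2 ?posrE ?ler_nat.
    - by rewrite /re_dot zv.
  split.
  - by apply: (star_scale sA); exact: (star_add sA).
  - exact: positive_mid.
  - exact: nbound_mid.
  - rewrite (freZ hN vA hphi); last exact: (star_add sA).
    rewrite (freD hphi Aa Ab).
    by move: fa fb; move: (n.+1%:R^-1) => q; lra.
  - by rewrite !fctE ipZl ipDl; lra.
(* The hulls are minimised for the norm of l2(H) on u, which controls strong limits. *)
have [u lu hu] := normal_dominated hN vA hphi.
have CC0 : 0 <= C * C by rewrite mulr_ge0.
have [|n|n|n|w [Sw cw _]] := @extraction _ _ _ _ (vec_form_psd hN vA lu)
    (fun n => hull (S n)) (C * C * l2sq u).
- by move=> n x /SP[].
- exists (z n); first by apply: hull_base; exists n => /=.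
  have [Az _ zC _ _] := SP n (z n) (hull_base (ex_intro2 _ _ n (leqnn n) erefl)).
  exact: l2sq_comp_le.
- by apply: hull_sub => _ [k /= nk <-]; exists k => //=; exact: ltnW.
- by move=> a b; exact: hull_mid.
have Pw n := SP n _ (Sw n).
have Aw n : A (w n) by have [] := Pw n.
have wC n : nbound dot (C * C) (w n) by have [] := Pw n.
have [l [Al lC wl]] := vec_cauchy_sot hN vA hphi lu hu CC0 Aw wC cw.
have pl : positive_op dot l by apply: sot_cvg_positive wl => n; have [] := Pw n.
have fl0 : fre l <= 0.
  apply: null_cst0; have h := gns_cvg_fre Aw Al (sot_cvg_gns CC0 Aw wC Al wl).
  apply: null_le (nullD h null_harmonic) => n; have [_ _ _ fw _] := Pw n.
  move: fw; have := lerNnormlW (lexx `|fre (w n) - fre l|).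
  by move: (n.+1%:R^-1) => a; lra.
(* l is a square s^2, and phi(l) is the squared GNS norm of s. *)
have [s [As ss sl]] := positive_sqrt hN vA Al pl.
have s0 : s = 0.
  apply: (gns_faithful hN vA hphi) => //; apply/eqP; rewrite eq_le (psd_ge0 gF) // andbT.
  by rewrite /gns_ip (adjE ss) sl.
suff : null (fun=> e) by move=> /null_cst0; lra.
apply: null_le (sot_cvg_ip v v wl) => n; have [_ _ _ _ ew] := Pw n.
have -> : l v = 0 by rewrite -sl s0.
by rewrite (psd0l (ip_form dot)) // subr0; apply: le_trans ew _; exact: ler_norm.
Qed.

Lemma gns_cauchy_sot (C : R) (x : nat -> op) : 0 <= C -> (forall n, A (x n)) ->
  (forall n, nbound dot C (x n)) -> form_cauchy gns x ->
  exists l, [/\ A l, nbound dot C l, sot_cvg dot x l &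
    null (fun n => gns (x n - l) (x n - l))].
Proof.
move=> C0 Ax xC cx.
have cv v : form_cauchy ip (fun n => x n v).
  move=> e e0; have C4 : 0 <= 4 * C by rewrite mulr_ge0.
  have [d d0 hd] := gns_small_strong v C4 e0.
  have [M hM] := cx d d0; exists M => n m Mn Mm.
  apply: (hd (x n - x m)); [exact: (star_sub sA)|exact: nbound_sub|exact: hM].
have ex v : exists l, null (fun n => nsq (x n v - l)).
  by have [l _ hl] := nsq_complete hN (fun=> I) (cv v); exists l.
have [l xl] := choice ex; have Al := von_neumann_sot hN vA Ax xC xl.
exists l; split=> //; first exact: (sot_cvg_nbound xC xl).
exact: (sot_cvg_gns C0 Ax xC Al xl).
Qed.

(** The bicommutant theorem in the amplification l2(H), for the vector u that
    dominates the GNS norm. The matrix entries of the projection onto the closure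
    of N u commute with N, hence with x; so x u stays in that closure. *)
Lemma bicommutant_gns (N : set op) x (e : R) : star_algebra dot N -> N `<=` A ->
  A x -> commutant (commutant N) x -> 0 < e ->
  exists2 y, N y & gns (x - y) (x - y) < e.
Proof.
move=> sN NA Ax cx e0; have [u lu hu] := normal_dominated hN vA hphi.
pose W : set (nat -> H) := [set y \o u | y in N].
have bN y : N y -> bounded_op y by exact: (star_bounded sN).
have compl2 y t : bounded_op y -> l2 t -> l2 (y \o t).
  by move=> by_ lt; have [C _ yC] := bounded_op_nbound hN by_; exact: l2_comp yC lt.
have WD : W `<=` l2 by move=> _ [y Ny <-]; apply: compl2 lu; exact: bN.
have W0 : W 0 by exists 0; first exact: (star_zero sN).
have Wlin (a : R[i]) t t' : W t -> W t' -> W (a *: t + t').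
  by move=> [y Ny <-] [y' Ny' <-]; exists (a *: y + y') => //; exact: (star_lin sN).
pose F := l2_form dot; pose cF := l2_complete hN.
have iZ (a : R[i]) (t t' : nat -> H) : l2 t -> l2 t' -> l2ip (a *: t) t' = l2ip t (a^* *: t').
  by move=> _ _; exact: l2ip_adjZ.
have nZ (t : nat -> H) : l2 t -> l2ip t t = 0 -> t = 0 by exact: l2sq_eq0.
pose pr := @orth_proj R (nat -> H) l2 l2ip W.
have [P hP] : {P : (nat -> H) -> (nat -> H) & forall t, l2 t -> pr t (P t)}.
  apply: (@choice _ _ (fun t p => l2 t -> pr t p)) => t.
  have [lt|nlt] := pselect (l2 t); last by exists 0.
  by have [p hp] := orth_proj_ex F cF WD W0 Wlin lt; exists p.
have uniq t p : l2 t -> pr t p -> P t = p.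
  by move=> lt hp; exact: (orth_proj_uniq F iZ WD W0 Wlin nZ lt (hP t lt) hp).
have lP t : l2 t -> l2 (P t) by move=> /hP[].
have Plin (a : R[i]) t t' : l2 t -> l2 t' -> P (a *: t + t') = a *: P t + P t'.
  move=> lt lt'; apply: uniq; first exact: (psd_closed F).
  exact: (orth_proj_lin F iZ WD W0 Wlin a lt lt' (hP t lt) (hP t' lt')).
have PD t t' : l2 t -> l2 t' -> P (t + t') = P t + P t'.
  by move=> lt lt'; rewrite -[t]scale1r Plin // !scale1r.
have PB t t' : l2 t -> l2 t' -> P (t - t') = P t - P t'.
  by move=> lt lt'; rewrite addrC -scaleN1r Plin // scaleN1r addrC.
have Ple t : l2 t -> l2sq (P t) <= l2sq t.
  by move=> lt; exact: (orth_proj_le F WD lt (hP t lt)).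
have PN y t : N y -> l2 t -> P (y \o t) = y \o P t.
  move=> Ny lt; apply: uniq; first exact: compl2 (bN _ Ny) lt.
  have [C C0 yC] := bounded_op_nbound hN (bN _ Ny).
  apply: (orth_proj_map F WD (S := fun t => y \o t) (S' := fun t => adj y \o t)
    C0 _ _ _ _ _ _ lt (hP t lt)).
  - by move=> s; exact: compl2 (bN _ Ny).
  - by move=> _ [y' Ny' <-]; exists (y \o y') => //; exact: (star_comp sN).
  - move=> _ [y' Ny' <-]; exists (adj y \o y') => //.
    by apply: (star_comp sN) => //; exact: (star_adj sN).
  - by move=> s s'; apply/funext => k; rewrite /= !fctE (bopB (bN _ Ny)).
  - by move=> s; exact: l2sq_comp_le.
  - by move=> s s' _ _; apply: l2ip_adjoint; exact: (star_adjP sN).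
pose entry i j : op := fun v => P (single j v) i.
have l2s j v : l2 (single j v) by exact: l2_single.
have centry i j : commutant N (entry i j).
  split.
    apply: (@nbound_bounded_op _ _ dot hN 1).
      by move=> a v w; rewrite /entry single_lin Plin.
    move=> v; rewrite mul1r; apply: le_trans (nsq_le_l2sq i (lP _ (l2s j v))) _.
    by apply: le_trans (Ple _ (l2s j v)) _; exact: l2sq_single_le.
  move=> y Ny; apply/funext => v; rewrite /entry /=.
  have -> : single j (y v) = y \o single j v.
    by apply/funext => k; rewrite /single /=; case: ifP => // _; rewrite (bop0 (bN _ Ny)).
  by rewrite PN.
have bx := star_bounded sA Ax.
(* x commutes with the entries of P, which lie in the commutant of N. *)
have Px j v : P (x \o single j v) = x \o P (single j v).
  have -> : x \o single j v = single j (x v).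
    by apply/funext => k; rewrite /single /=; case: ifP => // _; rewrite (bop0 bx).
  apply/funext => i; have [_ /(_ _ (centry i j))] := cx.
  by move=> /(congr1 (fun h : op => h v)).
have Pt n : P (x \o initseg n u) = x \o P (initseg n u).
  elim: n => [|n IH].
    rewrite initseg0; have -> : x \o (0 : nat -> H) = 0 by apply/funext => k; exact: (bop0 bx).
    have P0 : P 0 = 0 by apply: uniq; [exact: l2_mem0|exact: (orth_proj_self F WD)].
    by rewrite P0; apply/funext => k; rewrite [RHS](bop0 bx).
  have xD (t t' : nat -> H) : x \o (t + t') = (x \o t) + (x \o t').
    by apply/funext => k; rewrite /= !fctE (bopD bx).
  have lt := l2_initseg dot n u.
  rewrite initsegS xD PD ?IH ?Px ?PD ?xD //; exact: compl2.
have Pu : P u = u.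
  apply: uniq => //; apply: (orth_proj_self F WD).
  by exists idfun => //; exact: (star_one sN).
have [C C0 xC] := bounded_op_nbound hN bx.
have lxu := compl2 _ _ bx lu.
have xB (t t' : nat -> H) : x \o (t - t') = (x \o t) - (x \o t').
  by apply/funext => k; rewrite /= !fctE (bopB bx).
(* As P and x are bounded, commutation passes from finite sequences to u, which P fixes. *)
have Pxu : P (x \o u) = x \o u.
  apply/eqP; rewrite -subr_eq0; apply/eqP.
  have lPxu := psd_memB F (lP _ lxu) lxu.
  apply: (l2sq_eq0 lPxu); apply: (null_cst_eq0 (psd_ge0 F lPxu)).
  apply: null_le (nullZ (ler0n _ 4) (nullZ C0 (initseg_cvg lu))) => n.
  have lt := l2_initseg dot n u; have lxt := compl2 _ _ bx lt.
  have ld := psd_memB F lu lt; have lxd := compl2 _ _ bx ld.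
  have -> : P (x \o u) - (x \o u) = P (x \o (u - initseg n u)) - (x \o P (u - initseg n u)).
    by rewrite (PB _ _ lu lt) !xB (PB _ _ lxu lxt) Pt Pu opprB addrA subrK.
  have lxPd := compl2 _ _ bx (lP _ ld).
  apply: le_trans (psd_sqrD_le F (lP _ lxd) (psd_memN F lxPd)) _.
  rewrite (psdNl F lxPd (psd_memN F lxPd)) (psdNr F lxPd lxPd) opprK.
  have := Ple _ lxd; have := l2sq_comp_le C0 xC ld.
  have := l2sq_comp_le C0 xC (lP _ ld); have := ler_wpM2l C0 (Ple _ ld).
  by rewrite -!/(l2sq _); lra.
have [_ [t Wt tx] _] := hP _ lxu; rewrite Pxu in tx.
have [n _ /(_ n (leqnn n)) /= hn] := tx e e0.
have [y Ny ytn] := Wt n; exists y => //.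
have Ay := NA _ Ny; apply: le_lt_trans (hu _ (star_sub sA Ax Ay)) _.
move: hn; rewrite -ytn (psd_sqrBC F) //; last exact: compl2 (bN _ Ny) lu.
Qed.

End StateTopology.

(** * Conditional expectations and commuting squares *)

Section Expectations.
Context {R : realType} {H : completeNormedModType R[i]}.
Variable dot : {dot H for Num.conj}.
Hypothesis hN : hilbert_norm dot.
Local Notation op := (H -> H).
Local Notation nsq := (sqnorm dot).
Local Notation l2 := (l2 dot).
Local Notation l2sq := (l2sq dot).
Local Notation adj := (adj dot).
Variables (A : set op) (phi : op -> R[i]).
Hypotheses (vA : von_neumann dot A) (hphi : faithful_normal_state dot A phi).
Local Notation gns := (gns_ip dot phi).
Local Notation fre := (re_state phi).
Implicit Types (x y z a b c : op) (N : set op).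

Let sA : star_algebra dot A := von_neumann_star hN vA.
Let gF : psd_form A gns := gns_form hN vA hphi.

(** The conditional expectation of x onto N, characterised by its two-sided matrix
    coefficients against N; two-sidedness yields the bimodule property. *)
Definition is_proj N x z := N z /\
  forall a c, N a -> N c -> fre (a \o x \o c) = fre (a \o z \o c).

Record projectable N : Prop := Projectable {
  projectable_star : star_algebra dot N;
  projectable_sub : N `<=` A;
  projectable_ex : forall x, A x -> exists2 z, is_proj N x z &
    (positive_op dot x -> positive_op dot z) }.

Lemma sandwich_mem x a c : A a -> A x -> A c -> A (a \o x \o c).
Proof. by move=> Aa Ax Ac; apply: (star_comp sA) => //; exact: (star_comp sA). Qed.

Lemma sandwich_lin (k : R[i]) x y a c : A a ->
  a \o (k *: x + y) \o c = k *: (a \o x \o c) + (a \o y \o c).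
Proof.
move=> Aa; have ba := star_bounded sA Aa.
by rewrite (compDr _ _ ba) (compZr _ _ ba).
Qed.

Lemma sandwich_sub x y a c : A a ->
  a \o (x - y) \o c = (a \o x \o c) - (a \o y \o c).
Proof. by move=> Aa; rewrite (compBr _ _ (star_bounded sA Aa)). Qed.

Lemma fre_lin (k : R[i]) x y : A x -> A y ->
  fre (k *: x + y) = Re k * fre x + Im k * fre ('i%C *: x) + fre y.
Proof.
move=> Ax Ay; rewrite /re_state (phi_lin hphi) // (phiZ hN vA hphi) //.
by case: k (phi x) (phi y) => [p q] [r s] [t v] /=; ring.
Qed.

Section OneAlgebra.
Context {N : set op}.
Hypotheses (sN : star_algebra dot N) (NA : N `<=` A).

Lemma is_proj_uniq x z z' : A x -> is_proj N x z -> is_proj N x z' -> z = z'.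
Proof.
move=> Ax [Nz hz] [Nz' hz']; apply/eqP; rewrite -subr_eq0; apply/eqP.
have Nd := star_sub sN Nz Nz'; have Ad := NA Nd; have Nd' := star_adj sN Nd.
apply: (gns_faithful hN vA hphi) => //; have N1 := star_one sN.
have := hz _ _ Nd' N1; rewrite (hz' _ _ Nd' N1) => /eqP.
rewrite eq_sym -subr_eq0 -(freB hN vA hphi); last 2 first.
- by apply: sandwich_mem; exact: NA.
- by apply: sandwich_mem; exact: NA.
by rewrite -(sandwich_sub _ _ _ (NA Nd')) => /eqP.
Qed.

Lemma is_proj_lin (k : R[i]) x y z z' : A x -> A y ->
  is_proj N x z -> is_proj N y z' -> is_proj N (k *: x + y) (k *: z + z').
Proof.
move=> Ax Ay [Nz hz] [Nz' hz']; split; first exact: (star_lin sN).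
move=> a c Na Nc; have Aa := NA Na; have Ac := NA Nc.
have Az := NA Nz; have Az' := NA Nz'.
rewrite !sandwich_lin // !fre_lin; try exact: sandwich_mem.
rewrite hz // hz' //; congr (_ + _ * _ + _).
have e x' : 'i%C *: (a \o x' \o c) = ('i%C *: a) \o x' \o c by [].
by rewrite !e hz //; exact: (star_scale sN).
Qed.

Lemma is_proj_bimodule x z b c : is_proj N x z -> N b -> N c ->
  is_proj N (b \o x \o c) (b \o z \o c).
Proof.
move=> [Nz hz] Nb Nc; split; first by do 2!apply: (star_comp sN) => //.
move=> a d Na Nd.
rewrite -[LHS]/(fre ((a \o b) \o x \o (c \o d))).
rewrite -[RHS]/(fre ((a \o b) \o z \o (c \o d))).
by apply: hz; exact: (star_comp sN).
Qed.

Lemma is_proj_sub N' y z : N' `<=` N -> N' z -> is_proj N y z -> is_proj N' y z.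
Proof. by move=> NN Nz [_ hz]; split=> // a c /NN Na /NN Nc; exact: hz. Qed.

Lemma is_proj_id x : N x -> is_proj N x x.
Proof. by []. Qed.

(** The coefficients against 1 and against -i give both parts of phi. *)
Lemma is_proj_phi x z : A x -> is_proj N x z -> phi z = phi x.
Proof.
move=> Ax [Nz hz]; have N1 := star_one sN; have Az := NA Nz.
apply: eq_ReIm; first exact: (esym (hz _ _ N1 N1)).
have Ni : N (- 'i%C *: idfun) by exact: (star_scale sN).
have := hz _ _ Ni N1; rewrite -[_ \o x \o _]/(- 'i%C *: x).
rewrite -[_ \o z \o _]/(- 'i%C *: z) /re_state.
by rewrite !(phiZ hN vA hphi) // !ReNi.
Qed.

Lemma is_proj_gns_le x y z : A x -> N y -> is_proj N x z ->
  gns (x - z) (x - z) <= gns (x - y) (x - y).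
Proof.
move=> Ax Ny [Nz hz]; have Az := NA Nz; have Ay := NA Ny.
have Nd := star_sub sN Nz Ny; have Ad := NA Nd; have Axz := star_sub sA Ax Az.
have ort : gns (x - z) (z - y) = 0.
  have Nd' := star_adj sN Nd; have Ad' := NA Nd'.
  rewrite /gns_ip (compBr _ _ (star_bounded sA Ad')) (freB hN vA hphi); last 2 first.
  - exact: (star_comp sA).
  - exact: (star_comp sA).
  have := hz _ _ Nd' (star_one sN).
  by rewrite -[_ \o x \o _]/(_ \o x) -[_ \o z \o _]/(_ \o z) => ->; rewrite subrr.
have := psd_sqrD gF Axz Ad; rewrite subrKA ort mul0rn addr0 => ->.
by rewrite lerDl (psd_ge0 gF).
Qed.

Lemma cond_exp_is_proj E x : conditional_expectation dot A phi N E -> A x ->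
  is_proj N x (E x).
Proof.
move=> [[h1 _] _ _ h4 h5] Ax; split; first exact: h1.
move=> a c Na Nc; rewrite -h4 // /re_state h5 //.
by apply: sandwich_mem => //; exact: NA.
Qed.

End OneAlgebra.

(** N is GNS-dense in its bicommutant, while z is the point of N closest to x. *)
Lemma projectable_von_neumann N : projectable N -> von_neumann dot N.
Proof.
move=> [sN NA ex]; have [Ab _ AA] := vA; split.
- exact: (star_bounded sN).
- exact: (star_star sN).
apply/seteqP; split=> [x cx|]; last exact/sub_bicommutant/(star_bounded sN).
have Ax : A x by rewrite -AA; exact: commutant_anti (commutant_anti NA) _ cx.
have [z pz _] := ex x Ax; have [Nz _] := pz.
have Axz := star_sub sA Ax (NA _ Nz).
suff : x - z = 0 by move=> /eqP; rewrite subr_eq0 => /eqP ->.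
apply: (gns_faithful hN vA hphi) => //; apply/eqP.
rewrite eq_le (psd_ge0 gF) // andbT leNgt; apply/negP => e0.
have [y Ny] := bicommutant_gns hN vA hphi sN NA Ax cx e0.
by rewrite ltNge (is_proj_gns_le sN NA Ax Ny pz).
Qed.

Lemma projectable_conditioned N : projectable N -> conditioned dot A phi N.
Proof.
move=> pN; have [sN NA ex] := pN.
split; [exact: projectable_von_neumann|exact: NA|].
have exf x : exists z, A x -> is_proj N x z /\ (positive_op dot x -> positive_op dot z).
  have [Ax|nAx] := pselect (A x); last by exists 0.
  by have [z h1 h2] := ex x Ax; exists z.
have [E hE] := choice exf.
have uniq x z : A x -> is_proj N x z -> E x = z.
  by move=> Ax; apply: (is_proj_uniq sN NA Ax); exact: (hE x Ax).1.
exists E; split.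
- split=> [x Ax|b Nb]; first exact: (hE x Ax).1.1.
  by apply: uniq; [exact: NA|exact: is_proj_id].
- move=> k x y Ax Ay; apply: uniq; first exact: (star_lin sA).
  by apply: (is_proj_lin sN NA) => //; [exact: (hE x Ax).1|exact: (hE y Ay).1].
- by move=> x Ax; exact: (hE x Ax).2.
- move=> b x c Nb Ax Nc; apply: uniq; first by apply: sandwich_mem => //; exact: NA.
  by apply: (is_proj_bimodule sN) => //; exact: (hE x Ax).1.
- by move=> x Ax; apply: (is_proj_phi sN NA Ax); exact: (hE x Ax).1.
Qed.

(** If E1 carries N2 into N, then E1 E2 x lies in N and has the same coefficients
    against N as x, so it is E x. *)
Lemma commuting_square_of_proj N2 P N N1 :
  projectable N2 -> projectable P -> projectable N -> projectable N1 ->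
  N2 `<=` P -> N `<=` N1 -> N `<=` N2 -> N1 `<=` P ->
  (forall y, N2 y -> exists2 z, N z & is_proj N1 y z) ->
  commuting_square dot A phi N2 P N N1.
Proof.
move=> p2 pP pN p1 N2P NN1 NN2 N1P key.
split; [split; exact: projectable_conditioned | by split |].
move=> E1 E2 E c1 c2 c x Ax.
have [s2 N2A _] := p2; have [s1 N1A _] := p1; have [sN NA _] := pN.
have [N2E h2] := cond_exp_is_proj N2A c2 Ax.
have A2 := N2A _ N2E.
have [z Nz pz] := key _ N2E.
have -> : E1 (E2 x) = z.
  by apply: (is_proj_uniq s1 N1A A2) pz; exact: (cond_exp_is_proj N1A c1).
apply: (is_proj_uniq sN NA Ax); last exact: (cond_exp_is_proj NA c).
split=> // a b Na Nb; rewrite h2; [|exact: NN2|exact: NN2].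
by have [_ ->] := pz; [|exact: NN1|exact: NN1].
Qed.

Record state_endo (g : op -> op) : Prop := StateEndo {
  state_endo_star : star_endo dot A g;
  state_endo_phi : forall x, A x -> phi (g x) = phi x }.

(** Unitality comes from surjectivity: g(1) is a unit for the range of g. *)
Lemma automorphism_state_endo g : automorphism dot A phi g -> state_endo g.
Proof.
move=> [[gA _ gsurj] gl gm ga gp]; split=> //; split=> //.
have A1 := star_one sA; have [y Ay gy] := gsurj _ A1.
have e : g y = g idfun \o g y := gm _ _ A1 Ay.
by rewrite gy in e; exact: (esym e).
Qed.

Lemma state_endo_fre g x : state_endo g -> A x -> fre (g x) = fre x.
Proof. by move=> [_ gp] Ax; rewrite /re_state gp. Qed.

Lemma state_endo_sandwich g x a c : state_endo g -> A a -> A x -> A c ->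
  fre (g a \o g x \o g c) = fre (a \o x \o c).
Proof.
move=> hg Aa Ax Ac; have [[_ _ gm _ _] _] := hg.
rewrite -gm // -gm //; last exact: (star_comp sA).
exact/state_endo_fre/sandwich_mem.
Qed.

Lemma state_endo_gns g x y : state_endo g -> A x -> A y -> gns (g x) (g y) = gns x y.
Proof.
move=> hg Ax Ay; have hs := state_endo_star hg; have [_ _ gm _ _] := hs.
have Ay' := star_adj sA Ay.
rewrite /gns_ip (endo_adj hN vA hs Ay) -gm //.
by apply: state_endo_fre => //; exact: (star_comp sA).
Qed.

Lemma sandwich_cvg (K : R) (x y z : nat -> op) l m k : 0 <= K ->
  (forall n, A (x n)) -> (forall n, nbound dot K (x n)) ->
  (forall n, A (y n)) -> (forall n, nbound dot K (y n)) ->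
  (forall n, A (z n)) -> (forall n, nbound dot K (z n)) ->
  sot_cvg dot x l -> sot_cvg dot y m -> sot_cvg dot z k ->
  null (fun n => `|fre (x n \o y n \o z n) - fre (l \o m \o k)|).
Proof.
move=> K0 Ax xK Ay yK Az zK xl ym zk.
have Al := von_neumann_sot hN vA Ax xK xl.
have Am := von_neumann_sot hN vA Ay yK ym.
have Ak := von_neumann_sot hN vA Az zK zk.
have bx n := star_bounded sA (Ax n).
have KK : 0 <= K * K by rewrite mulr_ge0.
have xyK n : nbound dot (K * K) (x n \o y n) by exact: nbound_comp.
have Axy n : A (x n \o y n) by exact: (star_comp sA).
have h1 := sot_cvg_comp K0 bx xK xl ym.
have h2 := sot_cvg_comp KK (fun n => star_bounded sA (Axy n)) xyK h1 zk.
have Axyz n : A (x n \o y n \o z n) by exact: sandwich_mem.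
have Almk : A (l \o m \o k) by exact: sandwich_mem.
have KKK : 0 <= K * K * K by rewrite mulr_ge0.
apply: (gns_cvg_fre hN vA hphi Axyz Almk).
apply: (sot_cvg_gns hN vA hphi KKK) => // n.
exact: nbound_comp.
Qed.

(** [extraction] for the GNS norm, followed by strong convergence of bounded
    GNS-Cauchy sequences. *)
Lemma hull_limit (C : R) (S : nat -> set op) : 0 <= C ->
  (forall n, S n `<=` A) -> (forall n, S n !=set0) -> (forall n, S n.+1 `<=` S n) ->
  (forall n x, S n x -> nbound dot C x) ->
  exists w l, [/\ forall n, hull (S n) (w n), A l, nbound dot C l,
    sot_cvg dot w l /\ null (fun n => gns (w n - l) (w n - l)) &
    forall n x, hull (S n) x -> gns (w n) (w n) <= gns x x + n.+1%:R^-1].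
Proof.
move=> C0 SA Sne Sdec SC; have [u lu hu] := normal_dominated hN vA hphi.
have hA n x : hull (S n) x -> A x.
  elim=> [y /SA //|y z _ Ay _ Az]; apply: (star_scale sA); exact: (star_add sA).
have hC n x : hull (S n) x -> nbound dot C x.
  elim=> [y /SC //|y z _ yC _ zC]; exact: nbound_mid.
have [|n|n|n|w [Sw cw wmin]] := @extraction _ _ _ _ gF (fun n => hull (S n)) (C * l2sq u).
- by move=> n x; exact: hA.
- have [x Sx] := Sne n; exists x; first exact: hull_base.
  by apply: le_trans (hu _ (SA _ _ Sx)) _; apply: l2sq_comp_le => //; exact: SC Sx.
- exact: hull_sub.
- by move=> a b; exact: hull_mid.
have [l [Al lC wl gl]] := gns_cauchy_sot hN vA hphi C0
  (fun n => hA n _ (Sw n)) (fun n => hC n _ (Sw n)) cw.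
by exists w, l; split.
Qed.

End Expectations.

(** * Fixed points and limits of automorphisms *)

Section Limits.
Context {R : realType} {H : completeNormedModType R[i]}.
Variable dot : {dot H for Num.conj}.
Hypothesis hN : hilbert_norm dot.
Local Notation op := (H -> H).
Local Notation nsq := (sqnorm dot).
Local Notation adj := (adj dot).
Variables (A : set op) (phi : op -> R[i]).
Hypotheses (vA : von_neumann dot A) (hphi : faithful_normal_state dot A phi).
Local Notation gns := (gns_ip dot phi).
Local Notation fre := (re_state phi).
Local Notation endo := (state_endo dot A phi).
Implicit Types (x y z a b c : op) (N : set op).

Let sA : star_algebra dot A := von_neumann_star hN vA.
Let gF : psd_form A gns := gns_form hN vA hphi.

Lemma endo_mid (g : op -> op) x y : endo g -> A x -> A y ->
  g (2^-1%:C *: (x + y)) = 2^-1%:C *: (g x + g y).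
Proof.
move=> [hs _] Ax Ay; rewrite (endo_scale hN vA hs); last exact: (star_add sA).
by rewrite (endo_add hs).
Qed.

Lemma common_nbound a c (C : R) : A a -> A c -> 0 <= C ->
  exists2 K : R, 0 <= K & [/\ nbound dot K a, nbound dot K c & C <= K].
Proof.
move=> Aa Ac C0.
have [Ca Ca0 aC] := bounded_op_nbound hN (star_bounded sA Aa).
have [Cc Cc0 cC] := bounded_op_nbound hN (star_bounded sA Ac).
exists (Ca + Cc + C); first lra.
by split; [apply: nbound_le aC; lra|apply: nbound_le cC; lra|lra].
Qed.

Lemma hull_mem (S : set op) : S `<=` A -> hull S `<=` A.
Proof.
move=> SA x; elim=> [y /SA //|y z _ Ay _ Az].
by apply: (star_scale sA); exact: (star_add sA).
Qed.

Lemma hull_fre (S : set op) a c (k e : R) : S `<=` A -> A a -> A c ->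
  (forall x, S x -> `|fre (a \o x \o c) - k| <= e) ->
  forall x, hull S x -> `|fre (a \o x \o c) - k| <= e.
Proof.
move=> SA Aa Ac hS x; elim=> [y /hS //|y z hy IHy hz IHz].
have Ay := hull_mem SA hy; have Az := hull_mem SA hz.
have -> : a \o (2^-1%:C *: (y + z)) \o c = 2^-1%:C *: ((a \o y \o c) + (a \o z \o c)).
  have ba := star_bounded sA Aa.
  by rewrite (compZr _ _ ba) (compDr _ _ ba).
rewrite (freZ hN vA hphi); last by apply: (star_add sA); exact: (sandwich_mem hN vA).
rewrite (freD hphi); try exact: (sandwich_mem hN vA).
move: IHy IHz; rewrite !ler_norml => /andP[h1 h2] /andP[h3 h4].
by apply/andP; split; lra.
Qed.

(** Alaoglu-Birkhoff: g permutes the hull of an orbit and preserves the GNS norm,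
    so it fixes the unique limit of near-minimal points; and every point of the
    hull has the coefficients of x against the fixed algebra. *)
Lemma fixed_projectable (G : set (op -> op)) : G !=set0 ->
  (forall g, G g -> endo g) ->
  (forall g h, G g -> G h -> exists2 k, G k & forall x, A x -> k x = g (h x)) ->
  projectable dot A phi [set x | A x /\ forall g, G g -> g x = x].
Proof.
move=> [g0 Gg0] Ge Gc; set N := [set x | _].
have NA : N `<=` A by move=> x [].
have sN : star_algebra dot N.
  split.
  - by move=> x [/(star_bounded sA)].
  - by split=> [|g /Ge[[_ _ _ _ ->]]]; first exact: (star_one sA).
  - move=> k x y [Ax hx] [Ay hy]; split; first exact: (star_lin sA).
    by move=> g Gg; have [[_ gl _ _ _] _] := Ge g Gg; rewrite gl // hx // hy.
  - move=> x y [Ax hx] [Ay hy]; split; first exact: (star_comp sA).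
    by move=> g Gg; have [[_ _ gm _ _] _] := Ge g Gg; rewrite gm // hx // hy.
  - move=> x [Ax hx]; exists (adj x); last exact: (star_adjP sA).
    split; first exact: (star_adj sA).
    by move=> g Gg; have [hs _] := Ge g Gg; rewrite -(endo_adj hN vA hs) // hx.
split=> // x Ax.
have [C C0 xC] := bounded_op_nbound hN (star_bounded sA Ax).
pose S := [set g x | g in G].
have SA : S `<=` A by move=> _ [g Gg <-]; have [[gA _ _ _ _] _] := Ge g Gg; exact: gA.
have SC y : S y -> nbound dot C y.
  by move=> [g Gg <-]; have [hs _] := Ge g Gg; exact: (endo_nbound hN vA hs).
have Sne : S !=set0 by exists (g0 x); exists g0.
have [w [l [Sw Al lC [wl gl] wmin]]] :=
  hull_limit hN vA hphi C0 (fun=> SA) (fun=> Sne) (fun n y h => h) (fun=> SC).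
have Aw n : A (w n) by exact: hull_mem SA _ (Sw n).
have Sg g y : G g -> hull S y -> hull S (g y).
  move=> Gg; elim=> [_ [h Gh <-]|y' z hy IHy hz IHz].
    have [k Gk kx] := Gc g h Gg Gh; apply: hull_base; exists k => //; exact: kx.
  rewrite endo_mid; [exact: hull_mid|exact: Ge|exact: hull_mem hy|exact: hull_mem hz].
have fixl g : G g -> g l = l.
  move=> Gg; have eg := Ge g Gg; have [hs _] := eg; have [gA _ _ _ _] := hs.
  have Agl := gA _ Al; have Agw n := gA _ (Aw n).
  have Ad := star_sub sA Agl Al.
  apply/eqP; rewrite -subr_eq0; apply/eqP/(gns_faithful hN vA hphi Ad).
  apply: (null_cst_eq0 (psd_ge0 gF Ad)).
  apply: null_le (nullD (nullZ (ler0n _ 6) gl) (nullZ (ler0n _ 16) null_harmonic)) => n.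
  have D1 := star_sub sA Al (Aw n); have D2 := star_sub sA (Agw n) (Aw n).
  have D3 := star_sub sA (Aw n) Al; have gD1 := gA _ D1.
  have -> : g l - l = g (l - w n) + ((g (w n) - w n) + (w n - l)).
    by rewrite (endo_sub hN vA hs) // subrKA subrKA.
  have := psd_sqrD_le gF gD1 (star_add sA D2 D3).
  have := psd_sqrD_le gF D2 D3.
  rewrite (state_endo_gns hN vA eg D1 D1) (psd_sqrBC gF Al (Aw n)).
  (* g (w n) and w n are both near-minimal, so by the parallelogram identity with
     their midpoint they are close. *)
  have := wmin n _ (hull_mid (Sg g _ Gg (Sw n)) (Sw n)).
  rewrite (psd_sqrZ gF); last exact: (star_add sA).
  rewrite (psd_sqrD gF (Agw n) (Aw n)) (psd_sqrB gF (Agw n) (Aw n)).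
  rewrite (state_endo_gns hN vA eg (Aw n) (Aw n)).
  have -> : 2^-1 ^+ 2 = 4^-1 :> R by field.
  have := psd_ge0 gF D3.
  by move: (n.+1%:R^-1) => r; lra.
have Nl : N l by split.
exists l; last first.
  move=> px; apply: sot_cvg_positive wl => n.
  elim: (Sw n) => [_ [g Gg <-]|y z _ py _ pz]; last exact: positive_mid.
  by have [hs _] := Ge g Gg; exact: (endo_positive hN vA hs).
split=> // a c Na Nc; have Aa := NA _ Na; have Ac := NA _ Nc.
have hw n : fre (a \o w n \o c) = fre (a \o x \o c).
  apply/eqP; rewrite -subr_eq0 -normr_le0; apply: (hull_fre SA Aa Ac) (Sw n).
  move=> _ [g Gg <-]; rewrite normr_le0 subr_eq0; apply/eqP.
  have := state_endo_sandwich hN vA (Ge g Gg) Aa Ax Ac.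
  by have [_ ->] := Na => //; have [_ ->] := Nc.
have [K K0 [aK cK CK]] := common_nbound Aa Ac C0.
have wK n : nbound dot K (w n).
  apply: nbound_le CK _; elim: (Sw n) => [y /SC //|y z _ hy _ hz]; exact: nbound_mid.
have := sandwich_cvg hN vA hphi K0 (fun=> Aa) (fun=> aK) Aw wK (fun=> Ac) (fun=> cK)
  (@sot_cvg_cst _ _ dot a) wl (@sot_cvg_cst _ _ dot c).
have -> : (fun n => `|fre (a \o w n \o c) - fre (a \o l \o c)|) =
    (fun=> `|fre (a \o x \o c) - fre (a \o l \o c)|) by apply/funext => n; rewrite hw.
by move=> /null_cst0; rewrite normr_le0 subr_eq0 => /eqP.
Qed.

Section EndoLimit.
Context {beta beta' : nat -> op -> op} {alpha : op -> op}.
Hypotheses (eb : forall n, endo (beta n)) (eb' : forall n, endo (beta' n)).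
Hypothesis bK : forall n x, A x -> beta n (beta' n x) = x.
Hypothesis ba : forall x, A x -> sot_cvg dot (beta^~ x) (alpha x).

Let bA n x : A x -> A (beta n x).
Proof. by move=> Ax; have [[gA _ _ _ _] _] := eb n; exact: gA. Qed.

Let bC (C : R) n x : A x -> nbound dot C x -> nbound dot C (beta n x).
Proof. by move=> Ax xC; have [hs _] := eb n; exact: (endo_nbound hN vA hs). Qed.

Lemma limit_mem x : A x -> A (alpha x).
Proof.
move=> Ax; have [C C0 xC] := bounded_op_nbound hN (star_bounded sA Ax).
exact: (von_neumann_sot hN vA (fun n => bA n Ax) (fun n => bC n Ax xC) (ba Ax)).
Qed.

Lemma limit_state_endo : endo alpha.
Proof.
have lb x : A x -> forall n, linear (beta n x).
  by move=> Ax n; exact: (star_bounded sA (bA n Ax)).1.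
split; first split.
- exact: limit_mem.
- move=> k x y Ax Ay; apply: (@sot_cvg_uniq _ _ dot (beta^~ (k *: x + y))).
    by apply: ba; exact: (star_lin sA).
  set c := Re k ^+ 2 + Im k ^+ 2; have c0 : 0 <= c by rewrite addr_ge0 ?sqr_ge0.
  move=> v; apply: null_le (nullD (nullZ (ler0n _ 2) (nullZ c0 (ba Ax v)))
    (nullZ (ler0n _ 2) (ba Ay v))) => n.
  have [[_ bl _ _ _] _] := eb n; rewrite bl // !fctE.
  have -> : k *: beta n x v + beta n y v - (k *: alpha x v + alpha y v) =
      k *: (beta n x v - alpha x v) + (beta n y v - alpha y v).
    by rewrite scalerBr opprD addrACA.
  by have := nsqD_le dot (k *: (beta n x v - alpha x v)) (beta n y v - alpha y v);
    rewrite nsqZ -/c; lra.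
- move=> x y Ax Ay; apply: (@sot_cvg_uniq _ _ dot (beta^~ (x \o y))).
    by apply: ba; exact: (star_comp sA).
  have [C C0 xC] := bounded_op_nbound hN (star_bounded sA Ax).
  have h := sot_cvg_comp C0 (fun n => star_bounded sA (bA n Ax))
    (fun n => bC n Ax xC) (ba Ax) (ba Ay).
  by move=> v; apply: null_le (h v) => n; have [[_ _ bm _ _] _] := eb n; rewrite bm.
- move=> x y Ax Ay xy.
  apply: (sot_cvg_adjoint (star_bounded sA (limit_mem Ax)).1 _ (ba Ax) (ba Ay)) => n.
  by have [[_ _ _ h _] _] := eb n; exact: h.
- have A1 := star_one sA; apply: (@sot_cvg_uniq _ _ dot (beta^~ idfun)) (ba A1) _ => v.
  by apply: null_le (@sot_cvg_cst _ _ dot idfun v) => n; have [[_ _ _ _ ->] _] := eb n.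
move=> x Ax; have A1 := star_one sA; have aA := limit_mem Ax.
have key y : A y -> fre (alpha y) = fre y.
  move=> Ay; have aAy := limit_mem Ay.
  have [C C0 yC] := bounded_op_nbound hN (star_bounded sA Ay).
  have := gns_cvg_fre hN vA hphi (fun n => bA n Ay) aAy
    (sot_cvg_gns hN vA hphi C0 (fun n => bA n Ay) (fun n => bC n Ay yC) aAy (ba Ay)).
  have -> : (fun n => `|fre (beta n y) - fre (alpha y)|) = (fun=> `|fre y - fre (alpha y)|).
    by apply/funext => n; rewrite (state_endo_fre (eb n)).
  by move=> /null_cst0; rewrite normr_le0 subr_eq0 => /eqP.
apply: eq_ReIm; first exact: key.
have Aix : A (- 'i%C *: x) by exact: (star_scale sA).
have := key _ Aix; rewrite /re_state (phiZ hN vA hphi) // ReNi => <-.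
have -> : alpha (- 'i%C *: x) = - 'i%C *: alpha x.
  apply: (@sot_cvg_uniq _ _ dot (beta^~ (- 'i%C *: x))); first exact: ba.
  move=> v; apply: null_le (ba Ax v) => n; have [hs _] := eb n.
  rewrite (endo_scale hN vA hs) // !fctE -scalerBr nsqZ /=.
  by rewrite oppr0 expr0n add0r sqrrN expr1n mul1r.
by rewrite (phiZ hN vA hphi) // ReNi.
Qed.

(** The GNS adjoint of alpha: the coefficients of beta_k^-1(x) against a and c are
    those of x against beta_k(a) and beta_k(c), which converge; so do those of
    convex combinations, and these can be chosen strongly convergent. *)
Lemma limit_dagger x : A x -> exists2 y, A y &
  (forall a c, A a -> A c -> fre (a \o y \o c) = fre (alpha a \o x \o alpha c)) /\
  (positive_op dot x -> positive_op dot y).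
Proof.
move=> Ax; have [C C0 xC] := bounded_op_nbound hN (star_bounded sA Ax).
pose S n := [set beta' k x | k in [set k | (n <= k)%N]].
have SA n : S n `<=` A.
  by move=> _ [k _ <-]; have [[gA _ _ _ _] _] := eb' k; exact: gA.
have SC n y : S n y -> nbound dot C y.
  by move=> [k _ <-]; have [hs _] := eb' k; exact: (endo_nbound hN vA hs).
have [w [l [Sw Al lC [wl gl] _]]] : exists w l, [/\ forall n, hull (S n) (w n), A l, nbound dot C l,
    sot_cvg dot w l /\ null (fun n => gns (w n - l) (w n - l)) &
    forall n x, hull (S n) x -> gns (w n) (w n) <= gns x x + n.+1%:R^-1].
  apply: (hull_limit hN vA hphi C0 SA) => //.
    by move=> n; exists (beta' n x); exists n => /=.
  by move=> n _ [k /= nk <-]; exists k => //=; exact: ltnW.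
have Aw n : A (w n) by exact: hull_mem (SA n) _ (Sw n).
exists l => //; split; last first.
  move=> px; apply: sot_cvg_positive wl => n.
  elim: (Sw n) => [_ [k _ <-]|y z _ py _ pz]; last exact: positive_mid.
  by have [hs _] := eb' k; exact: (endo_positive hN vA hs).
move=> a c Aa Ac.
have [K K0 [aK cK CK]] := common_nbound Aa Ac C0.
have wK n : nbound dot K (w n).
  apply: nbound_le CK _; elim: (Sw n) => [y /SC //|y z _ hy _ hz]; exact: nbound_mid.
have xK : nbound dot K x by exact: nbound_le CK xC.
have h1 := sandwich_cvg hN vA hphi K0 (fun=> Aa) (fun=> aK) Aw wK (fun=> Ac) (fun=> cK)
  (@sot_cvg_cst _ _ dot a) wl (@sot_cvg_cst _ _ dot c).
apply: null_eq h1 _ => e e0.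
have := sandwich_cvg hN vA hphi K0 (fun n => bA n Aa) (fun n => bC n Aa aK)
  (fun=> Ax) (fun=> xK) (fun n => bA n Ac) (fun n => bC n Ac cK)
  (ba Aa) (@sot_cvg_cst _ _ dot x) (ba Ac).
move=> /(_ (e / 2) (divr_gt0 e0 (ltr0n _ 2)))[M _ hM].
exists M => // n /= Mn; apply: (@le_lt_trans _ _ (e / 2)); last by lra.
apply: (hull_fre (SA n) Aa Ac) (Sw n) => _ [k /= nk <-].
apply/ltW; have := hM k (leq_trans Mn nk); rewrite /=.
have [[b'A _ _ _ _] _] := eb' k.
by rewrite -{1}(bK k Ax) (state_endo_sandwich hN vA (eb k) Aa (b'A _ Ax) Ac).
Qed.

(** The expectation onto alpha(N) is alpha, after the expectation onto N, after the
    adjoint of alpha. *)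
Lemma image_projectable N : projectable dot A phi N ->
  projectable dot A phi (alpha @` N).
Proof.
move=> [sN NA ex]; have [hs hp] := limit_state_endo; have [aA al am aad a1] := hs.
have NA' x : N x -> A x by exact: NA.
split.
- split.
  + by move=> _ [x Nx <-]; apply: (star_bounded sA); exact/aA/NA.
  + by exists idfun => //; exact: (star_one sN).
  + move=> k _ _ [x Nx <-] [y Ny <-]; exists (k *: x + y); first exact: (star_lin sN).
    by apply: al; exact: NA.
  + move=> _ _ [x Nx <-] [y Ny <-]; exists (x \o y); first exact: (star_comp sN).
    by apply: am; exact: NA.
  + move=> _ [x Nx <-]; have Nx' := star_adj sN Nx.
    exists (alpha (adj x)); first by exists (adj x).
    by apply: aad; [exact: NA|exact: NA|exact: (star_adjP sN)].
- by move=> _ [x Nx <-]; exact/aA/NA.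
- move=> x Ax; have [y Ay [hy py]] := limit_dagger Ax.
  have [z [Nz hz] pz] := ex y Ay; exists (alpha z); last first.
    by move=> /py/pz; apply: (endo_positive hN vA hs); exact: NA.
  split; first by exists z.
  move=> _ _ [a Na <-] [c Nc <-].
  rewrite -hy; [|exact: NA|exact: NA]; rewrite hz //.
  by rewrite (state_endo_sandwich hN vA limit_state_endo) //; exact: NA.
Qed.

End EndoLimit.

(** The union of the generating algebras is GNS-dense by the bicommutant theorem,
    and the maps beta are GNS-isometric, so eventual constancy on that union
    makes beta x a GNS-Cauchy sequence for every x. *)
Lemma endo_limit_ex (beta : nat -> op -> op) (Nn : nat -> set op) :
  (forall n, endo (beta n)) ->
  (forall n, star_algebra dot (Nn n)) -> (forall n, Nn n `<=` A) ->
  (forall n, Nn n `<=` Nn n.+1) ->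
  (forall n x m, Nn n x -> (n <= m)%N -> beta m x = beta n x) ->
  smallest (von_neumann dot) (\bigcup_n Nn n) = A ->
  forall x, A x -> exists l, sot_cvg dot (beta^~ x) l.
Proof.
move=> eb sNn NA Nmono Nfix Agen x Ax.
have Nle n m : (n <= m)%N -> Nn n `<=` Nn m.
  elim: m => [|m IH]; first by rewrite leqn0 => /eqP ->.
  by rewrite leq_eqVlt => /orP[/eqP ->//|/IH h] y /h /Nmono.
set N := \bigcup_n Nn n in Agen.
have NNA : N `<=` A by move=> y [n _ /NA].
have sN : star_algebra dot N.
  split.
  - by move=> y [n _ /(star_bounded (sNn n))].
  - by exists 0%N => //; exact: (star_one (sNn 0%N)).
  - move=> k y z [n _ hy] [m _ hz]; exists (maxn n m) => //.
    apply: (star_lin (sNn _)); first exact: Nle (leq_maxl n m) _ hy.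
    exact: Nle (leq_maxr n m) _ hz.
  - move=> y z [n _ hy] [m _ hz]; exists (maxn n m) => //.
    apply: (star_comp (sNn _)); first exact: Nle (leq_maxl n m) _ hy.
    exact: Nle (leq_maxr n m) _ hz.
  - by move=> y [n _ /(star_star (sNn n))[z hz yz]]; exists z => //; exists n.
have cx : commutant (commutant N) x.
  rewrite -Agen in Ax; apply: Ax; split; last exact/sub_bicommutant/(star_bounded sN).
  exact: (bicommutant_von_neumann hN (star_bounded sN) (star_star sN)).
have bA n y : A y -> A (beta n y).
  by move=> Ay; have [[gA _ _ _ _] _] := eb n; exact: gA.
have [C C0 xC] := bounded_op_nbound hN (star_bounded sA Ax).
have [|||l [_ _ xl _]] :=
  @gns_cauchy_sot _ _ _ hN _ _ vA hphi C (beta^~ x) C0; last by exists l.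
- by move=> n; exact: bA.
- by move=> n; have [hs _] := eb n; exact: (endo_nbound hN vA hs).
move=> e e0; have e8 : 0 < e / 8 by rewrite divr_gt0.
have [y [n0 _ Ny] hy] := bicommutant_gns hN vA hphi sN NNA Ax cx e8.
have Ay := NA _ _ Ny; have Ad := star_sub sA Ax Ay.
have Ad' := star_sub sA Ay Ax.
exists n0 => n m Mn Mm.
have -> : beta n x - beta m x = beta n (x - y) + beta m (y - x).
  have [hn _] := eb n; have [hm _] := eb m.
  rewrite (endo_sub hN vA hn) // (endo_sub hN vA hm) //.
  by rewrite (Nfix _ _ _ Ny Mn) (Nfix _ _ _ Ny Mm) subrKA.
apply: le_lt_trans (psd_sqrD_le gF (bA n _ Ad) (bA m _ Ad')) _.
rewrite (state_endo_gns hN vA (eb n)) // (state_endo_gns hN vA (eb m)) //.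
by rewrite (psd_sqrBC gF Ay Ax); lra.
Qed.

End Limits.

(** * Braid relations *)

Section Braid.

Lemma sigma_braid i j : (i.+1 == j) || (j.+1 == i) ->
  (sigma i * sigma j * sigma i = sigma j * sigma i * sigma j)%g.
Proof.
move=> ij; rewrite -[LHS]/(braid_mul (braid_mul (sigma i) (sigma j)) (sigma i)).
rewrite -[RHS]/(braid_mul (braid_mul (sigma j) (sigma i)) (sigma j)).
by rewrite /sigma -!braid_class_cat; apply/braid_classP/braid_rel_braid.
Qed.

Lemma sigma_comm i j : (i.+1 < j)%N -> (sigma i * sigma j = sigma j * sigma i)%g.
Proof.
move=> ij; rewrite -[LHS]/(braid_mul (sigma i) (sigma j)).
rewrite -[RHS]/(braid_mul (sigma j) (sigma i)).
by rewrite /sigma -!braid_class_cat; apply/braid_classP/braid_rel_comm; rewrite ij.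
Qed.

(** The Coxeter element of the braid group on n + 1 strands. *)
Definition coxeter (n : nat) : braid_group := (\prod_(i < n) sigma i)%g.

Lemma coxeterS n : coxeter n.+1 = (coxeter n * sigma n)%g.
Proof. by rewrite /coxeter big_ord_recr. Qed.

Lemma coxeter_comm n j : (n < j)%N -> (sigma j * coxeter n = coxeter n * sigma j)%g.
Proof.
elim: n => [|n IH] nj; first by rewrite /coxeter big_ord0 mulg1 mul1g.
by rewrite coxeterS mulgA IH ?(ltnW nj) // -!mulgA -(sigma_comm nj).
Qed.

(** Conjugation by a Coxeter element shifts the generators. The case m = k + 2 is
    the braid relation; later factors commute with sigma k. *)
Lemma coxeter_shift k m : (k.+1 < m)%N ->
  (sigma k.+1 * coxeter m = coxeter m * sigma k)%g.
Proof.
elim: m => // m IH; rewrite ltnS leq_eqVlt => /orP[/eqP <-|km].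
  rewrite !coxeterS !mulgA coxeter_comm // -!mulgA; congr (_ * _)%g.
  by rewrite !mulgA sigma_braid ?eqxx ?orbT.
by rewrite coxeterS mulgA IH // -!mulgA (sigma_comm km).
Qed.

End Braid.

(** * The triangular tower *)

Section Tower.
Context {R : realType} {H : completeNormedModType R[i]}.
Variable dot : {dot H for Num.conj}.
Hypothesis hN : hilbert_norm dot.
Local Notation op := (H -> H).
Local Notation adj := (adj dot).
Variables (A : set op) (phi : op -> R[i]) (rho : braid_group -> op -> op).
Hypotheses (vA : von_neumann dot A) (hphi : faithful_normal_state dot A phi).
Hypotheses (hrho : representation dot A phi rho) (hgen : generating dot A rho).
Local Notation gns := (gns_ip dot phi).
Local Notation fre := (re_state phi).
Local Notation endo := (state_endo dot A phi).
Local Notation T := (tower A rho).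
Implicit Types (x y z a b c : op) (N : set op).

Let sA : star_algebra dot A := von_neumann_star hN vA.
Let gF : psd_form A gns := gns_form hN vA hphi.

Lemma rho_endo g : endo (rho g).
Proof. by apply: (automorphism_state_endo hN vA); exact: hrho.1. Qed.

Lemma rho_mem g x : A x -> A (rho g x).
Proof. by move=> Ax; have [[h _ _ _ _] _] := rho_endo g; exact: h. Qed.

Lemma rhoM g h x : A x -> rho (g * h)%g x = rho g (rho h x).
Proof. exact: hrho.2. Qed.

Lemma rho1 x : A x -> rho 1%g x = x.
Proof.
move=> Ax; have [[_ inj _] _ _ _ _] := hrho.1 1%g.
apply: inj; rewrite ?inE //; first exact: rho_mem.
by rewrite -rhoM // mulg1.
Qed.

Lemma rhoVK g x : A x -> rho g (rho g^-1%g x) = x.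
Proof. by move=> Ax; rewrite -rhoM // mulgV rho1. Qed.

Lemma rhoKV g x : A x -> rho g^-1%g (rho g x) = x.
Proof. by move=> Ax; rewrite -rhoM // mulVg rho1. Qed.

(** The stabiliser of x is a subgroup, so the generators suffice. *)
Lemma towerP n x : T n x <-> A x /\ forall k, (n <= k)%N -> rho (sigma k) x = x.
Proof.
split=> [[Ax hx]|[Ax hx]]; split=> //.
  by move=> k nk; apply: hx; apply: sub_gen_smallest; exists k.
pose S := [set g : braid_group | rho g x = x].
have subS : subgroup S.
  split=> [|g h gx hx'|g gx]; rewrite /S /=; first exact: rho1.
    by rewrite rhoM // hx' gx.
  by rewrite -{1}gx rhoKV.
by move=> g tg; apply: (smallest_sub subS _ tg) => _ [k nk <-]; exact: hx.
Qed.

Lemma tower_sub n : T n `<=` A. Proof. by move=> x []. Qed.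

Lemma tower_mono n : T n `<=` T n.+1.
Proof. by move=> x /towerP[Ax hx]; apply/towerP; split=> // k /ltnW; exact: hx. Qed.

Lemma tower_projectable n : projectable dot A phi (T n).
Proof.
pose G := [set rho g | g in braid_tail n].
have -> : T n = [set x | A x /\ forall f, G f -> f x = x].
  apply/seteqP; split=> x [Ax hx]; split=> //.
    by move=> _ [g tg <-]; exact: hx.
  by move=> g tg; apply: hx; exists g.
have tail1 : braid_tail n 1%g by move=> S [[]].
have tailM g h : braid_tail n g -> braid_tail n h -> braid_tail n (g * h)%g.
  by move=> hg hh S hS; have [[_ SM _] _] := hS; apply: SM; [exact: hg|exact: hh].
apply: (fixed_projectable hN vA hphi).
- by exists (rho 1%g); exists 1%g.
- by move=> _ [g _ <-]; exact: rho_endo.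
- move=> _ _ [g tg <-] [h th <-]; exists (rho (g * h)%g); last by move=> x; exact: rhoM.
  by exists (g * h)%g => //; exact: tailM.
Qed.

Lemma self_projectable : projectable dot A phi A.
Proof. by split=> // x Ax; exists x. Qed.

Local Notation beta := (fun n => rho (coxeter n)).
Local Notation alpha := (limit_endo rho).

Lemma coxeter_tower n m x : T n x -> (n <= m)%N -> beta m x = beta n x.
Proof.
move=> /towerP[Ax hx]; elim: m => [|m IH]; first by rewrite leqn0 => /eqP ->.
rewrite leq_eqVlt => /orP[/eqP -> //|nm].
by rewrite coxeterS rhoM // hx // IH.
Qed.

Lemma limit_endo_cvg x : A x -> sot_cvg dot (beta^~ x) (alpha x).
Proof.
move=> Ax.
have [l xl] := endo_limit_ex hN vA hphi (fun n => rho_endo (coxeter n))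
  (fun n => projectable_star (tower_projectable n)) tower_sub tower_mono
  (fun n x m => @coxeter_tower n m x) hgen Ax.
pose P := fun y : op => {ptws, (fun n => rho (\prod_(i < n) sigma i)%g x) @ \oo --> y}.
have ex : exists y, P y.
  by exists l; apply/pointwise_cvgP => v; apply/(cvg_nsq hN); exact: xl.
have /pointwise_cvgP h := getPex ex.
by move=> v; apply/(cvg_nsq hN); exact: h.
Qed.

Let bK n x : A x -> rho (coxeter n) (rho (coxeter n)^-1%g x) = x.
Proof. exact: rhoVK. Qed.

Lemma alpha_endo : endo alpha.
Proof.
exact: (limit_state_endo hN vA hphi (fun n => rho_endo (coxeter n)) limit_endo_cvg).
Qed.

Lemma alpha_mem x : A x -> A (alpha x).
Proof. by move=> Ax; have [[h _ _ _ _] _] := alpha_endo; exact: h. Qed.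

Lemma alpha_projectable N : projectable dot A phi N ->
  projectable dot A phi (alpha @` N).
Proof.
exact: (image_projectable hN vA hphi (fun n => rho_endo (coxeter n))
  (fun n => rho_endo (coxeter n)^-1%g) bK limit_endo_cvg).
Qed.

Lemma alpha_tower0 x : T 0 x -> alpha x = x.
Proof.
move=> Tx; have Ax := tower_sub Tx; apply: (@sot_cvg_uniq _ _ dot (beta^~ x)).
  exact: limit_endo_cvg.
move=> v; apply: null_le (@sot_cvg_cst _ _ dot x v) => n /=.
by rewrite (coxeter_tower Tx (leq0n n)) /coxeter big_ord0 rho1.
Qed.

(** [coxeter_shift] in the limit; rho(sigma_(k+1)) is GNS-isometric, so it passes
    through the limit defining alpha. *)
Lemma alpha_shift k x : A x -> rho (sigma k.+1) (alpha x) = alpha (rho (sigma k) x).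
Proof.
move=> Ax; have Ask := rho_mem (sigma k) Ax; have Aa := alpha_mem Ax.
have Ara := rho_mem (sigma k.+1) Aa; have Aas := alpha_mem Ask.
have [C C0 xC] := bounded_op_nbound hN (star_bounded sA Ax).
have [C' C'0 sC] := bounded_op_nbound hN (star_bounded sA Ask).
have bA n y : A y -> A (beta n y) by exact: rho_mem.
have bC n (D : R) y : A y -> nbound dot D y -> nbound dot D (beta n y).
  by move=> Ay yD; have [hs _] := rho_endo (coxeter n); exact: (endo_nbound hN vA hs).
have g1 := sot_cvg_gns hN vA hphi C0 (fun n => bA n _ Ax)
  (fun n => bC n _ _ Ax xC) Aa (limit_endo_cvg Ax).
have g2 := sot_cvg_gns hN vA hphi C'0 (fun n => bA n _ Ask)
  (fun n => bC n _ _ Ask sC) Aas (limit_endo_cvg Ask).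
have Ad := star_sub sA Ara Aas.
apply/eqP; rewrite -subr_eq0; apply/eqP/(gns_faithful hN vA hphi Ad).
apply: (null_cst_eq0 (psd_ge0 gF Ad)) => e e0.
have := nullD (nullZ (ler0n _ 2) g1) (nullZ (ler0n _ 2) g2) e0.
move=> [M _ hM]; exists (maxn M k.+2) => // n /=; rewrite geq_max => /andP[Mn kn].
apply: le_lt_trans (hM n Mn) => /=.
have Abn := bA n _ Ax; have Abs := bA n _ Ask.
have Arb := rho_mem (sigma k.+1) Abn.
have eqn : rho (sigma k.+1) (beta n x) = beta n (rho (sigma k) x).
  by rewrite -!rhoM // coxeter_shift.
have := psd_sqrD_le gF (star_sub sA Ara Arb) (star_sub sA Arb Aas).
rewrite subrKA; have [hs _] := rho_endo (sigma k.+1).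
rewrite -{1}(endo_sub hN vA hs) // -{1}(endo_sub hN vA hs) //.
rewrite (state_endo_gns hN vA (rho_endo _)); try exact: (star_sub sA).
by rewrite (psd_sqrBC gF Aa Abn) eqn; lra.
Qed.

Lemma alpha_tower n x : T n x -> T n.+1 (alpha x).
Proof.
move=> /towerP[Ax hx]; apply/towerP; split; first exact: alpha_mem.
by case=> // k; rewrite ltnS => nk; rewrite alpha_shift // hx.
Qed.

(** The adjoint of alpha intertwines rho(sigma_(k+1)) with rho(sigma_k), so it
    lowers the level in the tower. *)
Lemma dagger_tower n y : T n.+1 y -> exists2 x, T n x &
  forall a c, A a -> A c -> fre (a \o x \o c) = fre (alpha a \o y \o alpha c).
Proof.
move=> /towerP[Ay hy].
have [x Ax [hx _]] := limit_dagger hN vA hphi (fun n => rho_endo (coxeter n))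
  (fun n => rho_endo (coxeter n)^-1%g) bK limit_endo_cvg Ay.
exists x => //; apply/towerP; split=> // k nk.
have A1 := star_one sA; have [[_ _ _ _ a1] _] := alpha_endo.
pose g := rho (sigma k); pose h := rho (sigma k.+1).
have Agx : A (g x) by exact: rho_mem.
have Ad := star_sub sA Agx Ax.
(* Move g to the other side, apply the adjunction, use h alpha = alpha g, and undo
   the adjunction since h fixes y. *)
have key a : A a -> fre (a \o g x) = fre (a \o x).
  move=> Aa; pose b := rho (sigma k)^-1%g a; have Ab : A b by exact: rho_mem.
  have gb : g b = a by exact: rhoVK.
  have gm u v : A u -> A v -> g (u \o v) = g u \o g v.
    by have [[_ _ m _ _] _] := rho_endo (sigma k); exact: m.
  have hm u v : A u -> A v -> h (u \o v) = h u \o h v.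
    by have [[_ _ m _ _] _] := rho_endo (sigma k.+1); exact: m.
  have hx1 c : A c -> fre (c \o x) = fre (alpha c \o y).
    by move=> Ac; have := hx c idfun Ac A1; rewrite a1.
  have Aab := alpha_mem Ab.
  rewrite -{1}gb -gm // (state_endo_fre (rho_endo _)); last exact: (star_comp sA).
  rewrite hx1 // -(state_endo_fre (rho_endo (sigma k.+1))); last exact: (star_comp sA).
  rewrite -/h hm // /h alpha_shift // -/g gb hy //.
  by rewrite hx1.
apply/eqP; rewrite -subr_eq0; apply/eqP/(gns_faithful hN vA hphi Ad).
have Ad' := star_adj sA Ad.
rewrite /gns_ip (compBr _ _ (star_bounded sA Ad')) (freB hN vA hphi); try exact: (star_comp sA).
by rewrite key // subrr.
Qed.

Lemma iter_endo k : endo (iter k alpha).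
Proof.
elim: k => [|k [[mA ml mm ma m1] mp]]; first by split.
have [[aA al am aad a1] ap] := alpha_endo; split; first split => /=.
- by move=> x Ax; exact/aA/mA.
- by move=> c x y Ax Ay /=; rewrite ml // al //; exact: mA.
- by move=> x y Ax Ay /=; rewrite mm // am //; exact: mA.
- by move=> x y Ax Ay xy /=; apply: aad; [exact: mA|exact: mA|exact: ma].
- by rewrite /= m1.
- by move=> x Ax /=; rewrite ap ?mp //; exact: mA.
Qed.

Lemma iter_projectable k N : projectable dot A phi N ->
  projectable dot A phi (iter k alpha @` N).
Proof.
move=> pN; elim: k => [|k IH]; first by rewrite image_id.
by have := alpha_projectable IH; rewrite image_comp.
Qed.

(** For y = alpha^k(y0), the expectation onto alpha^(k+1)(A) is
    alpha^(k+1)(alpha'(y0)), where alpha' lowers the level of y0. *)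
Lemma tower_is_proj k n y : (iter k alpha @` T n.+1) y ->
  exists2 z, (iter k.+1 alpha @` T n) z & is_proj phi (iter k.+1 alpha @` A) y z.
Proof.
move=> [y0 Ty <-]; have Ay := tower_sub Ty.
have [x Tx hx] := dagger_tower Ty; have Ax := tower_sub Tx.
exists (iter k.+1 alpha x); first by exists x.
split; first by exists x.
move=> _ _ [a Aa <-] [c Ac <-].
rewrite (state_endo_sandwich hN vA (iter_endo k.+1)) // hx //.
rewrite !iterSr (state_endo_sandwich hN vA (iter_endo k)) //; exact: alpha_mem.
Qed.

End Tower.

Theorem theorem3p9 (R : realType) (H : completeNormedModType R[i])
    (dot : {dot H for Num.conj}) (A : set (H -> H))
    (phi : (H -> H) -> R[i]) (rho : braid_group -> (H -> H) -> (H -> H)) :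
  hilbert_norm dot ->
  probability_space dot A phi ->
  representation dot A phi rho ->
  generating dot A rho ->
  let alpha := limit_endo rho in
  let T (k n : nat) : set (H -> H) := iter k alpha @` tower A rho n in
  let TA (k : nat) : set (H -> H) := iter k alpha @` A in
  [/\ alpha @` tower A rho 0 = tower A rho 0,
      forall k n : nat,
        [/\ T k n `<=` T k n.+1, T k n `<=` TA k,
            T k.+1 n `<=` T k n.+1 & TA k.+1 `<=` TA k],
      forall k n : nat,
        commuting_square dot A phi
          (T k n.+1) (T k n.+2) (T k.+1 n) (T k.+1 n.+1) &
      forall k n : nat,
        commuting_square dot A phi
          (T k n.+1) (TA k) (T k.+1 n) (TA k.+1)].
Proof.
move=> hN [vA _ hphi] hrho hgen alpha T TA.
have incl k n : [/\ T k n `<=` T k n.+1, T k n `<=` TA k,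
    T k.+1 n `<=` T k n.+1 & TA k.+1 `<=` TA k].
  split; [apply: image_subset|apply: image_subset| |].
  - exact: (tower_mono hN vA hrho).
  - exact: tower_sub.
  - move=> _ [x Tx <-]; exists (alpha x); last by rewrite iterSr.
    exact: (alpha_tower hN vA hphi hrho hgen).
  - move=> _ [x Ax <-]; exists (alpha x); last by rewrite iterSr.
    exact: (alpha_mem hN vA hphi hrho hgen).
have pT k n : projectable dot A phi (T k n).
  apply: (iter_projectable hN vA hphi hrho hgen).
  exact: (tower_projectable hN vA hphi hrho).
have pTA k : projectable dot A phi (TA k).
  apply: (iter_projectable hN vA hphi hrho hgen); exact: (self_projectable hN phi vA).
have key k n y : T k n.+1 y -> exists2 z, T k.+1 n z & is_proj phi (TA k.+1) y z.
  exact: (tower_is_proj hN vA hphi hrho hgen).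
split.
- have aT x : tower A rho 0 x -> alpha x = x.
    exact: (alpha_tower0 hN vA hphi hrho hgen).
  apply/seteqP; split=> [_ [x Tx <-]|x Tx]; first by rewrite aT.
  by exists x; last exact: aT.
- exact: incl.
- move=> k n; have [i1 i2 i3 i4] := incl k n; have [j1 j2 j3 j4] := incl k n.+1.
  have [k1 k2 _ _] := incl k.+1 n; have [l1 l2 _ _] := incl k.+1 n.+1.
  apply: (commuting_square_of_proj hN vA hphi) => //.
  move=> y /key[z Tz pz]; exists z => //.
  by apply: is_proj_sub pz => //; exact: k1.
- move=> k n; have [i1 i2 i3 i4] := incl k n; have [j1 j2 j3 j4] := incl k n.+1.
  have [k1 k2 _ _] := incl k.+1 n.
  apply: (commuting_square_of_proj hN vA hphi) => //; exact: key.
Qed.
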